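(* Let $(W,S)$ be a Coxeter system, let $P=|W|_0$ be its Davis--Moussong realization and let $G(W,S)$ be the group of automorphisms of its Coxeter diagram. (a) If $(W,S)$ is rigid, then $\mathrm{Aut}(P)$ is discrete: it is the semidirect product of $W$ and $G(W,S)$. (b) Suppose that $(W,S)$ is not rigid and that $W$ is Gromov-hyperbolic. Then for every $s\in S$ and every non-trivial $f\in G(W,S)$ fixing the facet $\phi_s$ (pointwise), the wall $M_s$ passing through $\phi_s$ is proper. Moreover there exists an automorphism $\varphi$ of $P$ whose restriction to the star of $x_0$ in $P$ is that of $\hat f$ and which strictly fixes $M_s$. In particular $\mathrm{Aut}^+(P)\neq\{1\}$ and $\mathrm{Aut}(P)$ is non-discrete.
   Context: $S$ is finite, with Coxeter matrix $(m_{s,t})$; $G(W,S)$ is the group of permutations $f$ of $S$ with $m_{f(s),f(t)}=m_{s,t}$. For $T\subset S$, $W_T$ is the subgroup generated by $T$. The finite nerve $N$ is the simplicial complex with vertex set $S$ whose simplices are the $T\subset S$ with $W_T$ finite; $N'$ is its barycentric subdivision; the facet $\phi_s$ is the (closed) star of the vertex $s$ in $N'$. Let $x_0*N'$ be the simplicial cone on $N'$ with apex $x_0$. The quotient $P'=W\times(x_0*N')/\sim$, where $\sim$ is generated by $(w,x)\sim(ws,x)$ for $s\in S$, $x\in\phi_s$, is the barycentric subdivision of a $\mathrm{CAT}(0)$ Euclidean polyhedral complex $P=|W|_0$, the Davis--Moussong realization. Write $[w,x]$ for the class of $(w,x)$ and identify $x$ with $[1,x]$. The vertices of $P$ are the points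 $wx_0=[w,x_0]$, its $1$-skeleton is the Cayley graph of $(W,S)$, and $W$ acts by left multiplication. Each $f\in G(W,S)$ acts on $N'$, extends conically to $x_0*N'$, and induces an automorphism $\overline f$ of $W$; the automorphism $\hat f$ of $P$ is $\hat f([w,x])=[\overline f(w),f(x)]$. It fixes $x_0$, and $f\mapsto\hat f$ embeds $G(W,S)$ in $\mathrm{Aut}(P)$. To fix $\phi_s$ pointwise means $f(s)=s$ and $f(t)=t$ for all $t$ with $m_{s,t}<\infty$. $(W,S)$ is rigid if for every $s\in S$ the only element of $G(W,S)$ fixing $\phi_s$ pointwise is the identity. The walls of $P$ are the fixed point sets in $P$ of the conjugates of elements of $S$; $M_s$ is the fixed set of $s$, and contains $\phi_s$. The complement of a wall $M$ has two components; when $W$ is hyperbolic, $M$ is proper if $\partial P\setminus\partial A\neq\emptyset$ for each component $A$ of $P\setminus M$ ($\partial P$ the Gromov boundary, $\partial A=\overline A\cap\partial P$). $\mathrm{Aut}(P)$ is the group of automorphisms of the cell complex $P$ (two being identified if they send each open cell to the same open cell), with the compact-open topology. An automorphism strictly fixes $M$ if it fixes $M$ pointwise and preserves both components of $P\setminus M$; $\mathrm{Aut}^+(P)$ is the subgroup generated by the automorphisms strictly fixing some proper wall. *)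

(* Defs.v *)
From HB Require Import structures.
From Stdlib Require Import Relation_Operators.
From mathcomp Require Import all_boot all_order all_algebra all_fingroup.
From mathcomp Require Import all_classical all_reals all_analysis.

Set Implicit Arguments.
Unset Strict Implicit.
Unset Printing Implicit Defensive.

Import Order.TTheory GRing.Theory Num.Theory.
Import numFieldNormedType.Exports.

Local Open Scope classical_set_scope.
Local Open Scope ring_scope.
Local Open Scope quotient_scope.

Local Notation repr := generic_quotient.repr.

Section Groups.
Local Open Scope group_scope.
Variable G : groupType.
Implicit Types (A N H : set G).

Definition is_subgroup A : Prop :=
  [/\ A 1, (forall x y, A x -> A y -> A (x * y))
    & (forall x, A x -> A x^-1)].

Definition subgroup_gen A : set G := smallest is_subgroup A.

Definition is_semidirect_product N H : Prop :=
  [/\ is_subgroup N, is_subgroup H,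
      (forall g x, N x -> N (g * x * g^-1)),
      N `&` H = [set 1]
    & (forall g, exists x y, [/\ N x, H y & g = x * y])].

Lemma subgroup_gen_set0 : subgroup_gen set0 = [set 1].
Proof.
apply/seteqP; split => [x|x ->]; last by move=> A [] [].
apply; split=> //; split => //= [y z -> ->|y ->].
  by rewrite mulg1.
by rewrite invg1.
Qed.

End Groups.

Section Coxeter.
Local Open Scope group_scope.
Variables (W : groupType) (S : finType).
Variables (m : S -> S -> option nat) (gen : S -> W).

(* [None] is the entry "infinity". *)
Definition is_coxeter_matrix : Prop :=
  [/\ (forall s, m s s = Some 1%N),
      (forall s t, m s t = m t s)
    & (forall s t k, s != t -> m s t = Some k -> (2 <= k)%N)].

(* [W] has the presentation < S | (st)^m(s,t) = 1 for m(s,t) finite >. *)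
Definition is_coxeter_system : Prop :=
  [/\ is_coxeter_matrix,
      subgroup_gen (range gen) = [set: W],
      (forall s t k, m s t = Some k -> (gen s * gen t) ^+ k = 1)
    & (forall (H : groupType) (h : S -> H),
        (forall s t k, m s t = Some k -> (h s * h t) ^+ k = 1) ->
        exists phi : W -> H,
          {morph phi : x y / x * y} /\ (forall s, phi (gen s) = h s))].

Definition is_diagram_aut (f : {perm S}) : Prop :=
  forall s t, m (f s) (f t) = m s t.

(* [f] fixes the facet of [s] pointwise. *)
Definition fixes_facet (f : {perm S}) (s : S) : Prop :=
  f s = s /\ forall t, m s t <> None -> f t = t.

Definition is_rigid : Prop :=
  forall s (f : {perm S}), is_diagram_aut f -> fixes_facet f s -> f = 1.

Definition parabolic (T : {set S}) : set W := subgroup_gen (gen @` [set` T]).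

(* Simplices of the finite nerve, together with the empty set. *)
Definition spherical (T : {set S}) : Prop := finite_set (parabolic T).

Lemma spherical0 : spherical finset.set0.
Proof.
rewrite /spherical /parabolic [X in gen @` X](_ : _ = set0).
  by rewrite image_set0 subgroup_gen_set0; exact: finite_set1.
by rewrite predeqE => s /=; rewrite inE.
Qed.

(* The automorphism of [W] extending the permutation [f] of [S]; it exists and
   is unique when [f] is a diagram automorphism of a Coxeter system. *)
Definition induced_aut (f : {perm S}) : W -> W :=
  xget (id : W -> W) [set phi : W -> W |
    {morph phi : x y / x * y} /\ forall s, phi (gen s) = gen (f s)].

Definition word_prod (w : seq S) : W := foldr (fun s x => gen s * x) 1 w.

End Coxeter.

Section GromovBoundary.
Variables (R : realType) (X : Type) (d : X -> X -> R).

Definition gromov_product (o x y : X) : R := (d o x + d o y - d x y) / 2.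

Definition gromov_hyperbolic : Prop := exists delta : R, forall o x y z,
  Num.min (gromov_product o x y) (gromov_product o y z) - delta
    <= gromov_product o x z.

Variable o : X.

Definition equiv_at_infinity (u v : nat -> X) : Prop :=
  forall K : R, exists N : nat, forall i j : nat, (N <= i)%N -> (N <= j)%N ->
    K <= gromov_product o (u i) (v j).

Definition converges_at_infinity (u : nat -> X) : Prop :=
  equiv_at_infinity u u.

Definition boundary_point (u : nat -> X) : set (nat -> X) :=
  [set v | converges_at_infinity v /\ equiv_at_infinity u v].

Definition gromov_boundary : set (set (nat -> X)) :=
  boundary_point @` converges_at_infinity.

(* The trace on the boundary of the closure of [A]: a boundary point is
   adherent to [A] iff it is the limit of a sequence in [A]. *)
Definition boundary_of (A : set X) : set (set (nat -> X)) :=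
  boundary_point @` [set u | converges_at_infinity u /\ forall n, A (u n)].

End GromovBoundary.

Section WordMetric.
Variables (R : realType) (W : groupType) (S : finType) (gen : S -> W).

Definition word_length (x : W) : R :=
  inf [set (size w)%:R | w in [set w | word_prod gen w = x]].

Definition word_dist (x y : W) : R := word_length (x^-1 * y)%g.

Definition hyperbolic_group : Prop := gromov_hyperbolic word_dist.

End WordMetric.

Section Davis.
Variables (R : realType) (W : groupType) (S : finType) (gen : S -> W).

(* Barycentric coordinates on the cone x0 * N'. Its vertices are the spherical
   subsets of [S], the empty one being the apex x0; its simplices are the
   chains for inclusion. *)
Definition in_cone : set {ptws {set S} -> R} :=
  [set x | [/\ (forall T, 0 <= x T), \sum_T x T = 1,
      (forall T, x T != 0 -> spherical gen T)
    & (forall T U, x T != 0 -> x U != 0 -> T \subset U \/ U \subset T)]].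

Definition cone : Type := set_type in_cone.
HB.instance Definition _ := Topological.on cone.
HB.instance Definition _ := SubChoice.on cone.

Definition bcoord (x : cone) : {set S} -> R := val x.

Definition apex_coord : {ptws {set S} -> R} := fun T => (T == finset.set0)%:R.

Lemma apex_in_cone : apex_coord \in in_cone.
Proof.
rewrite inE; split => [T|||]; rewrite /apex_coord.
- exact: ler0n.
- by rewrite (bigD1 finset.set0) //= eqxx big1 ?addr0 // => T /negbTE ->.
- by move=> T; case: (eqVneq T finset.set0) => [-> _|_]; [exact: spherical0 | rewrite eqxx].
- move=> T U; case: (eqVneq T finset.set0) => [-> _ _|_]; last by rewrite eqxx.
  by left; exact: finset.sub0set.
Qed.

Definition apex : cone := SigSub apex_in_cone.

(* The closed star of the vertex [s] in N'. *)
Definition facet (s : S) : set cone :=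
  [set x | forall T, bcoord x T != 0 -> s \in T].

Definition chambers : Type := (discrete_topology W * cone)%type.
HB.instance Definition _ := Topological.on chambers.

Definition glue (p q : chambers) : Prop := exists (w : W) s x,
  [/\ facet s x, p = (w, x) & q = ((w * gen s)%g, x)].

Definition davis_rel : rel chambers :=
  fun p q => `[< clos_refl_sym_trans chambers glue p q >].

Lemma davis_relP : equiv_class_of davis_rel.
Proof.
split.
- by move=> p; apply/asboolP; exact: rst_refl.
- by move=> p q; apply: asbool_equiv_eq; split; exact: rst_sym.
- move=> q p r /asboolP pq /asboolP qr; apply/asboolP.
  exact: rst_trans pq qr.
Qed.

Canonical davis_equiv := EquivRelPack davis_relP.

(* The Davis-Moussong realization P, with the quotient topology. *)
Definition davis : Type := quotient_topology {eq_quot davis_rel}.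
HB.instance Definition _ := Topological.on davis.
HB.instance Definition _ := Quotient.on davis.

Definition pt (w : W) (x : cone) : davis := \pi_davis ((w, x) : chambers).

Definition base_vertex : davis := pt 1%g apex.

Definition wact (w : W) (p : davis) : davis :=
  pt (w * (repr p).1)%g (repr p).2.

Lemma ptP w x w' x' :
  pt w x = pt w' x' <-> clos_refl_sym_trans chambers glue (w, x) (w', x').
Proof.
rewrite -[X in _ <-> X]asboolE.
exact: rwP (@eqmodP _ davis_equiv (w, x) (w', x')).
Qed.

Lemma wactE v w x : wact v (pt w x) = pt (v * w)%g x.
Proof.
have : pt (repr (pt w x)).1 (repr (pt w x)).2 = pt w x.
  by rewrite /pt -surjective_pairing reprK.
rewrite /wact; case: (repr _) => w' x' /= /ptP glued; apply/ptP.
pose L (p : chambers) : chambers := ((v * p.1)%g, p.2).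
suff : forall p q, clos_refl_sym_trans chambers glue p q ->
    clos_refl_sym_trans chambers glue (L p) (L q) by move=> /(_ _ _ glued).
move=> p q; elim=> {p q} [p q [u [s [y [sy -> ->]]]]|p|p q _|p q r _ pq _].
- by apply: rst_step; exists (v * u)%g, s, y; rewrite /L/= mulgA.
- exact: rst_refl.
- exact: rst_sym.
- exact: rst_trans pq.
Qed.

(* The support of [x] consists of vertices of the closed cell of [T]. *)
Definition below (T : {set S}) (x : cone) : Prop :=
  forall U, bcoord x U != 0 -> U \subset T.

(* The closed cell whose set of vertices is (w W_T) x0, and its interior. *)
Definition closed_cell (w : W) (T : {set S}) : set davis :=
  [set p | exists u x, [/\ parabolic gen T u, below T x & p = pt (w * u)%g x]].

Definition open_cell (w : W) (T : {set S}) : set davis :=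
  [set p | exists u x, [/\ parabolic gen T u, below T x, bcoord x T != 0
                         & p = pt (w * u)%g x]].

Definition is_open_cell (C : set davis) : Prop :=
  exists w T, spherical gen T /\ C = open_cell w T.

Definition base_star : set davis :=
  [set p | exists w T, [/\ spherical gen T, closed_cell w T base_vertex
                         & closed_cell w T p]].

(* The image of [x] under the simplicial automorphism of x0 * N' sending the
   vertex [T] to [f T]; the default value [apex] is not used when [f] is a
   diagram automorphism. *)
Definition cone_map (f : {perm S}) (x : cone) : cone :=
  insubd apex (fun T => bcoord x (f @^-1: T)).

Definition hat (f : {perm S}) (p : davis) : davis :=
  pt (induced_aut gen f (repr p).1) (cone_map f (repr p).2).

Definition wall_of (s : S) : set davis := [set p | wact (gen s) p = p].

Definition is_wall (M : set davis) : Prop :=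
  exists w s, M = [set p | wact (w * gen s * w^-1)%g p = p].

Definition is_component (M A : set davis) : Prop :=
  exists2 p, (~` M) p & A = connected_component (~` M) p.

Definition fixes_strictly (h : davis -> davis) (M : set davis) : Prop :=
  (forall p, M p -> h p = p) /\ (forall A, is_component M A -> h @` A = A).

Definition is_cell_aut : set (@compact_open davis davis) :=
  [set h | [/\ bijective h, continuous (h : davis -> davis),
      (forall g : davis -> davis, cancel h g -> continuous g)
    & (forall C, is_open_cell C <-> is_open_cell (h @` C))]].

(* The homeomorphisms of P permuting the open cells, with the compact-open
   topology. *)
Definition cell_aut : Type := set_type is_cell_aut.
HB.instance Definition _ := Topological.on cell_aut.
HB.instance Definition _ := SubChoice.on cell_aut.

Definition cell_fun (h : cell_aut) : davis -> davis := val h.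

Definition same_cells : rel cell_aut := fun h k =>
  `[< forall C, is_open_cell C -> cell_fun h @` C = cell_fun k @` C >].

Lemma same_cellsP : equiv_class_of same_cells.
Proof.
split.
- by move=> h; apply/asboolP.
- by move=> h k; apply: asbool_equiv_eq; split => hk C oC; rewrite hk.
- move=> h k l /asboolP kh /asboolP hl; apply/asboolP => C oC.
  by rewrite kh// hl.
Qed.

Canonical same_cells_equiv := EquivRelPack same_cellsP.

(* The group Aut(P), with the quotient topology. *)
Definition AutP : Type := quotient_topology {eq_quot same_cells}.
HB.instance Definition _ := Topological.on AutP.
HB.instance Definition _ := Quotient.on AutP.

Definition represents (h : davis -> davis) (a : AutP) : Prop :=
  exists2 k : cell_aut, a = \pi_AutP k & cell_fun k = h.

Lemma id_cell_aut : (id : davis -> davis) \in is_cell_aut.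
Proof.
rewrite inE; split.
- by exists id.
- by move=> p; exact: cvg_id.
- move=> g gK; have -> : g = id by apply/funext => p; exact: gK.
  by move=> p; exact: cvg_id.
- by move=> C; rewrite image_id.
Qed.

Lemma comp_cell_aut (h k : cell_aut) :
  (cell_fun h \o cell_fun k : davis -> davis) \in is_cell_aut.
Proof.
case: h k => h hP [k kP]; rewrite /cell_fun /=.
move: hP kP; rewrite !inE => -[bh ch ch' oh] [bk ck ck' ok]; split.
- exact: bij_comp.
- by move=> p; apply: continuous_comp; [exact: ck | exact: ch].
- case: (bh) (bk) => h' hK h'K [k' kK k'K] g gK.
  have -> : g = k' \o h'.
    by apply/funext => p; rewrite -{1}(h'K p) -{1}(k'K (h' p)); exact: gK.
  move=> p; apply: continuous_comp; first exact: ch' hK _.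
  exact: ck' kK _.
- by move=> C; rewrite -(image_comp k h); exact: iff_trans (ok C) (oh _).
Qed.

Lemma inv_cell_aut (h : cell_aut) :
  {h' : davis -> davis | [/\ h' \in is_cell_aut, cancel (cell_fun h) h'
                           & cancel h' (cell_fun h)]}.
Proof.
apply: cid; case: h => h hP; rewrite /cell_fun /=.
move: hP; rewrite inE => -[[h' hK h'K] ch ch' oh]; exists h'; split => //.
rewrite inE; split.
- by exists h.
- exact: ch' hK.
- move=> g gK; have -> // : g = h.
  by apply/funext => p; rewrite -{1}(hK p) gK.
- move=> C; have {1}-> : C = h @` (h' @` C).
    rewrite image_comp (_ : h \o h' = id) ?image_id //.
    by apply/funext => p; exact: h'K.
  exact: iff_sym (oh _).
Qed.

Definition id_aut : cell_aut := SigSub id_cell_aut.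
Definition comp_aut (h k : cell_aut) : cell_aut :=
  SigSub (comp_cell_aut h k).
Definition inv_aut (h : cell_aut) : cell_aut :=
  let: exist h' hP := inv_cell_aut h in
  let: And3 h'P _ _ := hP in SigSub h'P.

Lemma comp_autE h k : cell_fun (comp_aut h k) = cell_fun h \o cell_fun k.
Proof. by []. Qed.

Lemma comp_aut_image h k C :
  cell_fun (comp_aut h k) @` C = cell_fun h @` (cell_fun k @` C).
Proof. by rewrite comp_autE -(image_comp (cell_fun k) (cell_fun h)). Qed.

Lemma inv_autK h : cancel (cell_fun h) (cell_fun (inv_aut h)).
Proof. by rewrite /inv_aut; case: inv_cell_aut => h' [? ? ?]. Qed.

Lemma inv_autKV h : cancel (cell_fun (inv_aut h)) (cell_fun h).
Proof. by rewrite /inv_aut; case: inv_cell_aut => h' [? ? ?]. Qed.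

Lemma cell_aut_open (h : cell_aut) C :
  is_open_cell C <-> is_open_cell (cell_fun h @` C).
Proof. by case: h => h hP; case: (set_mem hP) => _ _ _; exact. Qed.

Lemma eq_cell_aut (h k : cell_aut) : cell_fun h = cell_fun k -> h = k.
Proof. exact: val_inj. Qed.

Definition Aut_one : AutP := \pi_AutP id_aut.
Definition Aut_mul (a b : AutP) : AutP :=
  \pi_AutP (comp_aut (repr a) (repr b)).
Definition Aut_inv (a : AutP) : AutP := \pi_AutP (inv_aut (repr a)).

Lemma pi_AutP (h k : cell_aut) :
  (forall C, is_open_cell C -> cell_fun h @` C = cell_fun k @` C) <->
  \pi_AutP h = \pi_AutP k.
Proof.
have E : same_cells h k <-> \pi_AutP h = \pi_AutP k.
  exact: (iff_sym (rwP (@eqmodP _ same_cells_equiv h k))).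
by rewrite -E; split => [hk|/asboolP //]; apply/asboolP.
Qed.

Lemma Aut_mulE (h k : cell_aut) :
  Aut_mul (\pi_AutP h) (\pi_AutP k) = \pi_AutP (comp_aut h k).
Proof.
apply/pi_AutP => C oC; rewrite !comp_aut_image.
have /pi_AutP hE := reprK (\pi_AutP h).
have /pi_AutP kE := reprK (\pi_AutP k).
rewrite kE// hE//; exact: (cell_aut_open k C).1.
Qed.

Lemma Aut_mulA : associative Aut_mul.
Proof.
elim/quotW=> h; elim/quotW=> k; elim/quotW=> l.
rewrite (Aut_mulE k l) (Aut_mulE h) (Aut_mulE h k) (Aut_mulE _ l).
by congr (\pi_AutP _); exact: eq_cell_aut.
Qed.

Lemma Aut_mul1g : left_id Aut_one Aut_mul.
Proof.
elim/quotW=> h; rewrite (Aut_mulE id_aut h).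
by congr (\pi_AutP _); exact: eq_cell_aut.
Qed.

Lemma Aut_mulg1 : right_id Aut_one Aut_mul.
Proof.
elim/quotW=> h; rewrite (Aut_mulE h id_aut).
by congr (\pi_AutP _); exact: eq_cell_aut.
Qed.

Lemma Aut_mulVg : left_inverse Aut_one Aut_inv Aut_mul.
Proof.
move=> a; rewrite -[X in Aut_mul _ X](reprK a) (Aut_mulE (inv_aut _)).
congr (\pi_AutP _); apply: eq_cell_aut; apply/funext => p; exact: inv_autK.
Qed.

Lemma Aut_mulgV : right_inverse Aut_one Aut_inv Aut_mul.
Proof.
move=> a; rewrite -[X in Aut_mul X _](reprK a) (Aut_mulE _ (inv_aut _)).
congr (\pi_AutP _); apply: eq_cell_aut; apply/funext => p; exact: inv_autKV.
Qed.

HB.instance Definition _ := isGroup.Build AutP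
  Aut_mulA Aut_mul1g Aut_mulg1 Aut_mulVg Aut_mulgV.

Definition Aut_discrete : Prop := forall U : set AutP, open U.

Definition class_fixes_strictly (a : AutP) (M : set davis) : Prop :=
  exists2 h, represents h a & fixes_strictly h M.

Section Metric.
Variable m : S -> S -> option nat.

(* The Tits representation on R^S, whose basis vectors e_s have norm 1. *)
Definition gram (s t : S) : R :=
  if m s t is Some k then - cos (pi / k%:R) else - 1.

Definition pairing (s : S) (v : {ffun S -> R}) : R := \sum_t gram s t * v t.

Definition sqnorm (v : {ffun S -> R}) : R := \sum_s v s * pairing s v.

Definition reflection (s : S) (v : {ffun S -> R}) : {ffun S -> R} :=
  [ffun t => v t - (if t == s then 2 * pairing s v else 0)].

Definition word_reflection (w : seq S) (v : {ffun S -> R}) : {ffun S -> R} :=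
  foldr reflection v w.

(* The closed cell of [T] is the Coxeter polytope, the convex hull of the
   W_T-orbit of the vector p supported by T at distance 1/2 of the hyperplanes
   orthogonal to the e_t, so that its edges have length 1. The barycenter of
   its face W_U p, for U contained in T, is the orthogonal projection of p on
   the subspace fixed by W_U. *)
Definition face_center (T U : {set S}) : {ffun S -> R} :=
  xget 0 [set b : {ffun S -> R} | exists p : {ffun S -> R},
    [/\ (forall t, t \notin T -> p t = 0),
        (forall t, t \in T -> pairing t p = 1 / 2),
        (forall t, t \notin U -> b t = p t)
      & (forall t, t \in U -> pairing t b = 0)]].

Definition develop (T : {set S}) (w : seq S) (x : cone) : {ffun S -> R} :=
  word_reflection w
    [ffun s => \sum_(U : {set S}) bcoord x U * face_center T U s].

(* [r] is the Euclidean distance of [p] and [q] in a common closed cell. *)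
Definition cell_dist (p q : davis) (r : R) : Prop :=
  exists (w : W) (T : {set S}) (u v : seq S) (x y : cone),
    [/\ spherical gen T,
        all (mem T) u /\ all (mem T) v,
        below T x /\ below T y,
        p = pt (w * word_prod gen u)%g x /\ q = pt (w * word_prod gen v)%g y
      & r = Num.sqrt (sqnorm (develop T u x - develop T v y))].

Inductive chain_length : davis -> davis -> R -> Prop :=
| ChainNil p : chain_length p p 0
| ChainCons p q z r l :
    cell_dist p q r -> chain_length q z l -> chain_length p z (r + l).

(* The length metric of the piecewise Euclidean complex P. *)
Definition davis_dist (p q : davis) : R := inf (chain_length p q).

Definition is_proper (M : set davis) : Prop := forall A, is_component M A ->
  gromov_boundary davis_dist base_vertex
    `\` boundary_of davis_dist base_vertex A !=set0.

Definition Aut_plus : set AutP :=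
  subgroup_gen [set a | exists M,
    [/\ is_wall M, is_proper M & class_fixes_strictly a M]].

(* Aut(P) is the semidirect product of [W], acting by left multiplication, and
   of the group of diagram automorphisms, acting by [hat]. The product of
   {perm S} is read from left to right: (f * g) s = g (f s). *)
Definition Aut_is_semidirect : Prop :=
  exists (iW : W -> AutP) (iG : {perm S} -> AutP),
    [/\ (forall w, represents (wact w) (iW w)) /\
        (forall f, is_diagram_aut m f -> represents (hat f) (iG f)),
        injective iW /\ (forall f g, is_diagram_aut m f -> is_diagram_aut m g ->
          iG f = iG g -> f = g),
        (forall v w, iW (v * w)%g = (iW v * iW w)%g) /\
        (forall f g, is_diagram_aut m f -> is_diagram_aut m g ->
          iG (g * f)%g = (iG f * iG g)%g),
        (forall f w, is_diagram_aut m f ->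
          (iG f * iW w * (iG f)^-1)%g = iW (induced_aut gen f w))
      & is_semidirect_product (range iW) (iG @` is_diagram_aut m)].

End Metric.

End Davis.

Arguments wall_of R {W S} gen s.
Arguments Aut_plus R {W S} gen m.

(* Main.v *)
Require Import Defs.
From HB Require Import structures.
From mathcomp Require Import all_boot all_order all_algebra all_fingroup.
From mathcomp Require Import all_classical all_reals all_analysis.
From mathcomp Require Import zify lra.

(** The Tits representation of W on the space V spanned by the simple roots
    alpha s controls everything: by [len_pos] the image of a simple root has
    coordinates of a constant sign, which tells whether a letter is a descent,
    and the form is positive definite on the span of a spherical subset
    ([form_posdef]). The functions [dev r], one for each vector r, are the
    coordinates of an equivariant map from the Davis complex P to the dual of V;
    the wall of s is the zero set of dev (alpha s), and the components of its
    complement are the two open half-spaces ([wall_dev], [wall_components]).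

    An element of Aut(P) is determined by its effect on the vertices
    ([pi_verticesP]), which are the elements of W. At each vertex w it permutes
    the edges by a diagram automorphism F w, and the values of F at the two ends
    of an edge of type s agree on the facet of s ([cell_aut_local]); conversely such local data define an automorphism
    ([local_aut]). If the system is rigid, F is constant; an automorphism is then
    determined by the images of a vertex and of its neighbours, and is the
    composite of a translation and of a diagram automorphism
    ([rigid_discrete], [rigid_semidirect]).

    Let f be a non-trivial diagram automorphism that fixes the facet of s. Apply
    f to the longest prefix of w without the letter s ([twist]). This is local
    data since f does not move the letters that can be exchanged across the wall
    of s; the resulting automorphism [fold_aut] coincides with that of f on the
    star of x0 and is the identity beyond the wall of s. There is a letter t
    moved by f, and m(s,t) is infinite. Conjugates of [fold_aut] by the powers
    of ts fix half-spaces that exhaust P, so they converge to the identity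
    ([fold_not_discrete]).

    The wall of s is proper because of the ray of vertices (st)^n. The length
    metric is compared with the word metric by counting the roots separating
    two points: a chain of segments crosses the walls of a bounded number of
    roots per unit of length ([chain_depth]), and of at most one of the roots
    alpha s + k (alpha s + alpha t) at a time, so that the ray is geodesic
    ([dist_dihedral]). A vertex w on the side of the wall of s that contains x0
    satisfies l((ts)^n w) = 2n + l(w) ([len_st]), which says that x0 lies on a
    geodesic of the Cayley graph from (st)^n to w. If W is hyperbolic, such a
    geodesic is close to a shortest path of P ([morse]), so the Gromov products
    of the ray with that side stay bounded ([product_bound]) and the end of the
    ray is not adherent to it. Exchanging s and t treats the other side. *)

Set Implicit Arguments.
Unset Strict Implicit.
Unset Printing Implicit Defensive.

Import Order.TTheory GRing.Theory Num.Theory.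
Import numFieldNormedType.Exports.

Local Open Scope classical_set_scope.
Local Open Scope ring_scope.

Local Notation repr := generic_quotient.repr.

(** * Groups of bijections *)

(** The presentation of W yields morphisms to groups only, so the reflections
    are regarded as elements of the group of all bijections of V. *)
Record bijection (X : Type) := Bijection {
  bij_fun :> X -> X; bij_inv : X -> X;
  bij_funK : cancel bij_fun bij_inv; bij_invK : cancel bij_inv bij_fun }.

Section Bijections.
Variable X : Type.

HB.instance Definition _ := gen_eqMixin (bijection X).
HB.instance Definition _ := gen_choiceMixin (bijection X).

Lemma bijection_ext (f g : bijection X) : f =1 g -> f = g.
Proof.
case: f g => [f f' fK f'K] [g g' gK g'K] /= fg.
have {}fg : f = g by apply/funext.
subst g; have fg' : f' = g' by apply/funext => x; rewrite -{1}(g'K x) fK.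
by subst g'; congr Bijection; exact: Prop_irrelevance.
Qed.

Definition bij_one := @Bijection X id id (fun=> erefl) (fun=> erefl).
Definition bij_mul (f g : bijection X) : bijection X :=
  Bijection (can_comp (@bij_funK _ f) (@bij_funK _ g))
            (can_comp (@bij_invK _ g) (@bij_invK _ f)).
Definition bij_opp (f : bijection X) : bijection X :=
  Bijection (@bij_invK _ f) (@bij_funK _ f).

Lemma bij_mulA : associative bij_mul.
Proof. by move=> f g h; exact: bijection_ext. Qed.
Lemma bij_mul1g : left_id bij_one bij_mul.
Proof. by move=> f; exact: bijection_ext. Qed.
Lemma bij_mulg1 : right_id bij_one bij_mul.
Proof. by move=> f; exact: bijection_ext. Qed.
Lemma bij_mulVg : left_inverse bij_one bij_opp bij_mul.
Proof. by move=> f; apply: bijection_ext => x /=; exact: bij_funK. Qed.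
Lemma bij_mulgV : right_inverse bij_one bij_opp bij_mul.
Proof. by move=> f; apply: bijection_ext => x /=; exact: bij_invK. Qed.

HB.instance Definition _ := isGroup.Build (bijection X)
  bij_mulA bij_mul1g bij_mulg1 bij_mulVg bij_mulgV.

Lemma bij_expE (f : bijection X) n x : (f ^+ n)%g x = iter n f x.
Proof. by elim: n x => // n IH x; rewrite expgS iterS -IH. Qed.

End Bijections.

(** * The Tits form and its reflections *)

Lemma scaleffE (R : realType) (S : finType) (a : R) (v : {ffun S -> R}) t : (a *: v) t = a * v t.
Proof. by rewrite ffunE. Qed.

(** lra after discarding the equations that do not live in the field. *)
Ltac glra := repeat match goal with
  H : @eq ?T _ _, R : realType |- _ =>
    tryif unify T (Real.sort R) then fail else clear H end; lra.

Ltac vec := let u := fresh "u" in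
  apply/ffunP => u; rewrite !(scaleffE, ffunE); glra.

Section TitsForm.
Variables (R : realType) (S : finType) (m : S -> S -> option nat).
Local Notation V := {ffun S -> R}.

Definition alpha (s : S) : V := [ffun t => (t == s)%:R].
Definition form (u v : V) : R := \sum_s u s * pairing m s v.
Local Notation B := form.

Lemma pairingE s v : pairing m s v = B (alpha s) v.
Proof.
rewrite /B (bigD1 s) //= ffunE eqxx mul1r big1 ?addr0 // => t /negbTE ts.
by rewrite ffunE ts mul0r.
Qed.

Lemma formDl u v w : B (u + v) w = B u w + B v w.
Proof. by rewrite /B -big_split; apply: eq_bigr => s _; rewrite ffunE mulrDl. Qed.
Lemma formZl a v w : B (a *: v) w = a * B v w.
Proof. by rewrite /B big_distrr; apply: eq_bigr => s _; rewrite ffunE /= mulrA. Qed.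
Lemma pairingD s (u v : V) : pairing m s (u + v) = pairing m s u + pairing m s v.
Proof.
by rewrite /pairing -big_split; apply: eq_bigr => t _; rewrite ffunE mulrDr.
Qed.
Lemma pairingZ s a (v : V) : pairing m s (a *: v) = a * pairing m s v.
Proof.
by rewrite /pairing big_distrr; apply: eq_bigr => t _; rewrite ffunE /= mulrCA.
Qed.
Lemma formDr u v w : B u (v + w) = B u v + B u w.
Proof.
by rewrite /B -big_split; apply: eq_bigr => s _; rewrite pairingD mulrDr.
Qed.
Lemma formZr a v w : B v (a *: w) = a * B v w.
Proof.
by rewrite /B big_distrr; apply: eq_bigr => s _; rewrite pairingZ /= mulrCA.
Qed.
Lemma formNl u v : B (- u) v = - B u v.
Proof. by rewrite -scaleN1r formZl mulN1r. Qed.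
Lemma formNr u v : B u (- v) = - B u v.
Proof. by rewrite -scaleN1r formZr mulN1r. Qed.
Lemma formBl u v w : B (u - v) w = B u w - B v w.
Proof. by rewrite formDl formNl. Qed.
Lemma formBr u v w : B u (v - w) = B u v - B u w.
Proof. by rewrite formDr formNr. Qed.
Lemma form0l v : B 0 v = 0.
Proof. by rewrite -(scale0r 0) formZl mul0r. Qed.
Lemma form0r v : B v 0 = 0.
Proof. by rewrite -(scale0r 0) formZr mul0r. Qed.
Lemma form_suml I r (P : pred I) (F : I -> V) v :
  B (\sum_(i <- r | P i) F i) v = \sum_(i <- r | P i) B (F i) v.
Proof. by apply: (big_morph (B^~ v)) => [x y|]; rewrite ?formDl ?form0l. Qed.
Lemma form_sumr I r (P : pred I) (F : I -> V) v :
  B v (\sum_(i <- r | P i) F i) = \sum_(i <- r | P i) B v (F i).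
Proof. by apply: (big_morph (B v)) => [x y|]; rewrite ?formDr ?form0r. Qed.

Lemma alpha_sum (v : V) : v = \sum_s v s *: alpha s.
Proof.
apply/ffunP => t; rewrite sum_ffunE (bigD1 t) //= big1 => [|s /negbTE st].
  by rewrite !ffunE eqxx addr0 [RHS]mulr1.
by rewrite !ffunE eq_sym st [LHS]mulr0.
Qed.

Lemma form_alpha s t : B (alpha s) (alpha t) = gram R m s t.
Proof.
rewrite -pairingE /pairing (bigD1 t) //= ffunE eqxx mulr1 big1 ?addr0 //.
by move=> u /negbTE ut; rewrite ffunE ut mulr0.
Qed.

Lemma sqnormE (v : V) : sqnorm m v = B v v. Proof. by []. Qed.

Lemma reflectionE s (v : V) : reflection m s v = v - (2 * B (alpha s) v) *: alpha s.
Proof.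
apply/ffunP => t; rewrite -pairingE !(scaleffE, ffunE).
by case: eqP => _; rewrite ?mulr1 ?mulr0.
Qed.

Lemma reflectionD s (u v : V) :
  reflection m s (u + v) = reflection m s u + reflection m s v.
Proof.
by rewrite !reflectionE formDr mulrDr scalerDl opprD addrACA.
Qed.
Lemma reflectionZ s a (v : V) : reflection m s (a *: v) = a *: reflection m s v.
Proof. by rewrite !reflectionE formZr scalerBr scalerA mulrCA. Qed.

Hypothesis mxC : is_coxeter_matrix m.

Lemma gramC s t : gram R m s t = gram R m t s.
Proof. by case: mxC => _ mC _; rewrite /gram mC. Qed.
Lemma formC u v : B u v = B v u.
Proof.
rewrite /B /pairing; under eq_bigr do rewrite big_distrr.
rewrite exchange_big; apply: eq_bigr => t _; rewrite big_distrr.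
by apply: eq_bigr => s _ /=; rewrite gramC mulrCA mulrA mulrC mulrA.
Qed.
Lemma gram1 s : gram R m s s = 1.
Proof. by case: mxC => m1 _ _; rewrite /gram m1 divr1 cospi opprK. Qed.
Lemma form_alpha1 s : B (alpha s) (alpha s) = 1.
Proof. by rewrite form_alpha gram1. Qed.

Lemma gram_le0 s t : s != t -> gram R m s t <= 0.
Proof.
move=> st; rewrite /gram; case E: (m s t) => [k|]; last by rewrite lerN10.
case: mxC => _ _ /(_ _ _ _ st E) k2.
have k0 : (0 : R) < k%:R by rewrite ltr0n; lia.
rewrite oppr_le0 cos_ge0_pihalf //; have p0 := pi_ge0 R.
apply/andP; split.
  by apply: (@le_trans _ _ 0); [rewrite oppr_le0 divr_ge0|rewrite divr_ge0// ltW].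
by rewrite ler_pM2l ?pi_gt0 // lef_pV2 ?posrE ?ltr0n ?ler_nat //; lia.
Qed.

Lemma reflection_alpha s t :
  reflection m s (alpha t) = alpha t - (2 * gram R m s t) *: alpha s.
Proof. by rewrite reflectionE form_alpha. Qed.
Lemma reflection_alpha1 s : reflection m s (alpha s) = - alpha s.
Proof. by rewrite reflection_alpha gram1; vec.
Qed.

Lemma reflection_form s (u v : V) : B (reflection m s u) (reflection m s v) = B u v.
Proof.
rewrite !reflectionE !formBl !formBr !formZl !formZr form_alpha1.
by rewrite (formC u (alpha s)); lra.
Qed.

Lemma reflectionK s : involutive (reflection m s : V -> V).
Proof.
move=> v; rewrite !reflectionE formBr formZr form_alpha1.
by vec.
Qed.

Definition refl_bij s : bijection V := Bijection (@reflectionK s) (@reflectionK s).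

(** The composite of the reflections of s and t acts on the pair of coordinates
    dual to the two roots by a matrix whose powers are given by a linear
    recurrence of order two; for m(s,t) = k its solutions are the sines of the
    multiples of pi / k, up to a scalar. *)
Lemma refl_order s t k : m s t = Some k ->
  iter k (reflection m s \o reflection m t) =1 (id : V -> V).
Proof.
move=> mk; case: (eqVneq s t) => [st|st].
  case: mxC => m1 _ _; move: mk; rewrite st m1 => -[<-] v /=.
  exact: reflectionK.
case: (mxC) => _ _ /(_ _ _ _ st mk) k2 v.
pose th : R := pi / k%:R; pose c := cos th.
have gE : gram R m s t = - c by rewrite /gram mk.
have k0 : (0 : R) < k%:R by rewrite ltr0n; lia.
have th0 : 0 < th by rewrite divr_gt0 // pi_gt0.
have thpi : th < pi.
  by rewrite ltr_pdivrMr // ltr_pMr ?pi_gt0 // (ltr_nat R 1) ; lia.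
have sth : 0 < sin th by apply: sin_gt0_pi; rewrite th0.
have kth : k%:R * th = pi by rewrite /th mulrC divfK // gt_eqF.
pose x := B (alpha s) v; pose y := B (alpha t) v.
pose Y (n : nat) := (y * sin (n%:R * th) + x * sin (n%:R * th - th)) / sin th.
have sinS a : sin (a + th) = 2 * c * sin a - sin (a - th).
  by rewrite sinD sinB /c; lra.
have Yrec n : Y n.+2 = 2 * c * Y n.+1 - Y n.
  rewrite /Y mulrA -mulrBl; congr (_ / _).
  have -> : n.+2%:R * th = n.+1%:R * th + th by rewrite -[n.+2%:R]natr1; lra.
  have -> : n%:R * th = n.+1%:R * th - th by rewrite -[n.+1%:R]natr1; lra.
  move: (n.+1%:R * th) => A; rewrite addrK sinS.
  have := sinS (A - th); rewrite subrK => ->; lra.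
pose w n := iter n (reflection m s \o reflection m t) v.
(* Y interpolates the products with the two roots along the 2n reflections. *)
have wP n : [/\ B (alpha s) (w n) = - Y n.*2, B (alpha t) (w n) = Y n.*2.+1
    & exists a b, w n - v = a *: alpha s + b *: alpha t].
  elim: n => [|n [IHs IHt [a [b IH]]]].
    split.
    - by rewrite /Y !mul0r sin0 mulr0 add0r sub0r sinN mulrN mulNr opprK mulfK ?gt_eqF.
    - by rewrite /Y mul1r subrr sin0 mulr0 addr0 mulfK ?gt_eqF.
    - by exists 0, 0; rewrite /w /= subrr !scale0r addr0.
  have wS : w n.+1 = reflection m s (reflection m t (w n)) by [].
  have E : w n.+1 = w n - (2 * Y n.*2.+1) *: alpha t - (2 * Y n.*2.+2) *: alpha s.
    rewrite wS !reflectionE IHt formBr formZr form_alpha gE IHs.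
    by rewrite (Yrec n.*2); vec.
  have gE' : gram R m t s = - c by rewrite gramC.
  split.
  - by rewrite E !formBr !formZr !form_alpha gram1 gE IHs doubleS (Yrec n.*2); lra.
  - rewrite E !formBr !formZr !form_alpha gram1 gE' IHt doubleS.
    by rewrite (Yrec n.*2.+1) (Yrec n.*2); lra.
  - exists (a - 2 * Y n.*2.+2), (b - 2 * Y n.*2.+1); rewrite E.
    transitivity (w n - v - (2 * Y n.*2.+1) *: alpha t - (2 * Y n.*2.+2) *: alpha s).
      by vec.
    by rewrite IH; vec.
have [Ps Pt [a [b Pd]]] := wP k.
have E2 : (k.*2)%:R * th = pi + pi by rewrite -muln2 natrM mulrAC kth; lra.
have E2' : (k.*2.+1)%:R * th = pi + pi + th by rewrite -natr1 mulrDl E2 mul1r.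
have s2 : sin (pi + pi : R) = 0 by rewrite sinD sinpi mul0r mulr0 addr0.
have c2 : cos (pi + pi : R) = 1 by rewrite cosD sinpi cospi; lra.
have {}Ps : B (alpha s) (w k) = x.
  by rewrite Ps /Y E2 s2 sinB s2 c2 mulr0 mul0r mul1r sub0r add0r mulrN mulNr opprK mulfK ?gt_eqF.
have {}Pt : B (alpha t) (w k) = y.
  by rewrite Pt /Y E2' addrK s2 sinD s2 c2 mulr0 mul0r mul1r add0r addr0 mulfK ?gt_eqF.
have ds : B (alpha s) (w k - v) = 0 by rewrite formBr Ps subrr.
have dt : B (alpha t) (w k - v) = 0 by rewrite formBr Pt subrr.
move: ds dt; rewrite Pd !formDr !formZr !form_alpha !gram1 (gramC t) gE => ds dt.
have sc : sin th ^+ 2 = 1 - c ^+ 2 by rewrite -(cos2Dsin2 th) addrC addKr.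
have a0 : a * sin th ^+ 2 = 0.
  rewrite sc; transitivity ((a * 1 + b * - c) + c * (a * - c + b * 1)); first by lra.
  by rewrite ds dt mulr0 addr0.
have {}a0 : a = 0.
  by move/eqP: a0; rewrite mulf_eq0 expf_eq0 /= (gt_eqF sth) orbF => /eqP.
have b0 : b = 0 by move: dt; rewrite a0; lra.
move: Pd; rewrite a0 b0 !scale0r addr0 => /eqP.
by rewrite subr_eq0 => /eqP.
Qed.

End TitsForm.

(** * Words, length and parity *)

Section CoxeterGroup.
Variables (R : realType) (W : groupType) (S : finType).
Variables (m : S -> S -> option nat) (gen : S -> W).
Hypothesis coxWS : is_coxeter_system m gen.
Local Notation V := {ffun S -> R}.
Local Notation B := (@form R S m).
Local Notation alpha := (@alpha R S).
Implicit Types (w x y : W) (s t : S) (T U J : {set S}).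
Local Open Scope group_scope.

Let mxC : is_coxeter_matrix m. Proof. by case: coxWS. Qed.

Lemma cox_mC s t : m s t = m t s.
Proof. by case: mxC => _ + _; exact. Qed.
Lemma cox_m1 s : m s s = Some 1%N.
Proof. by case: mxC => + _ _; exact. Qed.
Lemma cox_m2 s t k : s != t -> m s t = Some k -> (2 <= k)%N.
Proof. by case: mxC => _ _; exact. Qed.
Lemma gen_rel s t k : m s t = Some k -> (gen s * gen t) ^+ k = 1.
Proof. by case: coxWS => _ _ + _; exact. Qed.

Lemma gengen s : gen s * gen s = 1.
Proof. exact: gen_rel (cox_m1 s). Qed.
Lemma genV s : (gen s)^-1 = gen s.
Proof. by rewrite -[LHS]mulg1 -(gengen s) mulgA mulVg mul1g. Qed.
Lemma genK s w : gen s * (gen s * w) = w.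
Proof. by rewrite mulgA gengen mul1g. Qed.
Lemma mulg_genK s w : w * gen s * gen s = w.
Proof. by rewrite -mulgA gengen mulg1. Qed.

Lemma word_cat (k l : seq S) :
  word_prod gen (k ++ l) = word_prod gen k * word_prod gen l.
Proof. by elim: k => [|s k IH] /=; rewrite ?mul1g // IH mulgA. Qed.

Lemma word_rev (l : seq S) : word_prod gen (rev l) = (word_prod gen l)^-1.
Proof.
elim: l => [|s l IH]; first by rewrite invg1.
by rewrite rev_cons -cats1 word_cat IH /= mulg1 invMg genV.
Qed.

Lemma parabolic_subgroup T : is_subgroup (parabolic gen T).
Proof.
split; first by move=> H [[]].
- by move=> x y Tx Ty H [sH HT]; case: (sH) => _ + _; apply; [exact: Tx|exact: Ty].
- by move=> x Tx H [sH HT]; case: (sH) => _ _; apply; exact: Tx.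
Qed.

Lemma parabolic1 T : parabolic gen T 1.
Proof. by case: (parabolic_subgroup T). Qed.
Lemma parabolicM T x y :
  parabolic gen T x -> parabolic gen T y -> parabolic gen T (x * y).
Proof. by case: (parabolic_subgroup T) => _ + _; exact. Qed.
Lemma parabolicV T x : parabolic gen T x -> parabolic gen T x^-1.
Proof. by case: (parabolic_subgroup T) => _ _; exact. Qed.
Lemma parabolic_gen T t : t \in T -> parabolic gen T (gen t).
Proof. by move=> tT H [_]; apply; exists t. Qed.

Lemma parabolicP T w :
  parabolic gen T w <-> exists2 l, all (mem T) l & word_prod gen l = w.
Proof.
split=> [|[l + <-]]; last first.
  elim: l => /= [_|s l IH /andP[sT lT]]; first exact: parabolic1.
  by apply: parabolicM; [exact: parabolic_gen|exact: IH].
move=> /(_ [set w | exists2 l, all (mem T) l & word_prod gen l = w]); apply.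
split; last by move=> _ [s sT <-]; exists [:: s]; rewrite //= ?mulg1 ?andbT.
split; first by exists [::].
- move=> _ _ [k kT <-] [l lT <-]; exists (k ++ l); last exact: word_cat.
  by rewrite all_cat kT.
- by move=> _ [l lT <-]; exists (rev l); rewrite ?word_rev // all_rev.
Qed.

Lemma parabolic_setT w : parabolic gen [set: S] w.
Proof.
have -> : parabolic gen [set: S] = [set: W]; last by [].
case: coxWS => _ <- _ _; congr subgroup_gen.
by apply/seteqP; split => _ [s _ <-]; exists s => //=; rewrite inE.
Qed.

Lemma word_ex w : exists l, word_prod gen l = w.
Proof. by have /parabolicP[l _ <-] := parabolic_setT w; exists l. Qed.

Lemma cox_ind (P : W -> Prop) :
  P 1 -> (forall s w, P w -> P (gen s * w)) -> forall w, P w.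
Proof. by move=> P1 PS w; have [l <-] := word_ex w; elim: l => //= s l; exact: PS. Qed.

Lemma parabolic_ind T (P : W -> Prop) : P 1 ->
  (forall s w, s \in T -> parabolic gen T w -> P w -> P (gen s * w)) ->
  forall w, parabolic gen T w -> P w.
Proof.
move=> P1 PS w /parabolicP[l + <-]; elim: l => //= s l IH /andP[sT lT].
by apply: PS => //; [apply/parabolicP; exists l|exact: IH].
Qed.

Lemma parabolicS T U : T \subset U -> parabolic gen T `<=` parabolic gen U.
Proof.
move=> /fintype.subsetP TU w; elim/parabolic_ind => [|s x sT _]; first exact: parabolic1.
by apply: parabolicM; apply: parabolic_gen; exact: TU.
Qed.

Lemma sphericalS T U : T \subset U -> spherical gen U -> spherical gen T.
Proof. by move=> TU; apply: sub_finite_set; exact: parabolicS. Qed.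

Let len_ex w : exists n, `[< exists2 l, size l = n & word_prod gen l = w >].
Proof. by have [l <-] := word_ex w; exists (size l); apply/asboolP; exists l. Qed.

Definition len w : nat := ex_minn (len_ex w).

Lemma len_word l : (len (word_prod gen l) <= size l)%N.
Proof. by rewrite /len; case: ex_minnP => n _; apply; apply/asboolP; exists l. Qed.

Lemma len_reduced w : exists2 l, size l = len w & word_prod gen l = w.
Proof. by rewrite /len; case: ex_minnP => n /asboolP[l <- <-] _; exists l. Qed.

Lemma len1 : len 1 = 0%N.
Proof. by apply/eqP; rewrite -leqn0 -[1]/(word_prod gen [::]); exact: len_word. Qed.

Lemma lenM x y : (len (x * y) <= len x + len y)%N.
Proof.
have [k <- <-] := len_reduced x; have [l <- <-] := len_reduced y.
by rewrite -word_cat -size_cat; exact: len_word.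
Qed.

Lemma lenV w : len w^-1 = len w.
Proof.
have L x : (len x^-1 <= len x)%N.
  have [l <- <-] := len_reduced x.
  by rewrite -word_rev -(size_rev l); exact: len_word.
by apply/eqP; rewrite eqn_leq L -{1}(invgK w) L.
Qed.

Lemma len_gen_le s : (len (gen s) <= 1)%N.
Proof. by have := len_word [:: s]; rewrite /= mulg1. Qed.

(** Every letter acts by the exchange of the two booleans, and the relators have
    even length. *)
Lemma parity_ex : exists phi : W -> bijection bool,
  {morph phi : x y / x * y} /\ forall s, phi (gen s) = Bijection negbK negbK.
Proof.
case: coxWS => _ _ _; apply => s t k _; apply: bijection_ext => b.
by rewrite bij_expE; elim: k => //= k ->; exact: negbK.
Qed.

Lemma len_parity s w : odd (len (gen s * w)) = ~~ odd (len w).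
Proof.
have [phi [phiM phig]] := parity_ex.
have phi1 : phi 1 = 1 by apply: (mulgI (phi 1)); rewrite -phiM !mulg1.
have E x : phi x false = odd (len x).
  have [l <- <-] := len_reduced x.
  by elim: l => /= [|t l IH]; rewrite ?phi1 // phiM phig /= IH.
by rewrite -!E phiM phig.
Qed.

Lemma len_genM s w :
  len (gen s * w) = (len w).+1 \/ len w = (len (gen s * w)).+1.
Proof.
have := lenM (gen s) w; have := lenM (gen s) (gen s * w); rewrite genK.
have := len_parity s w; have := len_gen_le s; lia.
Qed.

Lemma len_Mgen s w :
  len (w * gen s) = (len w).+1 \/ len w = (len (w * gen s)).+1.
Proof.
have := len_genM s w^-1; rewrite -(lenV (_ * _)) invMg invgK genV.
by rewrite !lenV.
Qed.

(** * The Tits representation *)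

Lemma tits_ex : exists phi : W -> bijection V,
  {morph phi : x y / x * y} /\ forall s, phi (gen s) = refl_bij R mxC s.
Proof.
case: coxWS => _ _ _; apply => s t k mk; apply: bijection_ext => v.
rewrite bij_expE -[RHS](refl_order mxC mk v).
by elim: k {mk} => //= k ->.
Qed.

Definition tits : W -> bijection V := projT1 (cid tits_ex).
Definition act w (v : V) : V := tits w v.

Lemma titsM : {morph tits : x y / x * y}.
Proof. exact: (projT2 (cid tits_ex)).1. Qed.
Lemma tits_gen s : tits (gen s) = refl_bij R mxC s.
Proof. exact: (projT2 (cid tits_ex)).2. Qed.

Lemma actM x y v : act (x * y) v = act x (act y v).
Proof. by rewrite /act titsM. Qed.
Lemma act_gen s v : act (gen s) v = reflection m s v.
Proof. by rewrite /act tits_gen. Qed.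
Lemma act1 v : act 1 v = v.
Proof.
have /(congr1 (fun f : bijection V => f v)) : tits 1 = 1 by apply: (mulgI (tits 1)); rewrite -titsM !mulg1.
exact.
Qed.
Lemma actK x : cancel (act x) (act x^-1).
Proof. by move=> v; rewrite -actM mulVg act1. Qed.
Lemma actVK x : cancel (act x^-1) (act x).
Proof. by move=> v; rewrite -actM mulgV act1. Qed.
Lemma act_inj x : injective (act x).
Proof. exact: can_inj (actK x). Qed.

Lemma actD x u v : act x (u + v)%R = (act x u + act x v)%R.
Proof.
elim/cox_ind: x u v => [|s x IH] u v; first by rewrite !act1.
by rewrite !actM IH !act_gen reflectionD.
Qed.
Lemma actZ x a v : act x (a *: v)%R = (a *: act x v)%R.
Proof.
elim/cox_ind: x v => [|s x IH] v; first by rewrite !act1.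
by rewrite !actM IH !act_gen reflectionZ.
Qed.
Lemma actN x v : act x (- v)%R = (- act x v)%R.
Proof. by rewrite -scaleN1r actZ scaleN1r. Qed.
Lemma actB x u v : act x (u - v)%R = (act x u - act x v)%R.
Proof. by rewrite actD actN. Qed.
Lemma act0 x : act x 0%R = 0%R.
Proof. by rewrite -(scale0r 0%R) actZ !scale0r. Qed.
Lemma act_sum x I r (P : pred I) (F : I -> V) :
  act x (\sum_(i <- r | P i) F i)%R = (\sum_(i <- r | P i) act x (F i))%R.
Proof. by apply: (big_morph (act x)) => [u v|]; rewrite ?actD ?act0. Qed.
Lemma act_form x u v : B (act x u) (act x v) = B u v.
Proof.
elim/cox_ind: x => [|s x IH]; first by rewrite !act1.
by rewrite !actM !act_gen reflection_form.
Qed.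
Lemma act_formV x u v : B (act x u) v = B u (act x^-1 v).
Proof. by rewrite -[in LHS](actVK x v) act_form. Qed.
Lemma act_word l v : act (word_prod gen l) v = word_reflection m l v.
Proof. by elim: l => [|s l IH] /=; rewrite ?act1 // actM IH act_gen. Qed.

(** * Roots: positivity of the image of a simple root *)

Definition pos (v : V) : Prop := forall t, (0 <= v t)%R.

Lemma pos_alpha s : pos (alpha s).
Proof. by move=> t; rewrite ffunE ler0n. Qed.
Lemma posD u v : pos u -> pos v -> pos (u + v)%R.
Proof. by move=> pu pv t; rewrite ffunE addr_ge0. Qed.
Lemma posZ a v : (0 <= a)%R -> pos v -> pos (a *: v)%R.
Proof. by move=> a0 pv t; rewrite scaleffE mulr_ge0. Qed.
Lemma pos_sum I r (P : pred I) (F : I -> V) :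
  (forall i, P i -> pos (F i)) -> pos (\sum_(i <- r | P i) F i)%R.
Proof.
move=> PF; apply: (big_ind pos) => //; last exact: posD.
by move=> t; rewrite ffunE.
Qed.
Lemma pos_antisym v : pos v -> pos (- v)%R -> v = 0%R.
Proof.
move=> pv nv; apply/ffunP => t; apply/eqP; rewrite eq_le ffunE pv andbT.
by rewrite -oppr_ge0; have := nv t; rewrite ffunE.
Qed.

(** The values of the Chebyshev polynomials of the second kind, starting at
    index -2: for c = cos x they are sin ((n - 1) x) / sin x. *)
Fixpoint cheb (c : R) (n : nat) : R := match n with
  | 0 => -1
  | n1.+1 => if n1 is n2.+1 then 2 * c * cheb c n1 - cheb c n2 else 0
  end%R.

Lemma chebSS c n : cheb c n.+2 = (2 * c * cheb c n.+1 - cheb c n)%R.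
Proof. by []. Qed.

Lemma cheb_small c : ((cheb c 0 = (-1)%R) * (cheb c 1 = 0%R) * (cheb c 2 = 1%R))%type.
Proof. by split=> //=; lra. Qed.

Arguments cheb : simpl never.

Lemma cheb1 n : cheb 1 n = (n%:R - 1)%R.
Proof.
suff : cheb 1 n = (n%:R - 1)%R /\ cheb 1 n.+1 = n%:R by case.
elim: n => [|n [IH IH1]]; first by rewrite !cheb_small; split; lra.
by split; rewrite ?chebSS ?IH1 ?IH -natr1; lra.
Qed.

Lemma cheb_sin (th : R) n :
  (cheb (cos th) n * sin th = sin (n%:R * th - th))%R.
Proof.
suff : (cheb (cos th) n * sin th = sin (n%:R * th - th) /\
        cheb (cos th) n.+1 * sin th = sin (n%:R * th))%R by case.
elim: n => [|n [IH IH1]].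
  by rewrite !cheb_small !mul0r sub0r sinN sin0 mulN1r.
have E : (n.+1%:R * th = n%:R * th + th)%R by rewrite -natr1; lra.
split; first by rewrite IH1 E addrK.
transitivity (2 * cos th * (cheb (cos th) n.+1 * sin th)
  - cheb (cos th) n * sin th)%R; first by rewrite chebSS; lra.
by rewrite IH1 IH E !(sinB, sinD); lra.
Qed.

Section Dihedral.
Variables s t : S.
Hypothesis st : s != t.
Local Notation c := (- gram R m s t)%R.

Lemma cheb_gram k : m s t = Some k -> exists2 th : R,
  (c = cos th /\ k%:R * th = pi)%R & (0 < th < pi)%R.
Proof.
move=> mk; have k2 := cox_m2 st mk; exists (pi / k%:R)%R.
  split; first by rewrite /gram mk opprK.
  by rewrite mulrC divfK // pnatr_eq0; lia.
have k0 : (0 < k%:R :> R)%R by rewrite ltr0n; lia.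
rewrite divr_gt0 ?pi_gt0 //= ltr_pdivrMr // ltr_pMr ?pi_gt0 //.
by rewrite (ltr_nat R 1); lia.
Qed.

(** The values are sin (j pi / k) / sin (pi / k) with 0 <= j <= k, and j itself in
    the limit case of an infinite m(s,t). *)
Lemma cheb_ge0 n : (0 < n)%N -> (if m s t is Some k then (n <= k.+1)%N else true) ->
  (0 <= cheb c n)%R.
Proof.
case E: (m s t) => [k|] n0 nk; last first.
  by rewrite /gram E opprK cheb1 subr_ge0 ler1n.
have [th [-> kth] thP] := cheb_gram E.
have sth := sin_gt0_pi thP; rewrite -(pmulr_lge0 _ sth) cheb_sin.
have -> : (n%:R * th - th = n.-1%:R * th)%R.
  by rewrite -{1}(prednK n0) -natr1; lra.
case/andP: thP => th0 _.
apply: sin_ge0_pi; apply/andP; split; first by rewrite mulr_ge0 ?ler0n ?(ltW th0).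
by rewrite -kth ler_wpM2r ?(ltW th0) // ler_nat; lia.
Qed.

Lemma cheb_period k n : m s t = Some k -> (0 < n < k)%N ->
  ~ (cheb c n.*2.+2 = 1 /\ cheb c n.*2.+1 = 0)%R.
Proof.
move=> mk /andP[n0 nk]; have [th [-> kth] thP] := cheb_gram mk.
have sth := sin_gt0_pi thP.
move=> [/(congr1 ( *%R^~ (sin th)))/= + /(congr1 ( *%R^~ (sin th)))/=].
rewrite !cheb_sin mul1r mul0r.
have -> : ((n.*2.+2)%:R * th - th = n%:R * th + n%:R * th + th)%R.
  by rewrite -addnn -!natr1 natrD; lra.
have -> : ((n.*2.+1)%:R * th - th = n%:R * th + n%:R * th)%R.
  by rewrite -addnn -!natr1 natrD; lra.
case/andP: thP => th0 _.
have : (0 < sin (n%:R * th))%R.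
  apply: sin_gt0_pi; rewrite mulr_gt0 ?ltr0n //= -kth.
  by rewrite ltr_pM2r // ltr_nat.
move: (n%:R * th)%R => A sA; rewrite sinD => E1 E2; move: E1.
rewrite E2 mul0r add0r cosD => E1.
have cA : (cos A * cos A - sin A * sin A = 1)%R.
  by apply: (mulIf (lt0r_neq0 sth)); rewrite mul1r.
have := cos2Dsin2 A; have : (0 < sin A * sin A)%R by rewrite mulr_gt0.
by rewrite !expr2; lra.
Qed.

End Dihedral.

(** The alternating product of n letters s, t that ends with t. *)
Fixpoint alt (s t : S) (n : nat) : W :=
  if n is k.+1 then alt t s k * gen t else 1.

Lemma altS s t n : alt s t n.+1 = gen (if odd n then s else t) * alt s t n.
Proof.
elim: n s t => [|n IH] s t; first by rewrite /= mul1g mulg1.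
by rewrite -[LHS]/(alt t s n.+1 * gen t) IH /= mulgA; case: (odd n).
Qed.

Lemma len_alt s t n : (len (alt s t n) <= n)%N.
Proof.
elim: n s t => [|n IH] s t; first by rewrite len1.
by have := lenM (alt t s n) (gen t); have := len_gen_le t; have := IH t s => /=; lia.
Qed.

Lemma alt_split s t n k : (k <= n)%N ->
  exists2 x, alt s t n = x * alt s t k & (len x <= n - k)%N.
Proof.
elim: n => [|n IH] kn.
  by exists 1; rewrite ?len1 // mul1g; have -> : k = 0%N by lia.
case: (ltngtP k n.+1) kn => // [kn _|-> _]; last by exists 1; rewrite ?mul1g ?len1.
have [x E lx] := IH kn; exists (gen (if odd n then s else t) * x).
  by rewrite altS E mulgA.
have := lenM (gen (if odd n then s else t)) x.
by have := len_gen_le (if odd n then s else t); lia.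
Qed.

Lemma altV s t n : (alt t s n)^-1 * alt s t n = (gen s * gen t) ^+ n.
Proof.
elim: n s t => [|n IH] s t; first by rewrite invg1 mulg1.
rewrite /= invMg genV mulgA -(mulgA (gen s)) IH expgSr.
elim: n {IH} => [|n IH]; first by rewrite !mulg1 mul1g.
by rewrite (expgSr (gen t * gen s)) [in RHS]expgSr -IH !mulgA.
Qed.

Lemma alt_braid s t k : m s t = Some k -> alt s t k = alt t s k.
Proof. by move=> mk; apply: (mulgI (alt t s k)^-1); rewrite altV mulVg gen_rel. Qed.

(** Each new letter changes the coordinates of the root by one step of the
    Chebyshev recurrence. *)
Lemma act_alt s t n : s != t ->
  let c := (- gram R m s t)%R in
  let e := if odd n then alpha t else alpha s in
  let e' := if odd n then alpha s else alpha t in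
  act (alt s t n) (alpha s) = (cheb c n.+2 *: e + cheb c n.+1 *: e')%R /\
  act (alt s t n) (alpha t) = (- (cheb c n.+1 *: e + cheb c n *: e'))%R.
Proof.
elim: n s t => [|n IH] s t st c e e'.
  by rewrite !act1 /e /e' /= !cheb_small; split; vec.
have [] := IH t s; first by rewrite eq_sym.
rewrite [gram R m t s]gramC // -/c => IHt IHs.
rewrite /= !actM !act_gen reflection_alpha1 // reflection_alpha actN IHt.
rewrite actB actZ IHt IHs /e /e' [gram R m t s]gramC // (chebSS c n.+1) (chebSS c n) /=.
by split; case: (odd n) => /=; rewrite /c; vec.
Qed.

Lemma descent_ex w : w <> 1 -> exists s, (len (w * gen s) < len w)%N.
Proof.
have [l + lw] := len_reduced w; case/lastP: l lw => [/= <- //|l s lw].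
rewrite size_rcons => E _; exists s.
by rewrite -E -lw -cats1 word_cat /= mulg1 mulg_genK ltnS len_word.
Qed.

(** Deodhar's argument: if w lengthens on the right by s and shortens by t,
    split off the longest alternating suffix of w in s and t; it is shorter
    than m(s,t), and the remaining prefix lengthens by both letters. *)
Theorem len_pos w s : (len w < len (w * gen s))%N -> pos (act w (alpha s)).
Proof.
have [n] := ubnP (len w); elim: n w s => // n IH w s wn ws.
have [w1|w1] := pselect (w = 1); first by rewrite w1 act1; exact: pos_alpha.
have [t wt] := descent_ex w1.
have st : s != t by apply: contraTneq ws => ->; lia.
pose P k := `[< exists2 x, w = x * alt s t k & len w = (len x + k)%N >].
have P1 : P 1%N.
  apply/asboolP; exists (w * gen t); first by rewrite /= mul1g mulg_genK.
  by case: (len_Mgen t w); lia.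
have Pmax k : P k -> (k <= len w)%N by case/asboolP => x _; lia.
case: (ex_maxnP (ex_intro (fun k => P k) 1%N P1) Pmax) => k /asboolP[x wE lE] kmax.
have k1 := kmax _ P1.
pose r := if odd k then s else t; pose r' := if odd k then t else s.
have xr : (len x < len (x * gen r))%N.
  case: (len_Mgen r x) => [->//|lx].
  have /kmax : P k.+1; last by rewrite ltnn.
  by apply/asboolP; exists (x * gen r); [rewrite altS -/r mulgA mulg_genK|lia].
have xr' : (len x < len (x * gen r'))%N.
  case: (len_Mgen r' x) => [->//|lx].
  have E : w = (x * gen r') * alt s t k.-1.
    rewrite wE -{1}(prednK k1) altS mulgA; congr (_ * gen _ * _).
    by rewrite /r' -[in RHS](prednK k1) /=; case: (odd _).
  have := lenM (x * gen r') (alt s t k.-1); rewrite -E.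
  by have := len_alt s t k.-1; lia.
have [xs xt] : pos (act x (alpha s)) /\ pos (act x (alpha t)).
  have Hr := IH x r; have Hr' := IH x r'.
  by split; move: Hr Hr' xr xr'; rewrite /r /r'; case: (odd k) => H1 H2 h1 h2;
    (apply: H1 || apply: H2) => //; lia.
have kP : if m s t is Some k' then (k < k')%N else true.
  case E: (m s t) => [k'|//]; rewrite ltnNge; apply/negP => k'k.
  have k2 := cox_m2 st E; have [y yE ly] := alt_split s t k'k.
  have : w * gen s = x * y * alt s t k'.-1.
    rewrite wE yE (alt_braid E) -(prednK (ltnW k2)) /= -!mulgA.
    by rewrite gengen mulg1.
  have := lenM (x * y) (alt s t k'.-1); have := lenM x y.
  by have := len_alt s t k'.-1 => + + + H; rewrite -H; lia.
rewrite wE actM; have [-> _] := act_alt k st; rewrite actD !actZ.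
apply: posD; apply: posZ; do ?[by case: (odd k)]; apply: cheb_ge0 => //.
  by move: kP; case: (m s t) => // a; lia.
by move: kP; case: (m s t) => // a; lia.
Qed.

End CoxeterGroup.

Section Roots.
Variables (R : realType) (W : groupType) (S : finType).
Variables (m : S -> S -> option nat) (gen : S -> W).
Hypothesis coxWS : is_coxeter_system m gen.
Local Notation V := {ffun S -> R}.
Local Notation B := (@form R S m).
Local Notation alpha := (@alpha R S).
Local Notation act := (@act R W S m gen coxWS).
Local Notation len := (len coxWS).
Implicit Types (w x y : W) (s t : S) (T U J : {set S}).
Local Open Scope group_scope.

Let mxC : is_coxeter_matrix m. Proof. by case: coxWS. Qed.

Let genV s : (gen s)^-1 = gen s := genV coxWS s.
Let gengen s : gen s * gen s = 1 := gengen coxWS s.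
Let genK s w : gen s * (gen s * w) = w := genK coxWS s w.
Let mulg_genK s w : w * gen s * gen s = w := mulg_genK coxWS s w.

Lemma len_neg w s : (len (w * gen s) < len w)%N -> pos (- act w (alpha s))%R.
Proof.
move=> ws; rewrite -actN -(@reflection_alpha1 R S m mxC) -(act_gen coxWS) -actM.
by apply: len_pos; rewrite mulg_genK.
Qed.

Lemma alpha_neq0 s : alpha s <> 0%R.
Proof.
by move=> /(congr1 (fun v : V => v s)); rewrite !ffunE eqxx => /eqP; rewrite oner_eq0.
Qed.

Lemma act_alpha_neq0 w s : act w (alpha s) <> 0%R.
Proof. by rewrite -(act0 R coxWS w) => /act_inj/alpha_neq0. Qed.

Lemma root_pos_neg w s : pos (act w (alpha s)) \/ pos (- act w (alpha s))%R.
Proof.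
case: (len_Mgen coxWS s w) => E; first by left; apply: len_pos; rewrite E.
by right; apply: len_neg; rewrite E.
Qed.

Lemma posP_len w s : pos (act w (alpha s)) <-> (len w < len (w * gen s))%N.
Proof.
split=> [p|]; last exact: len_pos.
case: (len_Mgen coxWS s w) => [->//|E].
have /(pos_antisym p) : pos (- act w (alpha s))%R by apply: len_neg; rewrite E.
by move/act_alpha_neq0.
Qed.

Lemma negP_len w s : pos (- act w (alpha s))%R <-> (len (w * gen s) < len w)%N.
Proof.
split=> [n|]; last exact: len_neg.
case: (len_Mgen coxWS s w) => [E|->//].
have /pos_antisym/(_ n)/act_alpha_neq0// : pos (act w (alpha s)).
by apply: len_pos; rewrite E.
Qed.

Lemma len_mulV w s : len (w^-1 * gen s) = len (gen s * w).
Proof. by rewrite -[LHS](lenV coxWS) invMg invgK genV. Qed.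

Lemma posVP w s : pos (act w^-1 (alpha s)) <-> len (gen s * w) = (len w).+1.
Proof.
rewrite posP_len len_mulV (lenV coxWS).
by case: (len_genM coxWS s w); lia.
Qed.

Lemma negVP w s : pos (- act w^-1 (alpha s))%R <-> len w = (len (gen s * w)).+1.
Proof.
rewrite negP_len len_mulV (lenV coxWS).
by case: (len_genM coxWS s w); lia.
Qed.

(** An element without right descents is trivial. *)
Lemma act_pos_eq1 w : (forall s, pos (act w (alpha s))) -> w = 1.
Proof.
move=> wp; apply: contrapT => /(@descent_ex _ _ _ _ coxWS w)[s].
by have /posP_len := wp s; lia.
Qed.

Lemma act_faithful w : (forall s, act w (alpha s) = alpha s) -> w = 1.
Proof. by move=> E; apply: act_pos_eq1 => s; rewrite E; exact: pos_alpha. Qed.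

Lemma act_reflection x s v :
  act (x * gen s * x^-1) v = (v - (2 * B (act x (alpha s)) v) *: act x (alpha s))%R.
Proof. by rewrite !actM act_gen reflectionE actB actZ actVK act_formV. Qed.

(** Both sides act on V as the reflection in the same root, and the action is
    faithful. *)
Lemma conj_gen x s y t :
  (act x (alpha s) = act y (alpha t) \/ act x (alpha s) = - act y (alpha t))%R ->
  x * gen s * x^-1 = y * gen t * y^-1.
Proof.
move=> E; apply: (mulIg (y * gen t * y^-1)^-1); rewrite mulgV.
apply: act_faithful => u; rewrite actM.
have -> v : act (y * gen t * y^-1)^-1 v = act (x * gen s * x^-1) v.
  have -> : (y * gen t * y^-1)^-1 = y * gen t * y^-1.
    by rewrite !invMg invgK genV mulgA.
  rewrite !act_reflection; case: E => -> //.
  by rewrite formNl mulrN scaleNr scalerN opprK.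
rewrite -actM.
have -> : x * gen s * x^-1 * (x * gen s * x^-1) = 1; last by rewrite act1.
by rewrite !mulgA mulgKV mulg_genK mulgV.
Qed.

Lemma gen_inj : injective gen.
Proof.
move=> s t st; have := act_gen coxWS s (alpha s).
rewrite [in LHS]st act_gen reflection_alpha reflection_alpha1 // => E.
apply: contrapT => /eqP nst; move/(congr1 (fun v : V => v s)): E.
rewrite !(scaleffE, ffunE) eqxx (negbTE nst) /= => F; glra.
Qed.

Lemma alt_double s t n : alt gen s t n.*2 = (gen s * gen t) ^+ n.
Proof.
elim: n => [|n IH]; first by rewrite expg0.
by rewrite doubleS /= IH expgSr mulgA.
Qed.

(** If the power n of st is trivial, the root alpha s comes back after 2n steps,
    which the sines allow only when m(s,t) divides n. *)
Lemma gen_order s t n : s != t -> (gen s * gen t) ^+ n = 1 ->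
  if m s t is Some k then (k %| n)%N else n == 0%N.
Proof.
move=> st; have ns : (s == t) = false by apply/negbTE.
have key j : (gen s * gen t) ^+ j = 1 ->
    (cheb (- gram R m s t) j.*2.+2 = 1 /\ cheb (- gram R m s t) j.*2.+1 = 0)%R.
  rewrite -alt_double => E; have [+ _] := act_alt R coxWS j.*2 st.
  rewrite E act1 odd_double => F; split.
    move/(congr1 (fun v : V => v s)): F.
    by rewrite !(scaleffE, ffunE) eqxx ns mulr1 mulr0 addr0.
  move/(congr1 (fun v : V => v t)): F.
  by rewrite !(scaleffE, ffunE) eqxx eq_sym ns mulr1 mulr0 add0r.
case mst : (m s t) => [k|] E; last first.
  have [_] := key _ E; rewrite /gram mst opprK cheb1 -natr1 addrK => /eqP.
  by rewrite pnatr_eq0 double_eq0.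
rewrite /dvdn; apply/negPn/negP => nk.
have k2 := cox_m2 coxWS st mst.
have /key : (gen s * gen t) ^+ (n %% k) = 1.
  move: E; rewrite {1}(divn_eq n k) expgD mulnC expgM (gen_rel coxWS mst).
  by rewrite expg1n mul1g.
by apply: (cheb_period coxWS st mst); rewrite lt0n nk ltn_mod; lia.
Qed.

(** * Parabolic subgroups *)

Lemma parabolic_Mgen T u t :
  parabolic gen T u -> t \in T -> parabolic gen T (u * gen t).
Proof. by move=> Tu tT; apply: parabolicM Tu _; exact: parabolic_gen. Qed.

Definition supp_in T (v : V) : Prop := forall t, t \notin T -> v t = 0%R.

Lemma parabolic_coord T w v t :
  parabolic gen T w -> t \notin T -> act w v t = v t.
Proof.
move=> Tw tT; move: w Tw v; apply: (@parabolic_ind _ _ _ _ coxWS) => [|s w sT _ IH] v.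
  by rewrite act1.
rewrite actM act_gen ffunE IH; case: eqP => [ts|_]; last by rewrite subr0.
by rewrite ts sT in tT.
Qed.

Lemma supp_act T w v : parabolic gen T w -> supp_in T v -> supp_in T (act w v).
Proof. by move=> Tw Tv t tT; rewrite (parabolic_coord _ Tw tT) Tv. Qed.

Lemma supp_alpha T t : t \in T -> supp_in T (alpha t).
Proof. by move=> tT u uT; rewrite ffunE; case: eqP uT => // ->; rewrite tT. Qed.

Lemma supp_sum T v : supp_in T v -> v = (\sum_(t in T) v t *: alpha t)%R.
Proof.
move=> Tv; rewrite [LHS]alpha_sum (bigID (mem T)) /= [X in (_ + X)%R]big1 ?addr0 //.
by move=> t /Tv ->; rewrite scale0r.
Qed.

Lemma parabolic_gen_in T s : parabolic gen T (gen s) -> s \in T.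
Proof.
move=> Ts; apply/negPn/negP => sT.
have /eqP := parabolic_coord (alpha s) Ts sT.
rewrite act_gen reflection_alpha1 // !ffunE eqxx -subr_eq0 -opprD oppr_eq0.
by rewrite -[X in (X + X)%R]/(1%:R)%R -natrD pnatr_eq0.
Qed.

Lemma parabolic_inj T U : parabolic gen T = parabolic gen U -> T = U.
Proof.
move=> E; apply/setP => s; apply/idP/idP => sT; apply: parabolic_gen_in.
  by rewrite -E; exact: parabolic_gen.
by rewrite E; exact: parabolic_gen.
Qed.

Lemma parabolic_pos_eq1 J u : parabolic gen J u ->
  (forall t, t \in J -> pos (act u (alpha t))) -> u = 1.
Proof.
move=> Ju up; apply: act_pos_eq1 => t; have [/up //|tJ] := boolP (t \in J).
case: (root_pos_neg u t) => // /(_ t); rewrite ffunE (parabolic_coord _ Ju tJ).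
by rewrite ffunE eqxx oppr_ge0 ler10.
Qed.

(** [v] is the shortest element of its coset W_J v. *)
Definition left_minimal J (v : W) : Prop :=
  forall t, t \in J -> pos (act v^-1 (alpha t)).

Lemma minimal_act J v r : left_minimal J v -> supp_in J r -> pos r ->
  pos (act v^-1 r).
Proof.
move=> vmin Jr rp; rewrite (supp_sum Jr) act_sum.
by apply: pos_sum => t tJ; rewrite actZ; apply: posZ (rp t) _; exact: vmin.
Qed.

(** The second factor is an element of minimal length of the coset W_J w. *)
Lemma coset_dec J w : exists u v,
  [/\ parabolic gen J u, left_minimal J v & w = u * v].
Proof.
pose P n := `[< exists2 u, parabolic gen J u & len (u^-1 * w) = n >].
have P0 : P (len w).
  by apply/asboolP; exists 1; [exact: parabolic1|rewrite invg1 mul1g].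
case: (ex_minnP (ex_intro (fun n => P n) _ P0)) => n /asboolP[u Ju un] nmin.
exists u, (u^-1 * w); split; rewrite ?mulVKg // => t tJ.
apply/posVP; case: (len_genM coxWS t (u^-1 * w)) => // E.
have /nmin : P (len (gen t * (u^-1 * w))); last by lia.
apply/asboolP; exists (u * gen t); first exact: parabolic_Mgen.
by rewrite invMg genV mulgA.
Qed.

(** Otherwise some simple root of J would be made negative by the factor of
    W_J, and then positive and negative at once by the minimal elements. *)
Lemma coset_dec_unique J u v u' v' : parabolic gen J u -> left_minimal J v ->
  parabolic gen J u' -> left_minimal J v' -> u * v = u' * v' -> u = u' /\ v = v'.
Proof.
move=> Ju vmin Ju' vmin' E; suff e : u'^-1 * u = 1.
  have e' : u = u' by rewrite -[LHS](mulVKg u') e mulg1.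
  by split=> //; move: E; rewrite e' => /mulgI.
have Je : parabolic gen J (u'^-1 * u) by apply: parabolicM => //; exact: parabolicV.
apply: (parabolic_pos_eq1 Je) => t tJ.
case: (root_pos_neg (u'^-1 * u) t) => // n; exfalso.
have vE : v'^-1 * (u'^-1 * u) = v^-1.
  by rewrite mulgA -invMg -E invMg mulgKV.
have : pos (act v'^-1 (- act (u'^-1 * u) (alpha t)))%R.
  apply: (minimal_act vmin') => // s sJ.
  by rewrite ffunE (supp_act Je (supp_alpha tJ) sJ) oppr0.
rewrite actN -actM vE => /(pos_antisym (vmin _ tJ)).
exact: act_alpha_neq0.
Qed.

Lemma form_root w s : B (act w (alpha s)) (act w (alpha s)) = 1%R.
Proof. by rewrite act_form form_alpha1. Qed.

(** A simple root spans an extreme ray of the cone of positive vectors, so all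
    the terms of the expansion of r become proportional to it. *)
Lemma simple_root_sum J v (r : V) s : left_minimal J v -> supp_in J r -> pos r ->
  act v^-1 r = alpha s -> exists2 t, t \in J & r = alpha t.
Proof.
move=> vmin Jr rp E.
have single t : t \in J -> (r t != 0)%R -> act v^-1 (alpha t) = alpha s.
  move=> tJ rt; have rt0 : (0 < r t)%R by rewrite lt_def rt rp.
  have vt := vmin _ tJ.
  have out a : a != s -> act v^-1 (alpha t) a = 0%R.
    move=> /negbTE as_; apply/eqP; rewrite eq_le vt andbT.
    move/(congr1 (fun v : V => v a)): E; rewrite ffunE as_.
    rewrite (supp_sum Jr) (bigD1 t) //= actD ffunE actZ scaleffE.
    set z := (X in (_ + X)%R); have z0 : (0 <= z)%R.
      rewrite /z act_sum; apply: pos_sum => u /andP[uJ _].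
      by rewrite actZ; apply: posZ (rp u) _; exact: vmin.
    move=> F; rewrite -(pmulr_rle0 _ rt0); lra.
  have F : act v^-1 (alpha t) = (act v^-1 (alpha t) s *: alpha s)%R.
    apply/ffunP => a; rewrite scaleffE ffunE.
    by case: eqP => [->|/eqP/out ->]; rewrite ?mulr1 ?mulr0.
  have := form_root v^-1 t; rewrite F formZl formZr form_alpha1 // mulr1.
  have := vt s; move: (act _ _ s) => c c0 c1.
  have -> : c = 1%R.
    by apply/eqP; rewrite -(@eqrXn2 _ 2 _ _ _ c0 ler01) // expr1n expr2 c1.
  by rewrite scale1r.
have [t tJ rt] : exists2 t, t \in J & (r t != 0)%R.
  apply: contrapT => H; apply: (@alpha_neq0 s); rewrite -E.
  rewrite (supp_sum Jr) big1 ?act0 // => t tJ.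
  have [->|rt] := eqVneq (r t) 0%R; first by rewrite scale0r.
  by exfalso; apply: H; exists t.
exists t => //; apply: (@act_inj R W S m gen coxWS v^-1).
by rewrite E single.
Qed.

(** A reflection whose root lies in the span of the simple roots of T belongs
    to W_T: move the root by the factor in W_T of a minimal coset
    decomposition, which makes it simple. *)
Lemma root_parabolic T x s :
  supp_in T (act x (alpha s)) -> parabolic gen T (x * gen s * x^-1) /\
  exists u t, [/\ parabolic gen T u, t \in T & act x (alpha s) = act u (alpha t)].
Proof.
wlog p : x / pos (act x (alpha s)).
  move=> H; case: (root_pos_neg x s) => [|n] Tx; first exact: H.
  have E : act (x * gen s) (alpha s) = (- act x (alpha s))%R.
    by rewrite actM act_gen reflection_alpha1 // actN.
  have [||P [u [t [Tu tT ut]]]] := H (x * gen s); rewrite ?E //.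
    by move=> t /Tx xt; rewrite ffunE xt oppr0.
  split; first by move: P; rewrite invMg genV !mulgA mulg_genK.
  exists (u * gen t), t; split => //; first exact: parabolic_Mgen.
  by rewrite actM act_gen reflection_alpha1 // actN -ut E opprK.
move=> Tx; have [u [v [Tu vmin xE]]] := coset_dec T x.
pose r := act u^-1 (act x (alpha s)).
have Tr : supp_in T r by apply: supp_act => //; exact: parabolicV.
have rE : act v^-1 r = alpha s by rewrite /r -!actM xE -invMg mulVg act1.
have rroot : r = act v (alpha s) by rewrite /r -actM xE mulKg.
case: (root_pos_neg v s) => vp; rewrite -rroot in vp.
  have [t tT rt] := simple_root_sum vmin Tr vp rE.
  have xt : act x (alpha s) = act u (alpha t) by rewrite -rt actVK.
  split; last by exists u, t.
  rewrite (@conj_gen x s u t); last by left.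
  by apply: parabolicM; [apply: parabolicM => //; exact: parabolic_gen|exact: parabolicV].
have : pos (act v^-1 (- r)%R).
  by apply: (minimal_act vmin) => // t /Tr rt; rewrite ffunE rt oppr0.
rewrite actN rE => /(pos_antisym (@pos_alpha R S s)) z.
by case: (alpha_neq0 z).
Qed.

(** * Infinite dihedral subgroups *)

Section InfiniteDihedral.
Variables s t : S.
Hypothesis mst : m s t = None.
Local Notation delta := (alpha s + alpha t)%R.

Lemma inf_neq : s != t.
Proof. by apply: contra_eq_neq mst => <-; rewrite (cox_m1 coxWS). Qed.

Lemma act_delta : act (gen s) delta = delta /\ act (gen t) delta = delta.
Proof.
have g : gram R m s t = (-1)%R by rewrite /gram mst.
have g' : gram R m t s = (-1)%R by rewrite gramC.
by split; rewrite actD !act_gen reflection_alpha1 // reflection_alpha ?g ?g'; vec.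
Qed.

Lemma form_delta : B delta delta = 0%R.
Proof.
have g : gram R m s t = (-1)%R by rewrite /gram mst.
have g' : gram R m t s = (-1)%R by rewrite gramC.
by rewrite formDl !formDr !form_alpha !gram1 // g g'; lra.
Qed.

(** The isotropic vector [delta] is dominated by no inversion set: shortening
    w on the left by s or t does not change its image. *)
Lemma pos_delta w : pos (act w^-1 delta).
Proof.
have [n] := ubnP (len w); elim: n w => // n IH w wn.
have [ds dt] := act_delta.
case: (root_pos_neg w^-1 s) => [ps|/negVP ns]; last first.
  by have := IH (gen s * w); rewrite invMg actM genV ds; apply; lia.
case: (root_pos_neg w^-1 t) => [pt|/negVP nt]; last first.
  by have := IH (gen t * w); rewrite invMg actM genV dt; apply; lia.
by rewrite actD; exact: posD.
Qed.

Lemma delta_neq0 : delta <> 0%R.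
Proof.
move/(congr1 (fun v : V => v s)); rewrite !ffunE eqxx (negbTE inf_neq) => /eqP.
by rewrite addr0 oner_eq0.
Qed.

Lemma not_both_descents w :
  ~ (pos (- act w^-1 (alpha s))%R /\ pos (- act w^-1 (alpha t))%R).
Proof.
move=> [ns nt]; have n : pos (- act w^-1 delta)%R.
  by rewrite actD opprD; exact: posD.
have := pos_antisym (pos_delta w) n; rewrite -(act0 R coxWS w^-1).
by move/act_inj/delta_neq0.
Qed.

Lemma act_st n : act ((gen s * gen t) ^+ n) (alpha s) = (alpha s + n.*2%:R *: delta)%R
  /\ act ((gen s * gen t) ^+ n) (alpha t) = (alpha t - n.*2%:R *: delta)%R.
Proof.
have g : gram R m s t = (-1)%R by rewrite /gram mst.
have g' : gram R m t s = (-1)%R by rewrite gramC.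
have [ds dt] := act_delta.
elim: n => [|n [IHs IHt]]; first by rewrite !act1 double0 scale0r addr0 subr0.
rewrite !expgS !actM IHs IHt !actD !actN !actZ dt ds.
rewrite !act_gen reflection_alpha1 // reflection_alpha g'.
rewrite reflectionE formBr formZr !form_alpha gram1 // g.
rewrite reflectionE !formNr form_alpha g.
have -> : (n.+1.*2%:R = n.*2%:R + 2 :> R)%R by rewrite doubleS -!natr1; lra.
by split; vec.
Qed.

Lemma act_st_delta n : act ((gen s * gen t) ^+ n) delta = delta.
Proof. by rewrite actD; have [-> ->] := act_st n; vec. Qed.

Lemma act_stV n :
  act ((gen s * gen t) ^+ n)^-1 (alpha t) = (alpha t + n.*2%:R *: delta)%R.
Proof.
apply: (@act_inj R W S m gen coxWS ((gen s * gen t) ^+ n)).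
by rewrite actVK actD actZ act_st_delta; have [_ ->] := act_st n; vec.
Qed.

(** Left multiplication by powers of st moves away from the walls of t as
    soon as it does at the first step. *)
Lemma len_st n w : pos (act w^-1 (alpha t)) ->
  len ((gen s * gen t) ^+ n * w) = (n.*2 + len w)%N.
Proof.
move=> wt; elim: n => [|n IH]; first by rewrite mul1g.
have inv : pos (act ((gen s * gen t) ^+ n * w)^-1 (alpha t)).
  rewrite invMg actM act_stV.
  rewrite actD actZ; apply: posD => //; apply: posZ; first by rewrite ler0n.
  exact: pos_delta.
rewrite expgS -!mulgA.
have [ds dt] := act_delta.
have := inv; rewrite posVP => E1.
have /posVP -> : pos (act (gen t * ((gen s * gen t) ^+ n * w))^-1 (alpha s)).
  have -> : alpha s = (delta - alpha t)%R by vec.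
  rewrite invMg actM genV actB dt [act (gen t) _]act_gen.
  rewrite reflection_alpha1 // opprK actD; apply: posD => //; exact: pos_delta.
by rewrite E1 IH doubleS !addSn.
Qed.

End InfiniteDihedral.

End Roots.

(** * Finite parabolic subgroups *)

Section Spherical.
Variables (R : realType) (W : groupType) (S : finType).
Variables (m : S -> S -> option nat) (gen : S -> W).
Hypothesis coxWS : is_coxeter_system m gen.
Local Notation V := {ffun S -> R}.
Local Notation B := (@form R S m).
Local Notation alpha := (@alpha R S).
Local Notation act := (@act R W S m gen coxWS).
Local Notation len := (len coxWS).
Implicit Types (w x y : W) (s t : S) (T U J : {set S}).
Local Open Scope group_scope.

Let mxC : is_coxeter_matrix m. Proof. by case: coxWS. Qed.
Let genV s : (gen s)^-1 = gen s := genV coxWS s.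
Let gengen s : gen s * gen s = 1 := gengen coxWS s.
Let genK s w : gen s * (gen s * w) = w := genK coxWS s w.
Let mulg_genK s w : w * gen s * gen s = w := mulg_genK coxWS s w.

Lemma spherical_enum T : spherical gen T ->
  exists e : seq W, uniq e /\ forall w, (w \in e) <-> parabolic gen T w.
Proof.
move=> /finite_seqP[e E]; exists (undup e); rewrite undup_uniq; split=> // w.
by rewrite mem_undup E.
Qed.

Section SumOverGroup.
Variables (T : {set S}) (e : seq W).
Hypotheses (e_uniq : uniq e) (eP : forall w, (w \in e) <-> parabolic gen T w).

Lemma perm_mull y : parabolic gen T y -> perm_eq [seq y * x | x <- e] e.
Proof.
move=> Ty; apply: uniq_perm => //; first by rewrite map_inj_uniq //; exact: mulgI.
move=> x; apply/mapP/idP => [[z /eP Tz ->]|/eP Tx]; first by apply/eP; exact: parabolicM.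
exists (y^-1 * x); rewrite ?mulVKg //; apply/eP.
exact: parabolicM (parabolicV Ty) Tx.
Qed.

Lemma perm_mulr y : parabolic gen T y -> perm_eq [seq x * y | x <- e] e.
Proof.
move=> Ty; apply: uniq_perm => //; first by rewrite map_inj_uniq //; exact: mulIg.
move=> x; apply/mapP/idP => [[z /eP Tz ->]|/eP Tx]; first by apply/eP; exact: parabolicM.
exists (x * y^-1); rewrite ?mulgKV //; apply/eP.
exact: parabolicM Tx (parabolicV Ty).
Qed.

Definition dot (u v : V) : R := (\sum_a u a * v a)%R.

Lemma dot_ge0 v : (0 <= dot v v)%R.
Proof. by apply: sumr_ge0 => a _; rewrite -expr2 sqr_ge0. Qed.

Lemma dot_gt0 v : v <> 0%R -> (0 < dot v v)%R.
Proof.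
move=> v0; rewrite lt_def dot_ge0 andbT; apply/eqP => d0; apply: v0.
apply/ffunP => a; rewrite ffunE.
apply/eqP; rewrite -sqrf_eq0; apply/eqP; rewrite expr2.
by apply: (psumr_eq0P (P := predT) _ d0) => // b _; rewrite -expr2 sqr_ge0.
Qed.

Definition avg_form (u v : V) : R := (\sum_(x <- e) dot (act x u) (act x v))%R.
Local Notation G := avg_form.

Lemma avg_invariant y u v : parabolic gen T y -> G (act y u) (act y v) = G u v.
Proof.
move=> Ty; rewrite /G -[in RHS](perm_big _ (perm_mulr Ty)) big_map.
by apply: eq_bigr => x _; rewrite !actM.
Qed.

Lemma avgC u v : G u v = G v u.
Proof.
by apply: eq_bigr => x _; apply: eq_bigr => a _; rewrite mulrC.
Qed.
Lemma avgDl u v (w : V) : G (u + v)%R w = (G u w + G v w)%R.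
Proof.
rewrite /G -big_split; apply: eq_bigr => x _; rewrite /dot -big_split.
by apply: eq_bigr => a _; rewrite actD ffunE mulrDl.
Qed.
Lemma avgZl c v (w : V) : G (c *: v)%R w = (c * G v w)%R.
Proof.
rewrite /G big_distrr; apply: eq_bigr => x _; rewrite /dot big_distrr.
by apply: eq_bigr => a _; rewrite actZ scaleffE /= mulrA.
Qed.
Lemma avgDr u v (w : V) : G u (v + w)%R = (G u v + G u w)%R.
Proof. by rewrite avgC avgDl !(avgC _ u). Qed.
Lemma avgZr c v (w : V) : G v (c *: w)%R = (c * G v w)%R.
Proof. by rewrite avgC avgZl avgC. Qed.
Lemma avg_suml I r (P : pred I) (F : I -> V) v :
  G (\sum_(i <- r | P i) F i)%R v = (\sum_(i <- r | P i) G (F i) v)%R.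
Proof.
apply: (big_morph (G^~ v)) => [x y|]; first exact: avgDl.
by rewrite -(scale0r (0%R : V)) avgZl mul0r.
Qed.
Lemma avg_sumr I r (P : pred I) (F : I -> V) v :
  G v (\sum_(i <- r | P i) F i)%R = (\sum_(i <- r | P i) G v (F i))%R.
Proof. by rewrite avgC avg_suml; apply: eq_bigr => i _; rewrite avgC. Qed.

Lemma avg_gt0 v : v <> 0%R -> (0 < G v v)%R.
Proof.
move=> v0; have e1 : 1 \in e by apply/eP; exact: parabolic1.
rewrite /G (big_rem _ e1) /= act1; apply: ltr_pwDl; first exact: dot_gt0.
by apply: sumr_ge0 => x _; exact: dot_ge0.
Qed.

(** The invariant form and the Tits form determine the same hyperplane
    orthogonal to a simple root, since both are preserved by its reflection. *)
Lemma avg_alpha t v : t \in T -> G (alpha t) v = (G (alpha t) (alpha t) * B (alpha t) v)%R.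
Proof.
move=> tT; have := avg_invariant (alpha t) v (parabolic_gen tT).
rewrite !act_gen reflection_alpha1 // reflectionE.
rewrite -[(- alpha t)%R]scaleN1r avgZl avgDr -[(- (_ *: _))%R]scaleNr avgZr; glra.
Qed.

(** Positivity of the averaged form passes to the Tits form after rescaling
    the simple roots, the scaling factors of two non-orthogonal simple roots
    being equal. *)
Lemma form_posdef_enum v : supp_in T v -> v <> 0%R -> (0 < B v v)%R.
Proof.
move=> Tv v0; pose c t := G (alpha t) (alpha t).
have c0 t : (0 < c t)%R by apply: avg_gt0; exact: alpha_neq0.
pose x := (\sum_(t in T) (v t / Num.sqrt (c t)) *: alpha t)%R.
have xE t : t \in T -> x t = (v t / Num.sqrt (c t))%R.
  move=> tT; rewrite sum_ffunE (bigD1 t) //= scaleffE ffunE eqxx mulr1.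
  rewrite big1 ?addr0 // => u /andP[_ /negbTE ut].
  by rewrite scaleffE ffunE eq_sym ut mulr0.
have -> : B v v = G x x; last first.
  apply: avg_gt0 => x0; apply: v0; apply/ffunP => t; rewrite ffunE.
  have [tT|/Tv//] := boolP (t \in T).
  have := xE _ tT; rewrite x0 ffunE => /esym/eqP.
  rewrite mulf_eq0 invr_eq0 sqrtr_eq0 leNgt c0 orbF; exact/eqP.
rewrite {1 2}(supp_sum Tv) form_suml avg_suml; apply: eq_bigr => t tT.
rewrite form_sumr avg_sumr; apply: eq_bigr => u uT.
rewrite formZl formZr avgZl avgZr.
have E1 : G (alpha t) (alpha u) = (c t * B (alpha t) (alpha u))%R by exact: avg_alpha.
have E2 : G (alpha t) (alpha u) = (c u * B (alpha t) (alpha u))%R.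
  by rewrite avgC avg_alpha // (formC mxC).
have [b0|b0] := eqVneq (B (alpha t) (alpha u)) 0%R.
  by rewrite E1 b0 !mulr0.
(* The two averaged norms agree as soon as the roots are not orthogonal. *)
have cE : c t = c u by apply: (mulIf b0); rewrite -E1 -E2.
have sc : Num.sqrt (c t) != 0%R by rewrite sqrtr_eq0 -ltNge.
have cq : c t = (Num.sqrt (c t) ^+ 2)%R by rewrite sqr_sqrtr // ltW.
rewrite E1 -cE; move: sc cq; set q : R := Num.sqrt (c t) => q0 ->.
move: q q0 => q q0; move: (B _ _) => b; rewrite expr2.
transitivity (v t * (v u * b) * (q^-1 * q) * (q^-1 * q))%R; last by glra.
by rewrite mulVf // !mulr1.
Qed.

(** The sum over the orbit is fixed by W_T. *)
Lemma orbit_sum_orth v t : t \in T -> B (alpha t) (\sum_(x <- e) act x v)%R = 0%R.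
Proof.
move=> tT; set z := (\sum_(x <- e) _)%R.
have zE : act (gen t) z = z.
  rewrite /z act_sum -[RHS](perm_big _ (perm_mull (parabolic_gen tT))) big_map.
  by apply: eq_bigr => x _; rewrite actM.
have : B (alpha t) (act (gen t) z) = (- B (alpha t) z)%R.
  rewrite -formNl -(@reflection_alpha1 R S m mxC) -(act_gen coxWS).
  by rewrite act_formV genV.
rewrite zE; glra.
Qed.

End SumOverGroup.

Lemma form_posdef T v : spherical gen T -> supp_in T v -> v <> 0%R -> (0 < B v v)%R.
Proof. by move=> /spherical_enum[e [eu eP]]; exact: (form_posdef_enum eu eP). Qed.

Lemma form_ge0 T v : spherical gen T -> supp_in T v -> (0 <= B v v)%R.
Proof.
move=> sT Tv; have [->|/eqP v0] := eqVneq v 0%R; first by rewrite form0l.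
by apply/ltW/(form_posdef sT).
Qed.

Lemma suppD T (u v : V) : supp_in T u -> supp_in T v -> supp_in T (u + v)%R.
Proof. by move=> Tu Tv t tT; rewrite ffunE Tu // Tv // addr0. Qed.
Lemma suppZ T c (v : V) : supp_in T v -> supp_in T (c *: v)%R.
Proof. by move=> Tv t tT; rewrite scaleffE Tv // mulr0. Qed.
Lemma suppN T (v : V) : supp_in T v -> supp_in T (- v)%R.
Proof. by move=> Tv; rewrite -scaleN1r; exact: suppZ. Qed.
Lemma suppB T (u v : V) : supp_in T u -> supp_in T v -> supp_in T (u - v)%R.
Proof. by move=> Tu Tv; apply: suppD => //; exact: suppN. Qed.
Lemma suppS T U (v : V) : T \subset U -> supp_in T v -> supp_in U v.
Proof. by move=> /fintype.subsetP TU Tv t tU; apply: Tv; apply: contra tU; exact: TU. Qed.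

(** Cauchy-Schwarz inequality against a unit vector. *)
Lemma form_CS T u v : spherical gen T -> supp_in T u -> supp_in T v ->
  B v v = 1%R -> (`|B u v| <= Num.sqrt (B u u))%R.
Proof.
move=> sT Tu Tv v1; rewrite -sqrtr_sqr ler_wsqrtr //.
have : (0 <= B (u - B u v *: v) (u - B u v *: v))%R.
  by apply: (form_ge0 sT); apply: suppB => //; exact: suppZ.
rewrite !(formBl, formBr, formZl, formZr) v1 (formC mxC v u) expr2; glra.
Qed.

Lemma spherical_finite_m T s t : spherical gen T -> s \in T -> t \in T ->
  m s t <> None.
Proof.
move=> sT sT' tT mst; have := form_delta R coxWS mst.
have : (0 < B (alpha s + alpha t) (alpha s + alpha t))%R.
  apply: (form_posdef sT); last by move=> E0; exact (delta_neq0 coxWS mst E0).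
  by apply: suppD; exact: supp_alpha.
by move=> + E; rewrite E ltxx.
Qed.

(** The dihedral group of order 2k consists of the powers of st and of their
    products with s. *)
Lemma spherical_pair s t k : m s t = Some k -> spherical gen [set s; t].
Proof.
move=> mst; pose r := gen s * gen t.
have k0 : (0 < k)%N.
  case: (eqVneq s t) mst => [->|st /(cox_m2 coxWS st)]; last by lia.
  by rewrite (cox_m1 coxWS) => -[<-].
have rE n : r ^+ n = r ^+ (n %% k).
  rewrite {1}(divn_eq n k) expgD mulnC expgM (gen_rel coxWS mst).
  by rewrite expg1n mul1g.
have srn n : gen s * r ^+ n = r ^+ (n * k.-1) * gen s.
  have rV : r^-1 = r ^+ k.-1.
    apply: (mulgI r); rewrite mulgV -expgS prednK //.
    exact/esym/(gen_rel coxWS).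
  rewrite mulnC expgM -rV; elim: n => [|n IH]; first by rewrite mulg1 mul1g.
  rewrite (expgSr r) mulgA IH [in RHS]expgSr -!mulgA; congr (_ * _).
  by rewrite /r invMg !genV genK -mulgA gengen mulg1.
pose L := [seq r ^+ i * (if b then gen s else 1) | i <- iota 0 k, b <- [:: true; false]].
have LP w : (w \in L) <-> exists n (b : bool), w = r ^+ n * (if b then gen s else 1).
  split=> [/allpairsP[[n b] [_ _ ->]]|[n [b ->]]]; first by exists n, b.
  apply/allpairsP; exists ((n %% k)%N, b); split=> /=.
  - by rewrite mem_iota add0n ltn_mod.
  - by case: b.
  - by rewrite -rE.
apply: (sub_finite_set (B := [set` L])); last exact: finite_seq.
apply: (@parabolic_ind _ _ _ _ coxWS).
  by apply/LP; exists 0%N, false; rewrite mulg1.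
move=> u w uT _ /LP[n [b ->]]; apply/LP.
have sE : gen s * (r ^+ n * (if b then gen s else 1)) =
   r ^+ (n * k.-1) * (if ~~ b then gen s else 1).
  by rewrite mulgA srn -mulgA; case: b; rewrite ?gengen // mulg1.
have tE : gen t = r ^+ k.-1 * gen s.
  have := srn 1%N; rewrite mul1n expg1 /r genK; exact.
move: uT; rewrite !inE => /orP[/eqP ->|/eqP ->]; first by rewrite sE; exists (n * k.-1)%N, (~~ b).
by rewrite tE -mulgA sE mulgA -expgD; exists (k.-1 + n * k.-1)%N, (~~ b).
Qed.

(** ** Centers of the faces of the cells *)

(** The Gram matrix of T is invertible, since the form is positive definite on
    the span of T; it is extended by the identity outside T. *)
Lemma gram_solve T (b : S -> R) : spherical gen T ->
  exists2 p, supp_in T p & forall t, t \in T -> B (alpha t) p = b t.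
Proof.
move=> sT; pose n := #|S|.
pose M : 'M[R]_n := \matrix_(i, j)
  (if (enum_val i \in T) && (enum_val j \in T)
   then gram R m (enum_val i) (enum_val j) else (i == j)%:R)%R.
have ME i j : M i j = (if (enum_val i \in T) && (enum_val j \in T)
   then gram R m (enum_val i) (enum_val j) else (i == j)%:R)%R by rewrite mxE.
pose vec_of (x : 'rV[R]_n) : V := [ffun s => x ord0 (enum_rank s)].
have MP (x : 'rV[R]_n) j : (x *m M)%R ord0 j =
   if enum_val j \in T then B (alpha (enum_val j)) [ffun s => if s \in T then vec_of x s else 0%R]
   else x ord0 j.
  rewrite mxE; case: ifP => jT.
    rewrite -pairingE /pairing (reindex _ (onW_bij _ (@enum_val_bij S))) /=.
    apply: eq_bigr => i _; rewrite ME !ffunE jT andbT enum_valK.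
    case: ifP => iT; first by rewrite mulrC (gramC R mxC).
    rewrite mulr0; case: eqP => [ij|_]; last by rewrite mulr0.
    by rewrite ij jT in iT.
  rewrite (bigD1 j) //= ME jT andbF eqxx mulr1 big1 ?addr0 // => i /negbTE ij.
  by rewrite ME jT andbF ij mulr0.
have Mfree : row_free M.
  apply: inj_row_free => x xM.
  pose v : V := [ffun s => if s \in T then vec_of x s else 0%R].
  have Tv : supp_in T v by move=> t /negbTE tT; rewrite ffunE tT.
  have Bv t : t \in T -> B (alpha t) v = 0%R.
    move=> tT; have := MP x (enum_rank t); rewrite enum_rankK tT xM mxE.
    exact: esym.
  have v0 : v = 0%R.
    apply: contrapT => /(form_posdef sT Tv).
    rewrite {1}(supp_sum Tv) form_suml big1 ?ltxx // => t tT.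
    by rewrite formZl Bv // mulr0.
  apply/rowP => j; rewrite mxE.
  have := MP x j; rewrite xM mxE; case: ifP => jT // _.
  move/(congr1 (fun v : V => v (enum_val j))): v0.
  by rewrite !ffunE jT enum_valK.
have Munit : M \in unitmx by rewrite -row_free_unit.
pose y : 'rV[R]_n := (\row_j b (enum_val j) *m invmx M)%R.
exists [ffun s => if s \in T then vec_of y s else 0%R].
  by move=> t /negbTE tT; rewrite ffunE tT.
move=> t tT; have := MP y (enum_rank t); rewrite enum_rankK tT => <-.
by rewrite /y mulmxKV // mxE enum_rankK.
Qed.

Lemma form_nondeg T v : spherical gen T -> supp_in T v ->
  (forall t, t \in T -> B (alpha t) v = 0%R) -> v = 0%R.
Proof.
move=> sT Tv Bv; apply: contrapT => /(form_posdef sT Tv).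
rewrite {1}(supp_sum Tv) form_suml big1 ?ltxx // => t tT.
by rewrite formZl Bv // mulr0.
Qed.

(** The vector of V_T at distance 1/2 of the walls of the simple roots of T. *)
Definition cell_vertex T : V := face_center R m T finset.set0.

Lemma face_center_spec T U : spherical gen T -> U \subset T ->
  exists p q, [/\ supp_in T p, (forall t, t \in T -> B (alpha t) p = 1 / 2)%R,
    supp_in U q, (forall t, t \in U -> B (alpha t) q = 1 / 2)%R
    & face_center R m T U = (p - q)%R].
Proof.
move=> sT UT; have sU := sphericalS coxWS UT sT.
have [p Tp Bp] := gram_solve (fun=> 1 / 2)%R sT.
have [q Uq Bq] := gram_solve (fun=> 1 / 2)%R sU.
exists p, q; split=> //; rewrite /face_center; apply: xget_subset1.
  exists p; split=> // t tU.
  - by rewrite pairingE Bp.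
  - by rewrite !ffunE (Uq _ tU) subr0.
  - by rewrite pairingE formBr Bp ?(fintype.subsetP UT) // Bq // subrr.
move=> b1 b2 [p1 [Tp1 Bp1 b1p Bb1]] [p2 [Tp2 Bp2 b2p Bb2]].
have pE : p1 = p2.
  apply/eqP; rewrite -subr_eq0; apply/eqP/(form_nondeg sT); first exact: suppB.
  by move=> t tT; rewrite formBr -!pairingE Bp1 // Bp2 // subrr.
apply/eqP; rewrite -subr_eq0; apply/eqP/(form_nondeg sU).
  by move=> t tU; rewrite !ffunE b1p // b2p // pE subrr.
by move=> t tU; rewrite formBr -!pairingE Bb1 // Bb2 // subrr.
Qed.

Lemma cell_vertexP T : spherical gen T -> supp_in T (cell_vertex T) /\
  forall t, t \in T -> B (alpha t) (cell_vertex T) = (1 / 2)%R.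
Proof.
move=> sT; have [p [q [Tp Bp q0 _ E]]] := face_center_spec sT (finset.sub0set T).
have -> : cell_vertex T = p; last by [].
rewrite /cell_vertex E; apply/ffunP => t.
by rewrite !ffunE q0 ?inE // subr0.
Qed.

Lemma face_centerE T U : spherical gen T -> U \subset T ->
  face_center R m T U = (cell_vertex T - cell_vertex U)%R.
Proof.
move=> sT UT; have sU := sphericalS coxWS UT sT.
have uniq_vertex X p : spherical gen X -> supp_in X p ->
    (forall t, t \in X -> B (alpha t) p = 1 / 2)%R -> p = cell_vertex X.
  move=> sX Xp Bp; have [Xc Bc] := cell_vertexP sX.
  apply/eqP; rewrite -subr_eq0; apply/eqP/(form_nondeg sX); first exact: suppB.
  by move=> t tX; rewrite formBr Bp // Bc // subrr.
have [p [q [Tp Bp Uq Bq ->]]] := face_center_spec sT UT.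
by rewrite (uniq_vertex T p) // (uniq_vertex U q).
Qed.

(** ** The dual position of the center of a face *)

Definition height (v : V) : R := (\sum_t v t)%R.

Lemma heightD u v : height (u + v)%R = (height u + height v)%R.
Proof. by rewrite /height -big_split; apply: eq_bigr => t _; rewrite ffunE. Qed.
Lemma heightZ c v : height (c *: v)%R = (c * height v)%R.
Proof. by rewrite /height big_distrr; apply: eq_bigr => t _; rewrite scaleffE. Qed.
Lemma height_alpha t : height (alpha t) = 1%R.
Proof.
rewrite /height (bigD1 t) //= ffunE eqxx big1 ?addr0 // => s /negbTE st.
by rewrite ffunE st.
Qed.

(** For positive v the form B v v is at most the square of the sum of the
    coordinates, the entries of the Gram matrix being at most 1. *)
Lemma root_height x s : pos (act x (alpha s)) -> (1 <= height (act x (alpha s)))%R.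
Proof.
move=> p; have := form_root R coxWS x s; move: (act x _) p => v p B1.
have h0 : (0 <= height v)%R by apply: sumr_ge0 => t _; exact: p.
have : (1 <= height v * height v)%R.
  rewrite -B1 {1 2}(alpha_sum v) form_suml /height big_distrl /=.
  apply: ler_sum => t _; rewrite form_sumr big_distrr /=; apply: ler_sum => u _.
  rewrite formZl formZr form_alpha mulrA ler_piMr ?mulr_ge0 //.
  have [->|tu] := eqVneq t u; first by rewrite gram1.
  by apply: le_trans (gram_le0 R mxC tu) _; exact: ler01.
move=> hh; rewrite leNgt; apply/negP => h1; nra.
Qed.

(** The pairing of a vector with the position of the center of the face U of a
    cell, the position of the vertex x0 being half the sum of coordinates. *)
Definition xi U (v : V) : R := (height v / 2 - B (cell_vertex U) v)%R.

Lemma xiD U u v : xi U (u + v)%R = (xi U u + xi U v)%R.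
Proof. by rewrite /xi heightD formDr; glra. Qed.
Lemma xiZ U c v : xi U (c *: v)%R = (c * xi U v)%R.
Proof. by rewrite /xi heightZ formZr; glra. Qed.
Lemma xiN U v : xi U (- v)%R = (- xi U v)%R.
Proof. by rewrite -scaleN1r xiZ mulN1r. Qed.

Lemma xi_alpha U t : spherical gen U -> t \in U -> xi U (alpha t) = 0%R.
Proof.
move=> sU tU; rewrite /xi height_alpha (formC mxC).
by have [_ ->] := cell_vertexP sU; rewrite // subrr.
Qed.

Lemma xi_supp U v : spherical gen U -> supp_in U v -> xi U v = 0%R.
Proof.
move=> sU Uv; rewrite (supp_sum Uv); apply: (big_ind (fun v => xi U v = 0%R)).
- by rewrite -(scale0r (0%R : V)) xiZ mul0r.
- by move=> u w u0 w0; rewrite xiD u0 w0 addr0.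
- by move=> t tU; rewrite xiZ xi_alpha // mulr0.
Qed.

Lemma xi_invariant U x v : spherical gen U -> parabolic gen U x ->
  xi U (act x v) = xi U v.
Proof.
move=> sU; move: x; apply: (@parabolic_ind _ _ _ _ coxWS) => [|s x sU' _ IH].
  by rewrite act1.
rewrite actM act_gen reflectionE xiD xiN xiZ xi_alpha // mulr0 subr0.
exact: IH.
Qed.

Lemma root_pos_coord x s t : (0 < act x (alpha s) t)%R -> pos (act x (alpha s)).
Proof.
by move=> h; case: (root_pos_neg R coxWS x s) => // /(_ t); rewrite ffunE oppr_ge0 leNgt h.
Qed.

(** Averaging over W_U kills the contribution of the center, so some root in
    the W_U-orbit has a non-positive product with it. *)
Lemma xi_ge U x s : spherical gen U -> pos (act x (alpha s)) ->
  ~ supp_in U (act x (alpha s)) -> (1 / 2 <= xi U (act x (alpha s)))%R.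
Proof.
move=> sU p nU.
have [t tU xt] : exists2 t, t \notin U & (0 < act x (alpha s) t)%R.
  apply: contrapT => H; apply: nU => t tU; apply/eqP; rewrite eq_le p andbT.
  by rewrite leNgt; apply/negP => xt; apply: H; exists t.
have [e [eu eP]] := spherical_enum sU; have [Uc _] := cell_vertexP sU.
have [u ue Bu] : exists2 u, u \in e & (B (cell_vertex U) (act u (act x (alpha s))) <= 0)%R.
  apply: contrapT => H.
  have : (0 < \sum_(u <- e) B (cell_vertex U) (act u (act x (alpha s))))%R.
    have e1 : 1 \in e by apply/eP; exact: parabolic1.
    have P u : u \in e -> (0 < B (cell_vertex U) (act u (act x (alpha s))))%R.
      by move=> ue; rewrite ltNge; apply/negP => Bu; apply: H; exists u.
    rewrite (big_rem _ e1) /=; apply: ltr_pwDl; first exact: P.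
    by rewrite big_seq; apply: sumr_ge0 => u /mem_rem/P/ltW.
  rewrite -form_sumr {1}(supp_sum Uc) form_suml big1 ?ltxx // => a aU.
  by rewrite formZl (orbit_sum_orth eu eP) // mulr0.
move/eP in ue.
rewrite -(xi_invariant _ sU ue) /xi -actM.
have : pos (act (u * x) (alpha s)).
  by apply: (root_pos_coord (t := t)); rewrite actM (parabolic_coord _ _ ue tU).
by move/root_height; move: Bu; rewrite -actM; glra.
Qed.

End Spherical.

(** * Maps on the Davis complex *)

Section DavisMaps.
Variables (R : realType) (W : groupType) (S : finType).
Variables (m : S -> S -> option nat) (gen : S -> W).
Hypothesis coxWS : is_coxeter_system m gen.
Local Notation cone := (cone R gen).
Local Notation davis := (davis R gen).
Implicit Types (w : W) (s t : S) (T U J : {set S}) (x y : cone) (p q : davis).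
Local Open Scope quotient_scope.
Local Open Scope group_scope.

Let genV s : (gen s)^-1 = gen s := genV coxWS s.
Let gengen s : gen s * gen s = 1 := gengen coxWS s.
Let genK s w : gen s * (gen s * w) = w := genK coxWS s w.
Let mulg_genK s w : w * gen s * gen s = w := mulg_genK coxWS s w.

Lemma coneP x : in_cone gen (bcoord x : {ptws {set S} -> R}).
Proof. by rewrite -in_setE; exact: (valP x). Qed.

Lemma bcoord_ge0 x T : (0 <= bcoord x T)%R.
Proof. by case: (coneP x). Qed.
Lemma bcoord_sum x : (\sum_T bcoord x T = 1)%R.
Proof. by case: (coneP x). Qed.
Lemma bcoord_spherical x T : bcoord x T != 0%R -> spherical gen T.
Proof. by case: (coneP x) => _ _ + _; exact. Qed.
Lemma bcoord_chain x T U : bcoord x T != 0%R -> bcoord x U != 0%R ->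
  T \subset U \/ U \subset T.
Proof. by case: (coneP x) => _ _ _; exact. Qed.
Lemma bcoord_le1 x T : (bcoord x T <= 1)%R.
Proof.
rewrite -(bcoord_sum x) (bigD1 T) //= lerDl; apply: sumr_ge0 => U _.
exact: bcoord_ge0.
Qed.
Lemma bcoord_inj x y : bcoord x =1 bcoord y -> x = y.
Proof. by move=> xy; apply: val_inj; apply/funext. Qed.
Lemma bcoord_apex T : bcoord (apex R gen) T = (T == finset.set0)%:R%R.
Proof. by []. Qed.

Lemma bcoord_nonzero x : exists T, bcoord x T != 0%R.
Proof.
apply: contrapT => H; have := bcoord_sum x; rewrite big1; first by move/esym/eqP; rewrite oner_eq0.
by move=> T _; apply/eqP/negPn/negP => xT; apply: H; exists T.
Qed.

Lemma top_ex x : exists2 T, bcoord x T != 0%R & below T x.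
Proof.
have [T0 xT0] := bcoord_nonzero x.
case: (@arg_maxnP _ T0 (fun T => bcoord x T != 0%R) (fun T => #|T|) xT0) => T xT Tmax.
exists T => // U xU; case: (bcoord_chain xU xT) => // TU.
by have /eqP <- : T == U by rewrite eqEcard TU; exact: Tmax.
Qed.

Lemma bottom_ex x : exists2 T, bcoord x T != 0%R &
  forall U, bcoord x U != 0%R -> T \subset U.
Proof.
have [T0 xT0] := bcoord_nonzero x.
case: (@arg_minnP _ T0 (fun T => bcoord x T != 0%R) (fun T => #|T|) xT0) => T xT Tmin.
exists T => // U xU; case: (bcoord_chain xT xU) => // UT.
by have /eqP <- : U == T by rewrite eqEcard UT; exact: Tmin.
Qed.

(** ** Functions defined chamber by chamber *)

Lemma davis_surj p : exists w x, p = pt w x.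
Proof. by exists (repr p).1, (repr p).2; rewrite /pt -surjective_pairing reprK. Qed.

Definition compatible (X : Type) (g : W -> cone -> X) : Prop :=
  forall w s x, facet s x -> g (w * gen s) x = g w x.

Lemma lift_eq (X : Type) (g : W -> cone -> X) w x w' x' :
  compatible g -> pt w x = pt w' x' -> g w x = g w' x'.
Proof.
move=> gP /ptP; pose h (p : chambers R gen) := g p.1 p.2.
suff H a b : Relation_Operators.clos_refl_sym_trans _ (@Defs.glue R W S gen) a b ->
    h a = h b by move/H.
elim=> {a b} [a b [u [s [z [sz -> ->]]]]|//|a b _ ->//|a b c _ -> _ ->//].
by rewrite /h /= gP.
Qed.

Definition lift (X : Type) (g : W -> cone -> X) (p : davis) : X :=
  g (repr p).1 (repr p).2.

Lemma liftE (X : Type) (g : W -> cone -> X) w x :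
  compatible g -> lift g (pt w x) = g w x.
Proof.
by move=> gP; apply: lift_eq => //; rewrite /pt -surjective_pairing reprK.
Qed.

Lemma pt_facet w s x : facet s x -> pt (w * gen s) x = pt w x.
Proof.
move=> sx; apply/ptP; apply: Relation_Operators.rst_sym.
by apply: Relation_Operators.rst_step; exists w, s, x.
Qed.

Lemma pt_parabolic w u x T : parabolic gen T u ->
  (forall U, bcoord x U != 0%R -> T \subset U) -> pt (w * u) x = pt w x.
Proof.
move=> Tu Tx; move: u Tu w.
apply: (@parabolic_ind _ _ _ _ coxWS) => [|s u sT _ IH] w; first by rewrite mulg1.
rewrite mulgA IH pt_facet // => U /Tx /fintype.subsetP; exact.
Qed.

Lemma bcoord_continuous T : continuous (fun x : cone => bcoord x T).
Proof.
have -> : (fun x : cone => bcoord x T) = (@proj _ (fun=> R : topologicalType) T) \o val.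
  by [].
move=> x; apply: continuous_comp; first exact: initial_continuous.
exact: proj_continuous.
Qed.

Lemma cone_continuous (X : topologicalType) (f : X -> cone) :
  (forall T, continuous (fun z => bcoord (f z) T)) -> continuous f.
Proof.
move=> fc; apply: continuous_comp_initial => z.
apply/cvg_sup => T U [_ [[C oC <-]] /= Cz /filterS]; apply; apply: (fc T z).
exact: open_nbhs_nbhs.
Qed.

Lemma lift_continuous (X : topologicalType) (g : W -> cone -> X) :
  compatible g -> (forall w, continuous (g w)) -> continuous (lift g : davis -> X).
Proof.
move=> gP gc; apply/quotient_continuous.
have -> : lift g \o \pi_davis = (fun p : chambers R gen => g p.1 p.2).
  by apply/funext => -[w x]; exact: liftE.
move=> [w x] A /= /gc xA.
exists ([set w], g w @^-1` A); first by split=> //; exact: discrete_set1.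
by move=> [w' x'] [/= -> ].
Qed.

Lemma pt_continuous w : continuous (pt w : cone -> davis).
Proof.
have -> : (pt w : cone -> davis) = \pi_davis \o (fun x => (w, x) : chambers R gen) by [].
move=> x; apply: continuous_comp; last exact: pi_continuous.
move=> A [[B C] [/= wB xC] BCA]; apply: filterS xC => y yC; apply: BCA.
by split=> //; exact: nbhs_singleton wB.
Qed.

(** ** Diagram automorphisms *)

Lemma induced_autP (f : {perm S}) : is_diagram_aut m f ->
  {morph induced_aut gen f : x y / x * y} /\
  forall s, induced_aut gen f (gen s) = gen (f s).
Proof.
move=> df; have [phi phiP] : exists phi : W -> W,
    {morph phi : x y / x * y} /\ forall s, phi (gen s) = gen (f s).
  case: (coxWS) => _ _ _; apply => s t k mk.
  by apply: (gen_rel coxWS); rewrite df.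
rewrite /induced_aut; apply: (@xgetI _ _ [set phi : W -> W |
  {morph phi : x y / x * y} /\ forall s, phi (gen s) = gen (f s)]).
exact: phiP.
Qed.

Lemma diagram_aut1 : is_diagram_aut m 1. Proof. by move=> s t; rewrite !perm1. Qed.
Lemma diagram_autM f g :
  is_diagram_aut m f -> is_diagram_aut m g -> is_diagram_aut m (g * f).
Proof. by move=> df dg s t; rewrite !permM df dg. Qed.
Lemma diagram_autV f : is_diagram_aut m f -> is_diagram_aut m f^-1.
Proof. by move=> df s t; rewrite -df !permKV. Qed.

Lemma morph_eq (phi psi : W -> W) : {morph phi : x y / x * y} ->
  {morph psi : x y / x * y} -> (forall s, phi (gen s) = psi (gen s)) -> phi =1 psi.
Proof.
move=> phiM psiM e; apply: (@cox_ind _ _ _ _ coxWS); last first.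
  by move=> s w IH; rewrite phiM psiM e IH.
have m1 (h : W -> W) : {morph h : x y / x * y} -> h 1 = 1.
  by move=> hM; apply: (mulgI (h 1)); rewrite -hM !mulg1.
by rewrite !m1.
Qed.

Section DiagramAut.
Variables (f : {perm S}).
Hypothesis df : is_diagram_aut m f.
Local Notation fb := (induced_aut gen f).

Lemma indM : {morph fb : x y / x * y}. Proof. by case: (induced_autP df). Qed.
Lemma ind_gen s : fb (gen s) = gen (f s). Proof. by case: (induced_autP df). Qed.
Lemma ind1 : fb 1 = 1. Proof. by apply: (mulgI (fb 1)); rewrite -indM !mulg1. Qed.
Lemma ind_parabolic T w : parabolic gen T w -> parabolic gen (f @: T) (fb w).
Proof.
move: w; apply: (@parabolic_ind _ _ _ _ coxWS) => [|s w sT _ IH].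
  by rewrite ind1; exact: parabolic1.
by rewrite indM ind_gen; apply: (parabolicM (parabolic_gen (imset_f f sT)) IH).
Qed.

Lemma ind_fix T w : parabolic gen T w -> {in T, f =1 id} -> fb w = w.
Proof.
move=> Tw fT; move: w Tw.
apply: (@parabolic_ind _ _ _ _ coxWS) => [|s w sT _ IH]; first exact: ind1.
by rewrite indM ind_gen IH fT.
Qed.

Lemma spherical_img T : spherical gen T -> spherical gen (f @: T).
Proof.
move=> sT; apply: (sub_finite_set (B := fb @` parabolic gen T)).
  apply: (@parabolic_ind _ _ _ _ coxWS) => [|s w /imsetP[t tT ->] _ [u Tu <-]].
    by exists 1; [exact: parabolic1|exact: ind1].
  exists (gen t * u); last by rewrite indM ind_gen.
  exact: parabolicM (parabolic_gen tT) Tu.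
exact: finite_image.
Qed.

End DiagramAut.

Lemma ind_id : induced_aut gen 1 =1 id.
Proof.
apply: morph_eq => // [|s]; first exact: (indM diagram_aut1).
by rewrite (ind_gen diagram_aut1) perm1.
Qed.

Lemma ind_comp f g : is_diagram_aut m f -> is_diagram_aut m g ->
  induced_aut gen (g * f) =1 induced_aut gen f \o induced_aut gen g.
Proof.
move=> df dg; have dgf := diagram_autM df dg.
apply: morph_eq => [||s]; first exact: indM.
  by move=> x y /=; rewrite !indM.
by rewrite /= !ind_gen // permM.
Qed.

Lemma imset_preim (f : {perm S}) T : f @: (f @^-1: T) = T.
Proof.
apply/setP => s; apply/imsetP/idP => [[t /[!inE] tT -> //]|sT].
by exists (f^-1 s)%g; rewrite ?inE permKV.
Qed.
Lemma preim_imset (f : {perm S}) T : f @^-1: (f @: T) = T.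
Proof. by apply/setP => s; rewrite inE mem_imset //; exact: perm_inj. Qed.

Lemma bcoord_cone_map f x T : is_diagram_aut m f ->
  bcoord (cone_map f x) T = bcoord x (f @^-1: T).
Proof.
move=> df; rewrite /cone_map /bcoord insubdK // inE; split => [U|||].
- exact: bcoord_ge0.
- rewrite -(bcoord_sum x) [RHS](reindex (fun U : {set S} => f @^-1: U)) //=.
  exists (fun U : {set S} => f @: U) => U _; first exact: imset_preim.
  exact: preim_imset.
- move=> U xU; rewrite -(imset_preim f U); apply: (spherical_img df).
  exact: bcoord_spherical xU.
- move=> U1 U2 x1 x2; case: (bcoord_chain x1 x2) => H; [left|right];
    by rewrite -(imset_preim f U1) -(imset_preim f U2) imsetS.
Qed.

Lemma bcoord_cone_map_img f x T : is_diagram_aut m f ->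
  bcoord (cone_map f x) (f @: T) = bcoord x T.
Proof. by move=> df; rewrite bcoord_cone_map // preim_imset. Qed.

Lemma cone_map1 x : cone_map 1 x = x.
Proof.
apply: bcoord_inj => T; rewrite (bcoord_cone_map _ _ diagram_aut1).
by congr bcoord; apply/setP => s; rewrite inE perm1.
Qed.

Lemma cone_mapM f g x : is_diagram_aut m f -> is_diagram_aut m g ->
  cone_map f (cone_map g x) = cone_map (g * f) x.
Proof.
move=> df dg; apply: bcoord_inj => T; have dgf := diagram_autM df dg.
rewrite !bcoord_cone_map //.
by congr bcoord; apply/setP => s; rewrite !inE permM.
Qed.

Lemma eq_cone_map f g x : is_diagram_aut m f -> is_diagram_aut m g ->
  (forall U, bcoord x U != 0%R -> {in U, f =1 g}) -> cone_map f x = cone_map g x.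
Proof.
move=> df dg fg; apply: bcoord_inj => T; rewrite !bcoord_cone_map //.
have key (a b : {perm S}) : (forall U, bcoord x U != 0%R -> {in U, a =1 b}) ->
    bcoord x (a @^-1: T) != 0%R -> bcoord x (a @^-1: T) = bcoord x (b @^-1: T).
  move=> ab xa; congr bcoord.
  have : a @: (a @^-1: T) = b @: (a @^-1: T).
    by apply: eq_in_imset; exact: ab.
  rewrite imset_preim => /(congr1 (fun U : {set S} => b @^-1: U)).
  by rewrite preim_imset.
have [x0|x0] := eqVneq (bcoord x (f @^-1: T)) 0%R; last exact: key.
have [y0|y0] := eqVneq (bcoord x (g @^-1: T)) 0%R; first by rewrite x0 y0.
by apply/esym/key => // U xU s sU; rewrite (fg _ xU _ sU).
Qed.

Lemma cone_map_continuous f : is_diagram_aut m f ->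
  continuous (cone_map f : cone -> cone).
Proof.
move=> df; apply: cone_continuous => T.
under eq_fun do rewrite bcoord_cone_map //.
exact: bcoord_continuous.
Qed.

(** ** Automorphisms given by local data *)

(** An automorphism of the Cayley graph preserving the cells permutes the
    edges at each vertex w by a diagram automorphism F w, and the permutations
    at the ends of an edge agree on the facet shared by the two chambers. *)
Definition local_data (al : W -> W) (F : W -> {perm S}) : Prop :=
  [/\ (forall w, is_diagram_aut m (F w)),
      (forall w t, al (w * gen t) = al w * gen (F w t))
    & (forall w t t', m t t' <> None -> F (w * gen t) t' = F w t')].

Definition local_map (al : W -> W) (F : W -> {perm S}) : davis -> davis :=
  lift (fun w x => pt (al w) (cone_map (F w) x)).

Section LocalData.
Variables (al : W -> W) (F : W -> {perm S}).
Hypothesis ld : local_data al F.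

Let dF w : is_diagram_aut m (F w). Proof. by case: ld. Qed.

(** In a spherical subset all the m(s,t) are finite, so the permutations at the
    vertices of a cell agree on its type. *)
Lemma local_agree T w u : spherical gen T -> parabolic gen T u ->
  {in T, F (w * u) =1 F w}.
Proof.
move=> sT Tu; move: u Tu w.
apply: (@parabolic_ind _ _ _ _ coxWS) => [|s u sU _ IH] w t tT; first by rewrite mulg1.
rewrite mulgA IH //; case: ld => _ _; apply.
exact: (spherical_finite_m R coxWS sT).
Qed.

Lemma local_parabolic T w u : spherical gen T -> parabolic gen T u ->
  exists2 u', parabolic gen (F w @: T) u' & al (w * u) = al w * u'.
Proof.
move=> sT Tu; move: u Tu w.
apply: (@parabolic_ind _ _ _ _ coxWS) => [|s u sU Tu IH] w.
  by exists 1; rewrite ?mulg1 //; exact: parabolic1.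
have Tsu := parabolicM (parabolic_gen sU) Tu.
have [u' Fu' E] := IH (w * gen s); exists (gen (F w s) * u').
  apply: (parabolicM (parabolic_gen (imset_f _ sU))).
  have -> : F w @: T = F (w * gen s) @: T; last by [].
  apply: eq_in_imset => t tT; apply/esym.
  exact: (local_agree w sT (parabolic_gen sU)).
by rewrite mulgA E; case: ld => _ -> _; rewrite mulgA.
Qed.

Lemma local_compatible : compatible (fun w x => pt (al w) (cone_map (F w) x)).
Proof.
move=> w s x sx.
have -> : cone_map (F (w * gen s)) x = cone_map (F w) x.
  apply: eq_cone_map => // U xU; apply: (@local_agree U).
    exact: bcoord_spherical xU.
  exact: (parabolic_gen (sx _ xU)).
case: ld => _ -> _; apply: pt_facet => T.
rewrite bcoord_cone_map // => /sx; rewrite inE; exact.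
Qed.

Lemma local_mapE w x : local_map al F (pt w x) = pt (al w) (cone_map (F w) x).
Proof. by rewrite /local_map liftE //; exact: local_compatible. Qed.

Lemma local_map_continuous : continuous (local_map al F).
Proof.
apply: lift_continuous; first exact: local_compatible.
move=> w x; apply: continuous_comp; first exact: cone_map_continuous.
exact: pt_continuous.
Qed.

Lemma local_map_cell w T : spherical gen T ->
  local_map al F @` open_cell w T `<=` open_cell (al w) (F w @: T).
Proof.
move=> sT _ [_ [u [x [Tu Tx xT ->]]] <-].
rewrite local_mapE; have [u' Fu' ->] := local_parabolic w sT Tu.
have E : cone_map (F (w * u)) x = cone_map (F w) x.
  apply: eq_cone_map => // U /Tx /fintype.subsetP UT s /UT.
  exact: local_agree.
exists u', (cone_map (F w) x); split; rewrite ?E //.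
  move=> U; rewrite bcoord_cone_map // => /Tx /(imsetS (F w)).
  by rewrite imset_preim.
by rewrite bcoord_cone_map_img.
Qed.

Lemma local_inverse (be : W -> W) : cancel al be -> cancel be al ->
  local_data be (fun w => (F (be w))^-1).
Proof.
move=> alK beK; have beS w t : be (w * gen t) = be w * gen ((F (be w))^-1 t).
  apply: (can_inj alK); rewrite beK; case: ld => _ -> _.
  by rewrite beK permKV.
split=> [w|//|w t t' mt]; first exact: diagram_autV.
apply: (@perm_inj _ (F (be (w * gen t)))); rewrite permKV beS.
case: ld => _ _ ->; first by rewrite permKV.
by rewrite (diagram_autV (dF _)).
Qed.

End LocalData.

Lemma local_mapK al F be : local_data al F -> cancel al be -> cancel be al ->
  cancel (local_map al F) (local_map be (fun w => (F (be w))^-1)).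
Proof.
move=> ld alK beK p; have ld' := local_inverse ld alK beK.
have [w [x ->]] := davis_surj p; rewrite !local_mapE // alK.
rewrite cone_mapM ?mulgV ?cone_map1 //; last by case: ld.
by case: ld' => /(_ (al w)); rewrite alK.
Qed.

Lemma local_mapVK al F be : local_data al F -> cancel al be -> cancel be al ->
  cancel (local_map be (fun w => (F (be w))^-1)) (local_map al F).
Proof.
move=> ld alK beK p; have ld' := local_inverse ld alK beK.
have [w [x ->]] := davis_surj p; rewrite !local_mapE // beK.
by rewrite cone_mapM ?mulVg ?cone_map1 //; [case: ld|case: ld'].
Qed.

Lemma local_map_open_cell al F be w T : local_data al F -> cancel al be ->
  cancel be al -> spherical gen T ->
  local_map al F @` open_cell w T = open_cell (al w) (F w @: T).
Proof.
move=> ld alK beK sT; apply/seteqP; split; first exact: local_map_cell.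
move=> p wp; have ld' := local_inverse ld alK beK.
exists (local_map be (fun w => (F (be w))^-1) p); last exact: local_mapVK.
have dF : is_diagram_aut m (F w) by case: ld.
have := local_map_cell (T := F w @: T) ld' (w := al w) (spherical_img dF sT).
have -> : [set ((F (be (al w)))^-1)%g s | s in F w @: T]%SET = T.
  rewrite alK -imset_comp -[RHS]imset_id; apply: eq_imset => s /=.
  exact: permK.
rewrite alK.
by apply; exists p.
Qed.

Lemma local_map_cell_aut al F be : local_data al F -> cancel al be ->
  cancel be al -> (local_map al F : davis -> davis) \in @is_cell_aut R W S gen.
Proof.
move=> ld alK beK; have ld' := local_inverse ld alK beK.
have hK := local_mapK ld alK beK; have hVK := local_mapVK ld alK beK.
rewrite inE; split.
- by exists (local_map be (fun w => (F (be w))^-1)).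
- exact: local_map_continuous.
- move=> g gK; suff -> : g = local_map be (fun w => (F (be w))^-1).
    exact: local_map_continuous.
  by apply/funext => p; rewrite -{1}(hVK p) gK.
- move=> C; split=> [[w [T [sT ->]]]|[w [T [sT E]]]].
    exists (al w), (F w @: T); split; last exact: local_map_open_cell alK beK sT.
    by apply: spherical_img => //; case: ld.
  have -> : C = local_map be (fun w => (F (be w))^-1) @` (local_map al F @` C).
    rewrite image_comp (_ : _ \o _ = id) ?image_id //.
    by apply/funext => p; exact: hK.
  rewrite E (local_map_open_cell w ld' beK alK sT).
  eexists; eexists; split; last reflexivity.
  by apply: spherical_img => //; case: ld'.
Qed.

Definition local_aut al F be (ld : local_data al F) (alK : cancel al be)
  (beK : cancel be al) : cell_aut R gen := SigSub (local_map_cell_aut ld alK beK).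

Lemma wact_data v : local_data ( *%g v) (fun=> 1).
Proof.
by split=> [w|w t|w t t' _]; rewrite ?perm1 ?mulgA //; exact: diagram_aut1.
Qed.

Lemma wact_local v : wact v = local_map ( *%g v) (fun=> 1).
Proof.
apply/funext => p; have [w [x ->]] := davis_surj p.
by rewrite wactE (local_mapE (wact_data v)) cone_map1.
Qed.

Lemma hat_data f : is_diagram_aut m f -> local_data (induced_aut gen f) (fun=> f).
Proof. by move=> df; split=> // w t; rewrite indM // ind_gen. Qed.

Lemma hat_local f : hat f = local_map (induced_aut gen f) (fun=> f) :> (davis -> davis).
Proof. by []. Qed.

Lemma ind_cancel f : is_diagram_aut m f ->
  cancel (induced_aut gen f) (induced_aut gen f^-1) /\
  cancel (induced_aut gen f^-1) (induced_aut gen f).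
Proof.
move=> df; have dfV := diagram_autV df.
split=> w.
  by rewrite -[LHS](ind_comp dfV df) mulgV ind_id.
by rewrite -[LHS](ind_comp df dfV) mulVg ind_id.
Qed.

(** ** Vertices and their stars *)

(** Its positivity cuts out the open star of the vertex v x0. *)
Definition vertex_coord v : davis -> R :=
  lift (fun w x => if w == v then bcoord x finset.set0 else 0%R).

Lemma facet_apex0 s x : facet s x -> bcoord x finset.set0 = 0%R.
Proof.
by move=> sx; apply/eqP/negPn/negP => /sx; rewrite inE.
Qed.

Lemma vertex_coordE v w x :
  vertex_coord v (pt w x) = if w == v then bcoord x finset.set0 else 0%R.
Proof.
by rewrite /vertex_coord liftE // => u s y /facet_apex0 ->; rewrite !if_same.
Qed.

Lemma vertex_coord_continuous v : continuous (vertex_coord v).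
Proof.
apply: lift_continuous => [u s y /facet_apex0 ->|w]; first by rewrite !if_same.
by case: eqP => _; [exact: bcoord_continuous|exact: cst_continuous].
Qed.

Definition vertex w : davis := pt w (apex R gen).

Lemma vertex_coord_vertex v w : vertex_coord v (vertex w) = (w == v)%:R%R.
Proof. by rewrite vertex_coordE bcoord_apex eqxx; case: (w == v). Qed.

Lemma vertex_inj : injective vertex.
Proof.
move=> v w vw; have := vertex_coord_vertex w v.
rewrite vw vertex_coord_vertex eqxx; case: eqP => // _ /eqP.
by rewrite oner_eq0.
Qed.

Lemma closed_cell_base w T : closed_cell w T (base_vertex R gen) ->
  exists2 u, parabolic gen T u & w * u = 1.
Proof.
move=> [u [x [Tu _ E]]]; exists u => //.
have := vertex_coord_vertex 1 1; rewrite /vertex.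
rewrite [pt 1 _]E vertex_coordE eqxx; case: eqP => // _ /esym/eqP.
by rewrite oner_eq0.
Qed.

End DavisMaps.

(** * The vertices determine a cellular automorphism *)

Section VertexMaps.
Variables (R : realType) (W : groupType) (S : finType).
Variables (m : S -> S -> option nat) (gen : S -> W).
Hypothesis coxWS : is_coxeter_system m gen.
Local Notation cone := (cone R gen).
Local Notation davis := (davis R gen).
Local Notation vertex := (@vertex R W S gen).
Implicit Types (w v : W) (s t : S) (T U J : {set S}) (x y : cone) (p q : davis).
Implicit Types (h k : cell_aut R gen).
Local Open Scope quotient_scope.
Local Open Scope group_scope.

Let genV s : (gen s)^-1 = gen s := genV coxWS s.
Let gengen s : gen s * gen s = 1 := gengen coxWS s.
Let genK s w : gen s * (gen s * w) = w := genK coxWS s w.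
Let mulg_genK s w : w * gen s * gen s = w := mulg_genK coxWS s w.

(** The projection of the line onto the unit interval, in a form that is visibly
    continuous. *)
Definition clamp (c : R) : R := ((`|c| - `|c - 1| + 1) / 2)%R.

Lemma clamp_bounds c : (0 <= clamp c <= 1)%R.
Proof.
rewrite /clamp; apply/andP; case: (lerP 0 c) => c0; case: (lerP 0 (c - 1)) => c1;
  rewrite ?(ger0_norm c0) ?(ger0_norm c1) ?(ltr0_norm c0) ?(ltr0_norm c1); split; lra.
Qed.

Lemma clamp_id c : (0 <= c <= 1)%R -> clamp c = c.
Proof.
move=> /andP[c0 c1]; rewrite /clamp ger0_norm // distrC ger0_norm ?subr_ge0 //; lra.
Qed.

Lemma clamp_continuous : continuous clamp.
Proof.
move=> c; apply: cvgM; last exact: cvg_cst.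
apply: cvgD; last exact: cvg_cst.
apply: cvgB; first exact: norm_continuous.
by apply: cvg_norm; apply: cvgB; [exact: cvg_id|exact: cvg_cst].
Qed.

(** The point at parameter c of the segment from the apex to x. *)
Definition slide (c : R) (x : cone) : cone :=
  insubd (apex R gen) (fun T => clamp c * bcoord x T + (1 - clamp c) * (T == finset.set0)%:R)%R.

Lemma bcoord_slide_clamp (c : R) x T : bcoord (slide c x) T =
  (clamp c * bcoord x T + (1 - clamp c) * (T == finset.set0)%:R)%R.
Proof.
have := clamp_bounds c; rewrite /slide; move: (clamp c) => {}c /andP[c0 c1].
rewrite /bcoord insubdK // inE.
have nz U : (c * bcoord x U + (1 - c) * (U == finset.set0)%:R)%R != 0%R ->
    bcoord x U != 0%R \/ U = finset.set0.
  case: (eqVneq U finset.set0) => [->|_]; first by right.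
  rewrite mulr0 addr0 mulf_eq0 => /norP[_]; by left.
split => [U|||].
- by rewrite addr_ge0 ?mulr_ge0 ?bcoord_ge0 ?ler0n // subr_ge0.
- rewrite big_split -!big_distrr /= bcoord_sum.
  rewrite [X in (_ + _ * X)%R](bigD1 finset.set0) //= eqxx big1; last by move=> U /negbTE ->.
  by rewrite addr0 !mulr1 addrC subrK.
- by move=> U /nz[/bcoord_spherical//|->]; exact: spherical0.
- move=> U1 U2 /nz[x1|->]; last by left; exact: finset.sub0set.
  by move=> /nz[|->]; [exact: bcoord_chain|right; exact: finset.sub0set].
Qed.

Lemma bcoord_slide (c : R) x T : (0 <= c <= 1)%R ->
  bcoord (slide c x) T = (c * bcoord x T + (1 - c) * (T == finset.set0)%:R)%R.
Proof. by move=> c01; rewrite bcoord_slide_clamp clamp_id. Qed.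

Lemma slide0 x : slide 0 x = apex R gen.
Proof.
apply: bcoord_inj => T; rewrite bcoord_slide ?lexx ?ler01 // bcoord_apex.
by rewrite mul0r add0r subr0 mul1r.
Qed.

Lemma slide1 x : slide 1 x = x.
Proof.
apply: bcoord_inj => T; rewrite bcoord_slide ?lexx ?ler01 //.
by rewrite mul1r subrr mul0r addr0.
Qed.

Lemma slide_continuous w x : continuous (fun c : R => pt w (slide c x) : davis).
Proof.
move=> c; apply: (@continuous_comp _ _ _ (slide^~ x) (pt w)); last exact: pt_continuous.
apply: cone_continuous => T {}c; rewrite /continuous_at.
under eq_fun do rewrite bcoord_slide_clamp.
rewrite bcoord_slide_clamp.
apply: cvgD; apply: cvgM; do ?exact: cvg_cst; do ?exact: clamp_continuous.
by apply: cvgB; [exact: cvg_cst|exact: clamp_continuous].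
Qed.

Definition center T : cone :=
  insubd (apex R gen) (fun U => (U == T)%:R : R).

Lemma bcoord_center T U : spherical gen T -> bcoord (center T) U = (U == T)%:R%R.
Proof.
move=> sT; rewrite /center /bcoord insubdK // inE; split=> [X|||].
- exact: ler0n.
- by rewrite (bigD1 T) //= eqxx big1 ?addr0 // => X /negbTE ->.
- by move=> X; case: (X =P T) => [->//|_]; rewrite eqxx.
- move=> X Y; case: (X =P T) => [->|_]; last by rewrite eqxx.
  by case: (Y =P T) => [->|_]; [left|rewrite eqxx].
Qed.

Lemma parabolic0 w : parabolic gen finset.set0 w -> w = 1.
Proof.
by move: w; apply: (@parabolic_ind _ _ _ _ coxWS) => // s w; rewrite inE.
Qed.

Lemma parabolic1s s w : parabolic gen [set s] w -> w = 1 \/ w = gen s.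
Proof.
move: w; apply: (@parabolic_ind _ _ _ _ coxWS) => [|t w /set1P -> _ [->|->]].
- by left.
- by right; rewrite mulg1.
- by left.
Qed.

Lemma open_cell0 w : @open_cell R W S gen w finset.set0 = [set vertex w].
Proof.
apply/seteqP; split=> [p [u [x [/parabolic0 -> xb _ ->]]]|_ ->].
  rewrite mulg1 /vertex; congr pt; apply: bcoord_inj => T; rewrite bcoord_apex.
  have out U : U != finset.set0 -> bcoord x U = 0%R.
    move=> U0; apply/eqP/negPn/negP => /xb; rewrite finset.subset0.
    by rewrite (negbTE U0).
  case: eqVneq => [->|/out//]; have := bcoord_sum x.
  by rewrite (bigD1 finset.set0) //= big1 ?addr0.
exists 1, (apex R gen); rewrite mulg1; split=> //; first exact: parabolic1.
  by move=> U; rewrite bcoord_apex; case: (U =P finset.set0) => [->|_]; rewrite ?eqxx.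
by rewrite bcoord_apex eqxx oner_neq0.
Qed.

Lemma open_cell_vertex w : is_open_cell [set vertex w].
Proof.
by exists w, finset.set0; split; [exact: spherical0|rewrite open_cell0].
Qed.

Lemma half01 : (0 <= (1 / 2 : R) <= 1)%R.
Proof. by apply/andP; split; lra. Qed.

(** A cell of positive dimension contains its center and the midpoint of the
    segment that joins it to a vertex. *)
Lemma singleton_open_cell w T p : spherical gen T ->
  open_cell w T = [set p] -> T = finset.set0.
Proof.
move=> sT E; apply: contrapT => /eqP T0.
have p1 : open_cell w T (pt w (center T)).
  exists 1, (center T); rewrite mulg1; split=> //; first exact: parabolic1.
    by move=> U; rewrite bcoord_center //; case: (U =P T) => [->|_]; rewrite ?eqxx.
  by rewrite bcoord_center // eqxx oner_neq0.
have p2 : open_cell w T (pt w (slide (1 / 2)%R (center T))).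
  exists 1, (slide (1 / 2)%R (center T)); rewrite mulg1; split=> //; first exact: parabolic1.
    move=> U; rewrite bcoord_slide ?half01 // bcoord_center //.
    case: (U =P T) => [->//|_]; case: (U =P finset.set0) => [-> _|_]; first exact: finset.sub0set.
    by rewrite !mulr0 addr0 eqxx.
  rewrite bcoord_slide ?half01 // bcoord_center // eqxx (negbTE T0) mulr1 mulr0 addr0.
  by rewrite gt_eqF // divr_gt0.
move: p1 p2; rewrite E => /= p1 p2.
have := congr1 (vertex_coord w) (etrans p2 (esym p1)).
rewrite !vertex_coordE eqxx bcoord_slide ?half01 // !bcoord_center // eqxx.
rewrite eq_sym (negbTE T0) mulr0 add0r mulr1 mulr0n => F; glra.
Qed.

Lemma vertex_image h w : exists v, cell_fun h (vertex w) = vertex v.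
Proof.
have /(cell_aut_open h) [v [T [sT E]]] := open_cell_vertex w.
rewrite image_set1 in E; exists v.
have T0 := singleton_open_cell sT (esym E).
have : [set cell_fun h (vertex w)] (cell_fun h (vertex w)) by [].
by rewrite E T0 open_cell0.
Qed.

Definition vmap h w : W := projT1 (cid (vertex_image h w)).

Lemma vmapE h w : cell_fun h (vertex w) = vertex (vmap h w).
Proof. exact: projT2 (cid (vertex_image h w)). Qed.

Lemma vmapK h k : cancel (cell_fun h) (cell_fun k) -> cancel (vmap h) (vmap k).
Proof.
move=> hk w; apply: (@vertex_inj R W S gen); rewrite -!vmapE; exact: hk.
Qed.

Lemma vertex_nbhs v : nbhs (vertex v) [set p | (0 < vertex_coord v p)%R].
Proof.
apply: (@vertex_coord_continuous R W S gen v (vertex v) [set c : R | (0 < c)%R]).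
apply: open_nbhs_nbhs; split; first exact: open_gt.
by rewrite /= vertex_coord_vertex eqxx ltr01.
Qed.

(** The open star of a vertex meets only the cells that contain this vertex, and
    the segment from the vertex to the center of the cell lies in the cell. *)
Lemma vertex_closure w T v : spherical gen T ->
  closure (open_cell w T) (vertex v) <-> parabolic gen T (w^-1 * v).
Proof.
move=> sT; split=> [cl|Tv].
  have [_ [[u [x [Tu _ _ ->]]]] /=] := cl _ (vertex_nbhs v).
  by rewrite vertex_coordE; case: eqP => [<- _|_]; rewrite ?ltxx // mulKg.
move=> A Av.
have := @slide_continuous v (center T) 0%R A.
rewrite slide0 => /(_ Av) [e /= e0 eA]; pose c := Num.min (e / 2)%R 1%R.
have c0 : (0 < c)%R by rewrite lt_min divr_gt0 // ltr01.
have c1 : (c <= 1)%R by rewrite ge_min lexx orbT.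
have c01 : (0 <= c <= 1)%R by rewrite ltW.
exists (pt v (slide c (center T))); split; last first.
  apply: eA; rewrite /= sub0r normrN gtr0_norm //.
  apply: (@le_lt_trans _ _ (e / 2)%R); first by rewrite ge_min lexx.
  by rewrite ltr_pdivrMr // mulr2n mulrDr mulr1 ltrDr.
exists (w^-1 * v), (slide c (center T)); split=> //; last by rewrite mulVKg.
  move=> U; rewrite bcoord_slide // bcoord_center //.
  case: (U =P T) => [->//|_]; case: (U =P finset.set0) => [-> _|_]; first exact: finset.sub0set.
  by rewrite !mulr0 addr0 eqxx.
rewrite bcoord_slide // bcoord_center // eqxx mulr1 gt_eqF //.
by rewrite ltr_pwDl // mulr_ge0 ?ler0n // subr_ge0.
Qed.

Lemma closure_image (X Y : topologicalType) (f : X -> Y) (A : set X) a :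
  continuous f -> closure A a -> closure (f @` A) (f a).
Proof.
move=> fc cl N Nf; have [b [Ab Nb]] := cl _ (fc a _ Nf).
by exists (f b); split=> //; exists b.
Qed.

Lemma cell_fun_continuous h : continuous (cell_fun h : davis -> davis).
Proof. by case: h => h hP; case: (set_mem hP). Qed.

Lemma vertex_closure_image h w T v : spherical gen T ->
  closure (cell_fun h @` open_cell w T) (vertex (vmap h v)) <->
  parabolic gen T (w^-1 * v).
Proof.
move=> sT; rewrite -(vertex_closure w v sT) -vmapE; split=> cl; last first.
  exact/closure_image/cl/cell_fun_continuous.
have := closure_image (cell_fun_continuous (h := inv_aut h)) cl.
rewrite image_comp inv_autK (_ : _ \o _ = id) ?image_id //.
by apply/funext => p; exact: inv_autK.
Qed.

(** The vertices of a cell are those in its closure, a notion preserved by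
    homeomorphisms. *)
Lemma vmap_coset h w T : spherical gen T -> exists T', spherical gen T' /\
  forall v, parabolic gen T (w^-1 * v) <-> parabolic gen T' ((vmap h w)^-1 * vmap h v).
Proof.
move=> sT; have [|v0 [T' [sT' E]]] := (cell_aut_open h (open_cell w T)).1; first by exists w, T.
have H v : parabolic gen T (w^-1 * v) <-> parabolic gen T' (v0^-1 * vmap h v).
  by rewrite -(vertex_closure_image h w v sT) E vertex_closure.
exists T'; split=> // v; rewrite H.
have Hw : parabolic gen T' (v0^-1 * vmap h w).
  by apply/H; rewrite mulVg; exact: parabolic1.
split=> Hv.
  by have := parabolicM (parabolicV Hw) Hv; rewrite invMg invgK !mulgA mulgK.
by have := parabolicM Hw Hv; rewrite !mulgA mulgK.
Qed.

Lemma open_cell_translate w u T : parabolic gen T u ->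
  @open_cell R W S gen (w * u) T = open_cell w T.
Proof.
have sub v u' : parabolic gen T u' -> @open_cell R W S gen (v * u') T `<=` open_cell v T.
  move=> Tu p [u0 [x [Tu0 Tx xT ->]]]; exists (u' * u0), x.
  by rewrite mulgA; split=> //; exact: parabolicM.
move=> Tu; apply/seteqP; split; first exact: sub.
by rewrite -{1}(mulgK u w); apply: sub; exact: parabolicV.
Qed.

(** An open cell is determined by the vertices in its closure. *)
Lemma eq_vertices_cells h k : (forall w, cell_fun h (vertex w) = cell_fun k (vertex w)) ->
  forall C, is_open_cell C -> cell_fun h @` C = cell_fun k @` C.
Proof.
move=> hk C [w [T [sT ->]]].
have E : vmap h =1 vmap k.
  by move=> v; apply: (@vertex_inj R W S gen); rewrite -!vmapE hk.
have [|v1 [T1 [sT1 E1]]] := (cell_aut_open h (open_cell w T)).1; first by exists w, T.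
have [|v2 [T2 [sT2 E2]]] := (cell_aut_open k (open_cell w T)).1; first by exists w, T.
rewrite E1 E2.
have vP v : parabolic gen T1 (v1^-1 * v) <-> parabolic gen T2 (v2^-1 * v).
  have [g' _ gK] : exists2 g', cancel (vmap h) g' & cancel g' (vmap h).
    exists (vmap (inv_aut h)); apply: vmapK; [exact: inv_autK|exact: inv_autKV].
  rewrite -(gK v) -(vertex_closure _ _ sT1) -E1 vertex_closure_image //.
  by rewrite -(vertex_closure _ _ sT2) -E2 E vertex_closure_image.
have T21 : parabolic gen T2 (v2^-1 * v1).
  by apply/vP; rewrite mulVg; exact: parabolic1.
have T12 : T1 = T2.
  apply: (parabolic_inj R coxWS); apply/seteqP; split=> u Tu.
    have : parabolic gen T2 (v2^-1 * (v1 * u)) by apply/vP; rewrite mulKg.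
    by move=> /(parabolicM (parabolicV T21)); rewrite invMg invgK !mulgA mulgK mulVg mul1g.
  have : parabolic gen T1 (v1^-1 * (v1 * u)).
    by apply/vP; rewrite mulgA; exact: parabolicM.
  by rewrite mulKg.
by rewrite T12 -(mulVKg v2 v1) open_cell_translate.
Qed.

Lemma pi_verticesP h k : \pi_(AutP R gen) h = \pi_(AutP R gen) k <->
  forall w, cell_fun h (vertex w) = cell_fun k (vertex w).
Proof.
rewrite -pi_AutP; split; last exact: eq_vertices_cells.
move=> hk w; have := hk _ (open_cell_vertex w).
rewrite !image_set1 => E.
have : [set cell_fun h (vertex w)] (cell_fun h (vertex w)) by [].
by rewrite E.
Qed.

(** ** Local data of a cellular automorphism *)

(** The cosets w W_T with T spherical are the vertex sets of the cells. *)
Definition coset_map (al : W -> W) : Prop := forall w T, spherical gen T ->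
  exists T', spherical gen T' /\
  forall v, parabolic gen T (w^-1 * v) <-> parabolic gen T' ((al w)^-1 * al v).

Section CosetMaps.
Variables (al be : W -> W).
Hypotheses (alK : cancel al be) (beK : cancel be al).
Hypotheses (alP : coset_map al) (beP : coset_map be).

Definition edge (f : W -> W) w s t : Prop := f (w * gen s) = f w * gen t.

Lemma gen_neq1 s : gen s <> 1.
Proof.
move=> s1; have := parabolic_gen_in R coxWS (T := finset.set0) (s := s).
by rewrite s1 inE => H; suff: false by []; apply: H; exact: parabolic1.
Qed.

Lemma spherical1 s : spherical gen [set s]%SET.
Proof. by rewrite -(finset.setUid [set s]%SET); apply: spherical_pair (cox_m1 coxWS s). Qed.

Lemma edge_ex w s : exists t, edge al w s t.
Proof.
have [T [sT TP]] := alP w (spherical1 s).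
have [t tT] : exists t, t \in T.
  have : T != finset.set0.
    apply/eqP => T0; have := TP (w * gen s); rewrite T0 mulKg.
    move=> [/(_ (parabolic_gen (set11 s)))/parabolic0 E _].
    apply: (@gen_neq1 s); apply: (mulgI w); rewrite mulg1.
    by apply: (can_inj alK); rewrite -[LHS](mulVKg (al w)) E mulg1.
  by case/set0Pn => t; exists t.
exists t; have := TP (be (al w * gen t)); rewrite beK mulKg.
move=> [_ /(_ (parabolic_gen tT))/parabolic1s E].
have {E} E : be (al w * gen t) = w * gen s.
  case: E => E; last by rewrite -[LHS](mulVKg w) E.
  exfalso; apply: (@gen_neq1 t); apply: (mulgI (al w)); rewrite mulg1.
  by apply: (can_inj beK); rewrite alK -[LHS](mulVKg w) E mulg1.
by rewrite /edge -E beK.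
Qed.

Lemma edge_inj w s t u : edge al w s u -> edge al w t u -> s = t.
Proof.
by rewrite /edge => <- /(can_inj alK)/mulgI/(gen_inj R coxWS).
Qed.

Lemma edge_uniq w s t u : edge al w s t -> edge al w s u -> t = u.
Proof. by rewrite /edge => -> /mulgI/(gen_inj R coxWS). Qed.

Lemma edge_inv w s t : edge al w s t -> edge be (al w) t s.
Proof. by rewrite /edge => <-; rewrite !alK. Qed.

(** The two edges generate the vertex set of a cell of dimension at most two, whose
    image is again one. *)
Lemma edge_pair w s t s' t' (k : nat) : edge al w s s' -> edge al w t t' ->
  m s t = Some k -> spherical gen [set s'; t']%SET /\
  forall v, parabolic gen [set s; t] (w^-1 * v) ->
    parabolic gen [set s'; t'] ((al w)^-1 * al v).
Proof.
move=> es et mst; have [T' [sT' T'P]] := alP w (spherical_pair coxWS mst).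
have inT' a a' : edge al w a a' -> a \in [set s; t]%SET -> a' \in T'.
  move=> ea aT; apply: (parabolic_gen_in R coxWS).
  have := (T'P (w * gen a)).1; rewrite ea !mulKg; apply; exact: parabolic_gen.
have s'T : s' \in T' by apply: inT' es _; rewrite !inE eqxx.
have t'T : t' \in T' by apply: inT' et _; rewrite !inE eqxx orbT.
have sst' : spherical gen [set s'; t']%SET.
  apply: (sphericalS coxWS _ sT'); apply/fintype.subsetP => a.
  by rewrite !inE => /orP[] /eqP ->.
split=> // v Tv; have [T'' [sT'' T''P]] := beP (al w) sst'.
have inT'' a a' : edge al w a a' -> a' \in [set s'; t']%SET -> a \in T''.
  move=> /edge_inv ea aT; apply: (parabolic_gen_in R coxWS).
  have := (T''P (al w * gen a')).1; rewrite ea alK !mulKg; apply; exact: parabolic_gen.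
apply/T''P; rewrite !alK; apply: (parabolicS coxWS _ Tv).
apply/fintype.subsetP => a; rewrite !inE => /orP[] /eqP ->.
  by apply: inT'' es _; rewrite !inE eqxx.
by apply: inT'' et _; rewrite !inE eqxx orbT.
Qed.

(** The polygon of s and t is mapped to the polygon of s' and t', so opposite
    labels are preserved along it. *)
Lemma edge_move w s t s' t' : edge al w s s' -> edge al w t t' ->
  m s t <> None -> edge al (w * gen s) t t'.
Proof.
move=> es et; case mst : (m s t) => [k|//] _.
have es' : edge al (w * gen s) s s' by rewrite /edge es !mulg_genK.
have [u eu] := edge_ex (w * gen s) t.
have [st|st] := eqVneq s t; first by subst t; rewrite (edge_uniq et es).
have [_ /(_ (w * gen s * gen t))] := edge_pair es et mst.
rewrite -mulgA mulKg mulgA eu es -mulgA mulKg => /(_ _)/wrap[].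
  by apply: parabolicM; apply: parabolic_gen; rewrite !inE eqxx ?orbT.
move=> stu; have us : u \in [set s'; t']%SET.
  apply: (parabolic_gen_in R coxWS); rewrite -(genK s' (gen u)).
  by apply: parabolicM stu; apply: parabolic_gen; rewrite !inE eqxx.
have -> : t' = u; last by [].
move: us; rewrite !inE => /orP[/eqP us|/eqP//].
by rewrite us in eu; case/eqP: st; exact: edge_inj es' eu.
Qed.

Lemma edge_power w s t s' t' n : edge al w s s' -> edge al w t t' ->
  m s t <> None ->
  al (w * (gen s * gen t) ^+ n) = al w * (gen s' * gen t') ^+ n.
Proof.
move=> es et mst; elim: n w es et => [|n IH] w es et; first by rewrite !mulg1.
have ets : edge al (w * gen s) t t' by exact: edge_move es et mst.
have ess : edge al (w * gen s) s s' by rewrite /edge es !mulg_genK.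
have mts : m t s <> None by rewrite (cox_mC coxWS).
have es2 : edge al (w * gen s * gen t) s s' by exact: edge_move ets ess mts.
have et2 : edge al (w * gen s * gen t) t t' by rewrite /edge ets !mulg_genK.
by rewrite (expgS (gen s * gen t)) (expgS (gen s' * gen t')) !mulgA IH // ets es.
Qed.

(** Closing up around the polygon of s and t closes up around its image. *)
Lemma edge_order w s t s' t' (k : nat) : edge al w s s' -> edge al w t t' ->
  m s t = Some k -> exists2 k', m s' t' = Some k' & (k' %| k)%N.
Proof.
move=> es et mst.
have [st|st] := eqVneq s t.
  subst t; rewrite (edge_uniq et es); exists 1%N; rewrite ?dvd1n //.
  exact: cox_m1 coxWS s'.
have st' : s' != t'.
  apply/eqP => E; move/edge_inv: es => es; move/edge_inv: et => et.
  move: st; apply/negP/negPn/eqP; apply: (gen_inj R coxWS); apply: (mulgI w).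
  by rewrite -[X in X * _](alK w) -es E et alK.
have E : (gen s' * gen t') ^+ k = 1.
  have mst' : m s t <> None by rewrite mst.
  apply: (mulgI (al w)); rewrite -(edge_power _ es et mst').
  by rewrite (gen_rel coxWS mst) !mulg1.
have := gen_order R coxWS st' E; case: (m s' t') => [k' kk'|/eqP k0]; first by exists k'.
by have := cox_m2 coxWS st mst; rewrite k0.
Qed.

End CosetMaps.

(** The orders m(s,t) are divisible both ways, by applying the previous results
    to the map and to its inverse. *)
Theorem coset_map_local (al be : W -> W) : cancel al be -> cancel be al ->
  coset_map al -> coset_map be -> exists F, local_data m gen al F.
Proof.
move=> alK beK alP beP.
pose e w s := projT1 (cid (edge_ex alK beK alP w s)).
have eP w s : edge al w s (e w s) by exact: projT2 (cid (edge_ex alK beK alP w s)).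
have e_inj w : injective (e w).
  move=> s t est; have := eP w s; rewrite est => es.
  exact: (edge_inj alK es (eP w t)).
exists (fun w => perm (@e_inj w)); split=> [w s t|w t|w t t' mt].
- rewrite !permE; have es := eP w s; have et := eP w t.
  have esV := edge_inv alK es; have etV := edge_inv alK et.
  case E : (m s t) => [k|].
    have [k' E' kk'] := edge_order alK beK alP beP es et E.
    have [k'' E'' kk''] := edge_order beK alK beP alP esV etV E'.
    rewrite E'; congr Some; apply/eqP; rewrite eqn_dvd kk'.
    by move: E''; rewrite E => -[->].
  case E' : (m (e w s) (e w t)) => [k'|//].
  have [k'' E'' _] := edge_order beK alK beP alP esV etV E'.
  by rewrite E in E''.
- by rewrite permE; exact: eP.
- rewrite !permE; apply/esym; apply: (@edge_uniq al (w * gen t) t' _ _ _ (eP _ _)).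
  exact: (edge_move alK beK alP beP (eP w t) (eP w t') mt).
Qed.

Theorem cell_aut_local h : exists F, local_data m gen (vmap h) F.
Proof.
have hK := vmapK (inv_autK h); have hVK := vmapK (inv_autKV h).
by apply: coset_map_local hK hVK _ _ => w T; exact: vmap_coset.
Qed.

(** ** The rigid case *)

Section Rigid.
Hypothesis rigid : is_rigid m.

(** In a rigid system the local permutations at the ends of an edge agree on
    its facet, hence everywhere. *)
Lemma rigid_local_const al F : local_data m gen al F -> forall w, F w = F 1.
Proof.
move=> [dF alS Fm]; have step w s : F (w * gen s) = F w.
  apply: (mulIg (F w)^-1); rewrite mulgV; apply: (rigid (s := s)).
    by apply: diagram_autM => //; exact: diagram_autV.
  by split=> [|t mst]; rewrite permM Fm ?permK // (cox_m1 coxWS).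
move=> w; rewrite -(mul1g w); move: (1 : W) => v; move: w v.
apply: (@cox_ind _ _ _ _ coxWS) => [v|s w IH v]; first by rewrite mulg1.
by rewrite mulgA IH step.
Qed.

Lemma rigid_vmap al F : local_data m gen al F ->
  forall w, al w = al 1 * induced_aut gen (F 1) w.
Proof.
move=> ld; have [dF alS _] := ld; have Fc := rigid_local_const ld.
move=> w; rewrite -{1}(mul1g w); move: (1 : W) => v.
suff H u : al (u * w) = al u * induced_aut gen (F v) w by exact: H.
rewrite Fc; move: w u.
apply: (@cox_ind _ _ _ _ coxWS) => [u|s w IH u].
  by rewrite (ind1 coxWS (dF 1)) !mulg1.
by rewrite mulgA IH alS Fc (indM coxWS (dF 1)) (ind_gen coxWS (dF 1)) mulgA.
Qed.

(** Near h the automorphisms agree with h at the apex and its neighbours. *)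
Lemma vertex_agree_nbhs h w :
  nbhs h [set k | cell_fun k (vertex w) = cell_fun h (vertex w)].
Proof.
pose O := [set p | (0 < vertex_coord (vmap h w) p)%R] : set davis.
have oO : open O.
  rewrite openE => p Op.
  apply: (@vertex_coord_continuous R W S gen (vmap h w) p [set c : R | (0 < c)%R]).
  by apply: open_nbhs_nbhs; split; first exact: open_gt.
have cK : compact [set vertex w] by exact: compact_set1.
have : nbhs h [set k : cell_aut R gen | cell_fun k @` [set vertex w] `<=` O].
  apply: open_nbhs_nbhs; split.
    exists [set g : {compact-open, davis -> davis} | g @` [set vertex w] `<=` O] => //.
    exact: compact_open_open.
  by rewrite /= image_set1 => _ ->; rewrite /O /= vmapE vertex_coord_vertex eqxx ltr01.
apply: filterS => k; rewrite /= image_set1 => /(_ _ erefl).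
rewrite /O /= !vmapE vertex_coord_vertex; case: eqP => [->//|_].
by rewrite ltxx.
Qed.

(** The local permutation, being constant, is read off the images of x0 and of
    its neighbours, and these are locally constant. *)
Lemma rigid_discrete : Aut_discrete R gen.
Proof.
move=> U; rewrite /open /= /quotient_open openE => h Uh.
have : nbhs h [set k | forall w, (w = 1 \/ exists s, w = gen s) ->
    cell_fun k (vertex w) = cell_fun h (vertex w)].
  have H s : nbhs h [set k | cell_fun k (vertex (gen s)) = cell_fun h (vertex (gen s))].
    exact: vertex_agree_nbhs.
  have /(_ (nbhs_filter h)) := filterI (vertex_agree_nbhs h 1) (filter_forall (nbhs_filter h) H).
  by apply: filterS => k [k1 ks] w [->//|[s ->]]; exact: ks.
apply: filterS => k kh; rewrite /preimage /=; have -> : \pi_(AutP R gen) k = \pi_(AutP R gen) h; last exact: Uh.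
apply/pi_verticesP => w; rewrite !vmapE; congr vertex.
have vkh v : (v = 1 \/ exists s, v = gen s) -> vmap k v = vmap h v.
  by move=> /kh; rewrite !vmapE => /vertex_inj.
have [F ldF] := cell_aut_local h; have [G ldG] := cell_aut_local k.
rewrite (rigid_vmap ldF) (rigid_vmap ldG) vkh; last by left.
have -> : F 1 = G 1; last by [].
apply/permP => s; apply: (gen_inj R coxWS); apply: (mulgI (vmap h 1)).
case: (ldF) (ldG) => _ <- _ [_ lG _].
by rewrite -[in RHS]vkh; [rewrite -lG vkh // mul1g; right; exists s|left].
Qed.

Definition trans_aut (v : W) : cell_aut R gen :=
  local_aut R coxWS (wact_data m gen v) (mulKg v) (mulVKg v).

Lemma trans_autE v : cell_fun (trans_aut v) = wact v.
Proof. by rewrite (wact_local R coxWS). Qed.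

Definition diag_aut f (df : is_diagram_aut m f) : cell_aut R gen :=
  local_aut R coxWS (hat_data coxWS df) (ind_cancel coxWS df).1 (ind_cancel coxWS df).2.

Lemma diag_autE f (df : is_diagram_aut m f) : cell_fun (diag_aut df) = hat f.
Proof. by []. Qed.

Lemma wact_vertex v w : wact v (vertex w) = vertex (v * w).
Proof. exact: wactE. Qed.

Lemma cone_map_apex f : is_diagram_aut m f -> cone_map f (apex R gen) = apex R gen.
Proof.
move=> df; apply: bcoord_inj => T; rewrite (bcoord_cone_map coxWS) // !bcoord_apex.
congr (_%:R)%R; congr nat_of_bool; apply/eqP/eqP => [E|->].
  by rewrite -(imset_preim f T) E imset0.
by apply/setP => s; rewrite !inE.
Qed.

Lemma hat_vertex f w : is_diagram_aut m f ->
  hat f (vertex w) = vertex (induced_aut gen f w).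
Proof.
move=> df; rewrite hat_local /vertex (local_mapE coxWS (hat_data coxWS df)).
by rewrite cone_map_apex.
Qed.

(** An automorphism is the translation by the image of x0 followed on the right by
    the constant value of its local permutation. *)
Lemma rigid_semidirect : Aut_is_semidirect R gen m.
Proof.
pose iW (w : W) : AutP R gen := \pi_(AutP R gen) (trans_aut w).
pose iG f : AutP R gen := if pselect (is_diagram_aut m f) is left df
  then \pi_(AutP R gen) (diag_aut df) else 1.
have iGE f (df : is_diagram_aut m f) : iG f = \pi_(AutP R gen) (diag_aut df).
  rewrite /iG; case: pselect => // df'; congr (\pi_(AutP R gen) _).
  exact: eq_cell_aut.
have mulE h k : (\pi_(AutP R gen) h * \pi_(AutP R gen) k)%g = \pi_(AutP R gen) (comp_aut h k).
  exact: Aut_mulE.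
have iWM v w : iW (v * w) = iW v * iW w.
  rewrite /iW mulE; apply/pi_verticesP => u.
  by rewrite comp_autE /= !trans_autE !wact_vertex mulgA.
have iGM f g : is_diagram_aut m f -> is_diagram_aut m g -> iG (g * f) = iG f * iG g.
  move=> df dg; have dfg := diagram_autM df dg.
  rewrite !iGE mulE; apply/pi_verticesP => u.
  by rewrite comp_autE /= !diag_autE !hat_vertex // (ind_comp coxWS).
have conj f w : is_diagram_aut m f -> iG f * iW w * (iG f)^-1 = iW (induced_aut gen f w).
  move=> df; apply: (mulIg (iG f)); rewrite mulgVK iGE /iW !mulE.
  apply/pi_verticesP => u; rewrite !comp_autE /= !diag_autE !trans_autE.
  by rewrite !hat_vertex // !wact_vertex !hat_vertex // (indM coxWS).
have iW1 : iW 1 = 1 by apply: (mulgI (iW 1)); rewrite -iWM !mulg1.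
have iWV w : iW w^-1 = (iW w)^-1.
  by apply: (mulgI (iW w)); rewrite -iWM !mulgV.
have d1 : is_diagram_aut m 1 by exact: diagram_aut1.
have iG1 : iG 1 = 1 by apply: (mulgI (iG 1)); rewrite -iGM // !mulg1.
have iGV f : is_diagram_aut m f -> iG f^-1 = (iG f)^-1.
  move=> df; have dfV := diagram_autV df.
  by apply: (mulgI (iG f)); rewrite -iGM // mulVg mulgV.
have dec a : exists w f, is_diagram_aut m f /\ a = iW w * iG f.
  elim/quotW: a => h; have [F ld] := cell_aut_local h.
  have dF : is_diagram_aut m (F 1) by case: ld.
  exists (vmap h 1), (F 1); split=> //; rewrite iGE /iW mulE.
  apply/pi_verticesP => u; rewrite comp_autE /= trans_autE diag_autE.
  by rewrite hat_vertex // wact_vertex vmapE (rigid_vmap ld).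
exists iW, iG; split.
- split=> [w|f df]; first by exists (trans_aut w); rewrite ?trans_autE.
  by exists (diag_aut df); rewrite ?iGE ?diag_autE.
- split=> [v w /pi_verticesP/(_ 1)|f g df dg].
    by rewrite !trans_autE !wact_vertex !mulg1 => /vertex_inj.
  rewrite !iGE => /pi_verticesP E; apply/permP => s.
  have := E (gen s); rewrite !diag_autE !hat_vertex // => /vertex_inj.
  by rewrite !(ind_gen coxWS) // => /(gen_inj R coxWS).
- by split.
- exact: conj.
- split.
  + split; first by exists 1.
      by move=> _ _ [v _ <-] [w _ <-]; exists (v * w).
    by move=> _ [v _ <-]; exists v^-1.
  + split; first by exists 1.
      by move=> _ _ [f df <-] [g dg <-]; exists (g * f); [exact: diagram_autM|exact: iGM].
    by move=> _ [f df <-]; exists f^-1; [exact: diagram_autV|exact: iGV].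
  + move=> a _ [v _ <-]; have [w [f [df ->]]] := dec a.
    exists (w * induced_aut gen f v * w^-1) => //.
    by rewrite !iWM iWV -conj // invMg !mulgA.
  + apply/seteqP; split=> [a [[w _ <-] [f df E]]|a ->]; last first.
      by split; [exists 1|exists 1].
    suff -> : w = 1 by [].
    move: E; rewrite iGE => /pi_verticesP/(_ 1).
    rewrite diag_autE trans_autE hat_vertex // wact_vertex (ind1 coxWS df) mulg1.
    by move/vertex_inj.
  + move=> a; have [w [f [df ->]]] := dec a; exists (iW w), (iG f).
      by split.
Qed.

End Rigid.

End VertexMaps.

(** * Walls and half-spaces *)

Section Walls.
Variables (R : realType) (W : groupType) (S : finType).
Variables (m : S -> S -> option nat) (gen : S -> W).
Hypothesis coxWS : is_coxeter_system m gen.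
Local Notation V := {ffun S -> R}.
Local Notation B := (@form R S m).
Local Notation alpha := (@alpha R S).
Local Notation act := (@act R W S m gen coxWS).
Local Notation len := (len coxWS).
Local Notation xi := (@xi R S m).
Local Notation cone := (cone R gen).
Local Notation davis := (davis R gen).
Local Notation vertex := (@vertex R W S gen).
Implicit Types (w v : W) (s t : S) (T U J : {set S}) (x y : cone) (p q : davis).
Local Open Scope group_scope.

Let mxC : is_coxeter_matrix m. Proof. by case: coxWS. Qed.
Let genV s : (gen s)^-1 = gen s := genV coxWS s.
Let gengen s : gen s * gen s = 1 := gengen coxWS s.
Let genK s w : gen s * (gen s * w) = w := genK coxWS s w.
Let mulg_genK s w : w * gen s * gen s = w := mulg_genK coxWS s w.

(** The pairing of a vector with the image of a point under the equivariant map
    from the Davis complex to the dual of the Tits representation that is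
    affine on the simplices and sends each vertex w x0 to half the image of
    the sum of coordinates under w. *)
Definition dev_chamber (r : V) w x : R := (\sum_U bcoord x U * xi U (act w^-1 r))%R.
Definition dev (r : V) : davis -> R := lift (dev_chamber r).

Lemma dev_compatible r : compatible (dev_chamber r).
Proof.
move=> w t x tx; apply: eq_bigr => U _.
have [->|xU] := eqVneq (bcoord x U) 0%R; first by rewrite !mul0r.
congr (_ * _)%R; rewrite invMg genV actM (xi_invariant coxWS) //.
  exact: bcoord_spherical xU.
exact: (parabolic_gen (tx _ xU)).
Qed.

Lemma devE r w x : dev r (pt w x) = (\sum_U bcoord x U * xi U (act w^-1 r))%R.
Proof. exact: (liftE _ _ (@dev_compatible r)). Qed.

Lemma devN r p : dev (- r)%R p = (- dev r p)%R.
Proof.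
have [w [x ->]] := davis_surj p; rewrite !devE -sumrN; apply: eq_bigr => U _.
by rewrite actN xiN mulrN.
Qed.

Lemma dev_wact v r p : dev r (wact v p) = dev (act v^-1 r) p.
Proof.
have [w [x ->]] := davis_surj p; rewrite wactE !devE.
by apply: eq_bigr => U _; rewrite invMg actM.
Qed.

Lemma dev_continuous r : continuous (dev r).
Proof.
apply: lift_continuous; first exact: dev_compatible.
move=> w; apply: continuous_big => [|U _ x]; first exact: add_continuous.
exact: (cvgM (@bcoord_continuous R W S gen U x) (cvg_cst _)).
Qed.

Lemma xi0 r : xi finset.set0 r = (height r / 2)%R.
Proof.
rewrite [LHS](_ : _ = height r / 2 - B (cell_vertex R m finset.set0) r)%R //.
have [c0 _] := cell_vertexP R coxWS (@spherical0 W S gen).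
have -> : cell_vertex R m finset.set0 = 0%R.
  by apply/ffunP => t; rewrite c0 ?ffunE ?inE.
by rewrite form0l subr0.
Qed.

Lemma dev_vertex r w : dev r (vertex w) = (height (act w^-1 r) / 2)%R.
Proof.
rewrite devE (bigD1 finset.set0) //= bcoord_apex eqxx mul1r big1 ?addr0 ?xi0 //.
by move=> U /negbTE U0; rewrite bcoord_apex U0 mul0r.
Qed.

Lemma dev_slide r w (c : R) x : (0 <= c <= 1)%R ->
  dev r (pt w (slide c x)) = (c * dev r (pt w x) + (1 - c) * dev r (vertex w))%R.
Proof.
move=> c01; rewrite !devE !big_distrr -big_split; apply: eq_bigr => U _ /=.
by rewrite bcoord_slide // bcoord_apex; glra.
Qed.

Lemma xi_root_ge0 U w s : spherical gen U -> pos (act w (alpha s)) ->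
  (0 <= xi U (act w (alpha s)))%R.
Proof.
move=> sU p; have [Ur|nUr] := pselect (supp_in U (act w (alpha s))).
  by rewrite (xi_supp coxWS).
by apply: le_trans (xi_ge sU p nUr); rewrite divr_ge0 ?ler0n.
Qed.

Lemma dev_root_ge0 w s x : pos (act w^-1 (alpha s)) ->
  (0 <= dev (alpha s) (pt w x))%R.
Proof.
move=> p; rewrite devE; apply: sumr_ge0 => U _.
have [->|xU] := eqVneq (bcoord x U) 0%R; first by rewrite mul0r.
rewrite mulr_ge0 ?bcoord_ge0 //; apply: xi_root_ge0 => //.
exact: bcoord_spherical xU.
Qed.

Lemma dev_root_le0 w s x : pos (- act w^-1 (alpha s))%R ->
  (dev (alpha s) (pt w x) <= 0)%R.
Proof.
move=> n; have E : act (gen s * w)^-1 (alpha s) = (- act w^-1 (alpha s))%R.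
  by rewrite invMg actM genV act_gen reflection_alpha1 // actN.
have := @dev_root_ge0 (gen s * w) s x; rewrite E => /(_ n).
by rewrite -wactE dev_wact genV act_gen reflection_alpha1 // devN oppr_ge0.
Qed.

Lemma dev_root_gt0 w s x : (0 < dev (alpha s) (pt w x))%R -> pos (act w^-1 (alpha s)).
Proof.
move=> h; case: (root_pos_neg R coxWS w^-1 s) => // /dev_root_le0 => /(_ x).
by rewrite leNgt h.
Qed.

Lemma dev_root_eq0 w s x : dev (alpha s) (pt w x) = 0%R ->
  forall U, bcoord x U != 0%R -> supp_in U (act w^-1 (alpha s)).
Proof.
wlog p : w / pos (act w^-1 (alpha s)).
  move=> H; case: (root_pos_neg R coxWS w^-1 s) => [|n d0]; first exact: H.
  have E : act (gen s * w)^-1 (alpha s) = (- act w^-1 (alpha s))%R.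
    by rewrite invMg actM genV act_gen reflection_alpha1 // actN.
  move=> U xU t tU; have := H (gen s * w); rewrite E => /(_ n) H1.
  have d1 : dev (alpha s) (pt (gen s * w) x) = 0%R.
    by rewrite -wactE dev_wact genV act_gen reflection_alpha1 // devN d0 oppr0.
  by have := H1 d1 U xU t tU; rewrite ffunE => /eqP; rewrite oppr_eq0 => /eqP.
rewrite devE => d0 U xU; apply: contrapT => nU.
have sU := bcoord_spherical xU.
have ge0 X : (0 <= bcoord x X * xi X (act w^-1 (alpha s)))%R.
  have [->|xX] := eqVneq (bcoord x X) 0%R; first by rewrite mul0r.
  by rewrite mulr_ge0 ?bcoord_ge0 // xi_root_ge0 //; exact: bcoord_spherical xX.
have H := psumr_eq0P (fun X _ => ge0 X) d0; have /eqP := H U isT.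
rewrite mulf_eq0 (negbTE xU) /= => /eqP x0.
by have := xi_ge sU p nU; rewrite x0 lt_geF // divr_gt0.
Qed.

(** At a zero of dev (alpha s) in the chamber of w, the root w^-1 alpha s lies in
    the span of the smallest face of the point, hence its reflection belongs to
    the stabilizer of this point. *)
Lemma wall_dev s : wall_of R gen s = [set p | dev (alpha s) p = 0%R].
Proof.
apply/seteqP; split => p /=.
  move=> sp; have : dev (alpha s) p = (- dev (alpha s) p)%R.
    by rewrite -{1}sp dev_wact genV act_gen reflection_alpha1 // devN.
  by glra.
have [w [x ->]] := davis_surj p => d0.
have [T xT Tmin] := bottom_ex x; rewrite /wall_of /= wactE.
have [Tw _] := root_parabolic (dev_root_eq0 d0 xT).
have -> : gen s * w = w * (w^-1 * gen s * w^-1^-1) by rewrite invgK -mulgA mulVKg.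
exact: (pt_parabolic coxWS w Tw Tmin).
Qed.

Definition half_space (r : V) : set davis := [set p | (0 < dev r p)%R].

Lemma unit_interval_connected (f : R -> davis) : continuous f ->
  connected (f @` [set c | (0 <= c <= 1)%R]).
Proof.
move=> fc; have -> : [set c : R | (0 <= c <= 1)%R] = `[0%R, 1%R]%classic.
  by apply/seteqP; split=> c /=; rewrite in_itv.
apply: connected_continuous_connected; first exact: segment_connected.
exact: continuous_subspaceT.
Qed.

(** On the segment from a vertex to a point of its chamber dev is affine. *)
Lemma segment_component s w x : half_space (alpha s) (pt w x) ->
  connected_component (half_space (alpha s)) (vertex w) (pt w x).
Proof.
move=> wx; have wp : pos (act w^-1 (alpha s)).
  exact: dev_root_gt0 wx.
have wv : (0 < dev (alpha s) (vertex w))%R.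
  rewrite dev_vertex divr_gt0 //; apply: lt_le_trans (root_height wp); exact: ltr01.
pose f c : davis := pt w (slide c x).
apply: (@connected_component_max _ _ (f @` [set c | (0 <= c <= 1)%R])).
- by exists 0%R; rewrite /= ?lexx ?ler01 // /f slide0.
- move=> _ [c c01 <-]; rewrite /half_space /= dev_slide //.
  case/andP: c01; rewrite le_eqVlt => /orP[/eqP <- _|c0 c1].
    by rewrite mul0r add0r subr0 mul1r.
  by rewrite ltr_pwDl ?mulr_gt0 // mulr_ge0 ?subr_ge0 // ltW.
- by apply: unit_interval_connected; exact: slide_continuous.
- by exists 1%R; rewrite /= ?lexx ?ler01 // /f slide1.
Qed.

(** Every vertex of the half-space is joined to x0 by a minimal gallery inside
    the half-space. *)
Lemma vertex_component s w : pos (act w^-1 (alpha s)) ->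
  connected_component (half_space (alpha s)) (vertex 1) (vertex w).
Proof.
have vin v : pos (act v^-1 (alpha s)) -> half_space (alpha s) (vertex v).
  move=> vp; rewrite /half_space /= dev_vertex divr_gt0 //.
  by apply: lt_le_trans (root_height vp); exact: ltr01.
have [n] := ubnP (len w); elim: n w => // n IH w wn wp.
have [->|w1] := pselect (w = 1).
  by apply: connected_component_refl; apply: vin; rewrite invg1 act1; exact: pos_alpha.
have [t wt] := descent_ex coxWS w1.
have tp : pos (act (w * gen t)^-1 (alpha s)).
  apply/(posVP R coxWS); have := (posVP R coxWS w s).1 wp.
  have E : gen s * w = gen s * (w * gen t) * gen t by rewrite -!mulgA gengen mulg1.
  have := lenM coxWS (gen s * (w * gen t)) (gen t); rewrite -E.
  case: (len_genM coxWS s (w * gen t)) => //.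
  by have := len_gen_le coxWS t; lia.
have st := spherical1 coxWS t.
have ptE : pt (w * gen t) (center R gen [set t]%SET) = pt w (center R gen [set t]%SET).
  apply: pt_facet => U; rewrite bcoord_center //.
  by case: (U =P [set t]%SET) => [->|_]; rewrite ?eqxx // inE.
have mid : half_space (alpha s) (pt w (center R gen [set t]%SET)).
  rewrite /half_space /= lt_def dev_root_ge0 // andbT.
  apply/eqP => /dev_root_eq0/(_ [set t]%SET).
  rewrite bcoord_center // eqxx oner_neq0 => /(_ isT) ws.
  have E : act w^-1 (alpha s) = (act w^-1 (alpha s) t *: alpha t)%R.
    by rewrite {1}(supp_sum ws) big_set1.
  have : act (w * gen t)^-1 (alpha s) = (- act w^-1 (alpha s))%R.
    by rewrite invMg genV actM E actZ act_gen reflection_alpha1 // scalerN.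
  move=> F; move: tp; rewrite F => /(pos_antisym wp).
  by move=> z; exact (act_alpha_neq0 z).
apply: connected_component_trans (IH _ _ tp) _; first lia.
have c1 := segment_component mid.
have := @segment_component s (w * gen t) (center R gen [set t]%SET).
rewrite ptE => /(_ mid) c2.
by apply: connected_component_trans c2 _; exact: connected_component_sym.
Qed.

Lemma half_space_connected s : connected (half_space (alpha s)).
Proof.
have -> : half_space (alpha s) = connected_component (half_space (alpha s)) (vertex 1).
  apply/seteqP; split; last exact: connected_component_sub.
  move=> p; have [w [x ->]] := davis_surj p => wx.
  have wp : pos (act w^-1 (alpha s)).
    exact: dev_root_gt0 wx.
  exact: connected_component_trans (vertex_component wp) (segment_component wx).
exact: component_connected.
Qed.

Lemma wact_continuous v : continuous (wact v : davis -> davis).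
Proof. by rewrite (wact_local R coxWS); exact: (local_map_continuous coxWS (wact_data m gen v)). Qed.

Lemma half_space_connectedN s : connected (half_space (- alpha s)%R).
Proof.
have -> : half_space (- alpha s)%R = wact (gen s) @` half_space (alpha s).
  have E p : dev (alpha s) (wact (gen s) p) = dev (- alpha s)%R p.
    by rewrite dev_wact genV act_gen reflection_alpha1.
  have K p : wact (gen s) (wact (gen s) p) = p.
    by have [w [x ->]] := davis_surj p; rewrite !wactE genK.
  apply/seteqP; split=> [p hp|_ [p hp <-]].
    by exists (wact (gen s) p); rewrite ?K // /half_space /= E.
  by rewrite /half_space /= -E K.
apply: connected_continuous_connected; first exact: half_space_connected.
apply: continuous_subspaceT; exact: wact_continuous.
Qed.

(** The connected image under dev r of a component that meets both signs would
    contain 0. *)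
Lemma half_space_component r p : connected (half_space r) -> half_space r p ->
  connected_component [set q | dev r q != 0%R] p = half_space r.
Proof.
move=> cr rp; apply/seteqP; split; last first.
  by apply: connected_component_max => // q; rewrite /half_space /=; exact: lt0r_neq0.
move=> q pq; rewrite /half_space /= ltNge; apply/negP => q0.
set A := connected_component [set q | dev r q != 0%R] p in pq *.
have Ap : A p by apply: connected_component_refl => /=; exact: lt0r_neq0.
have cA : connected (dev r @` A).
  apply: connected_continuous_connected; first exact: component_connected.
  apply: continuous_subspaceT; exact: dev_continuous.
have /(connected_intervalP (dev r @` A)).1 iA := cA.
have [z Az /eqP] : (dev r @` A) 0%R.
  apply: (iA (dev r q) (dev r p)); [by exists q|by exists p|].
  by rewrite q0 ltW.
exact/negP/(connected_component_sub Az).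
Qed.

Lemma wall_components s A : is_component (wall_of R gen s) A ->
  A = half_space (alpha s) \/ A = half_space (- alpha s)%R.
Proof.
move=> [p]; have E r : (forall q, (dev r q == 0%R) = (dev (alpha s) q == 0%R)) ->
    ~` wall_of R gen s = [set q | dev r q != 0%R].
  move=> rE; rewrite wall_dev; apply/seteqP; split => q /=; rewrite rE.
    by move/eqP.
  by move/eqP.
move=> np ->; move: (np); rewrite {1}(E (alpha s)) //= => p0.
case: (ltgtP (dev (alpha s) p) 0%R) => [lt0|gt0|e0]; last by rewrite e0 eqxx in p0.
  right; rewrite (E (- alpha s)%R) => [|q]; last by rewrite devN oppr_eq0.
  apply: half_space_component; first exact: half_space_connectedN.
  by rewrite /half_space /= devN oppr_gt0.
left; rewrite (E (alpha s)) //.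
by apply: half_space_component => //; exact: half_space_connected.
Qed.

End Walls.

(** * The automorphism folding a facet stabilizer across a wall *)

Section Twist.
Variables (R : realType) (W : groupType) (S : finType).
Variables (m : S -> S -> option nat) (gen : S -> W).
Hypothesis coxWS : is_coxeter_system m gen.
Local Notation V := {ffun S -> R}.
Local Notation alpha := (@alpha R S).
Local Notation act := (@act R W S m gen coxWS).
Local Notation len := (len coxWS).
Local Notation cone := (cone R gen).
Local Notation davis := (davis R gen).
Local Notation left_minimal := (@left_minimal R W S m gen coxWS).
Implicit Types (w u v : W) (t : S) (T U J : {set S}) (x y : cone) (p q : davis).
Local Open Scope group_scope.

Let mxC : is_coxeter_matrix m. Proof. by case: coxWS. Qed.
Let genV s : (gen s)^-1 = gen s := genV coxWS s.
Let gengen s : gen s * gen s = 1 := gengen coxWS s.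
Let genK s w : gen s * (gen s * w) = w := genK coxWS s w.
Let mulg_genK s w : w * gen s * gen s = w := mulg_genK coxWS s w.

(** A simple reflection changes the sign of no other positive root. *)
Lemma reflect_pos_root t v a : pos (act v (alpha a)) ->
  ~ pos (act (gen t * v) (alpha a)) -> act v (alpha a) = alpha t.
Proof.
move=> p np; have E b : b != t -> act v (alpha a) b = 0%R.
  move=> bt; apply/eqP; rewrite eq_le p andbT leNgt; apply/negP => b0.
  apply: np; apply: (root_pos_coord (t := b)); rewrite actM act_gen ffunE.
  by rewrite (negbTE bt) subr0.
have F : act v (alpha a) = (act v (alpha a) t *: alpha t)%R.
  apply/ffunP => b; rewrite scaleffE ffunE.
  by case: (b =P t) => [->|/eqP/E ->]; rewrite ?mulr1 ?mulr0.
have := form_root R coxWS v a; rewrite F formZl formZr form_alpha1 // mulr1.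
have := p t; move: (act _ _ t) => c c0 c1.
have -> : c = 1%R.
  by apply/eqP; rewrite -(@eqrXn2 _ 2 _ _ _ c0 ler01) // expr1n expr2 c1.
by rewrite scale1r.
Qed.

Variables (s : S).
Local Notation J := (~: [set s])%SET.

Lemma minimal1 : left_minimal J 1.
Proof. by move=> t _; rewrite invg1 act1; exact: pos_alpha. Qed.

Let dec w := cid (coset_dec R coxWS J w).
Definition twist_head w : W := projT1 (dec w).
Definition twist_tail w : W := (twist_head w)^-1 * w.

Lemma twist_dec w : [/\ parabolic gen J (twist_head w), left_minimal J (twist_tail w)
  & w = twist_head w * twist_tail w].
Proof.
have [v [Ju vmin wE]] := projT2 (dec w); rewrite -/(twist_head w) in Ju wE.
have -> : twist_tail w = v by rewrite /twist_tail {2}wE mulKg.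
by split.
Qed.

(** On W_J the twist is the automorphism induced by f; a coset W_J v with v
    minimal is moved by the factor in W_J alone. *)
Definition twist (f : {perm S}) w : W :=
  induced_aut gen f (twist_head w) * twist_tail w.
Definition twist_local (f : {perm S}) w : {perm S} :=
  if `[< parabolic gen J w >] then f else 1.

Lemma twistE f u v : parabolic gen J u -> left_minimal J v ->
  twist f (u * v) = induced_aut gen f u * v.
Proof.
move=> Ju vmin; have [Ju' vmin' E] := twist_dec (u * v).
rewrite /twist; by have [<- <-] := coset_dec_unique Ju vmin Ju' vmin' E.
Qed.

Section TwistBy.
Variable f : {perm S}.
Hypotheses (df : is_diagram_aut m f) (ff : fixes_facet m f s).

Let fs : f s = s. Proof. by case: ff. Qed.
Let fix_t t : m s t <> None -> f t = t. Proof. by case: ff => _; exact. Qed.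

Lemma twist_J w : parabolic gen J w -> twist f w = induced_aut gen f w.
Proof. by move=> Jw; rewrite -{1}(mulg1 w) twistE ?mulg1 //; exact: minimal1. Qed.

Lemma minimal_descent v : left_minimal J v -> v <> 1 -> pos (- act v^-1 (alpha s))%R.
Proof.
move=> vmin v1; case: (root_pos_neg R coxWS v^-1 s) => // vs; exfalso; apply: v1.
suff /(congr1 (fun z => z^-1)) : v^-1 = 1 by rewrite invgK invg1.
apply: (act_pos_eq1 (R := R) (coxWS := coxWS)) => t.
have [->//|ts] := eqVneq t s; apply: vmin.
by rewrite !inE.
Qed.

(** If an edge at a non-trivial minimal element v is moved to a letter t, both
    s and t are left descents of the other end, so that m(s,t) is finite. *)
Lemma twist_edge_fixed v a t : left_minimal J v -> v <> 1 -> t \in J ->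
  act v^-1 (alpha t) = alpha a -> m s t <> None.
Proof.
move=> vmin v1 tJ E mst; have vs := minimal_descent vmin v1.
apply: (@not_both_descents R W S m gen coxWS s t mst (v * gen a)).
split; rewrite invMg genV actM; last first.
  by rewrite E act_gen reflection_alpha1 // opprK; exact: pos_alpha.
have nE : act v^-1 (alpha s) <> (- alpha a)%R.
  rewrite -E -actN => /act_inj /(congr1 (fun r : V => r s)).
  rewrite !ffunE eqxx => /eqP; rewrite eq_sym -subr_eq0 -opprD oppr_eq0.
  by rewrite gt_eqF // ltr_pwDr // ler0n.
have gs : act (gen s) (alpha s) = (- alpha s)%R by rewrite act_gen reflection_alpha1.
rewrite -actN; set r := act _ _.
have rE : r = act (gen a * (v^-1 * gen s)) (alpha s).
  by rewrite !actM gs /r !actN.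
apply: contrapT; rewrite rE => np; apply: nE.
have := @reflect_pos_root a (v^-1 * gen s) s.
have -> : act (v^-1 * gen s) (alpha s) = (- act v^-1 (alpha s))%R by rewrite actM gs actN.
move=> /(_ vs np) <-.
by rewrite opprK.
Qed.

(** Multiplying the minimal factor v by a letter t either gives a minimal
    element again or amounts to multiplying the factor in W_J by a letter t2 with
    v t = t2 v; in the second case t2 is fixed by f unless v is trivial. *)
Lemma twist_data : local_data m gen (twist f) (twist_local f).
Proof.
split=> [w|w t|w t t' mt].
- by rewrite /twist_local; case: ifP => _ //; exact: diagram_aut1.
- have [Ju vmin wE] := twist_dec w; rewrite {1 2}wE.
  move: (twist_head w) (twist_tail w) Ju vmin wE => u v Ju vmin wE.
  rewrite (twistE f Ju vmin) /twist_local.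
  have v1P : parabolic gen J w -> v = 1.
    move=> Jw; have [|//] := coset_dec_unique Ju vmin Jw minimal1 _.
    by rewrite mulg1.
  have [vt|nvt] := pselect (left_minimal J (v * gen t)).
    rewrite -mulgA (twistE f Ju vt) mulgA; case: ifP => [/asboolP/v1P v1|_]; last by rewrite perm1.
    have -> : f t = t; last by [].
    have [->//|ts] := eqVneq t s; have := vt t; rewrite v1 mul1g !inE ts => /(_ isT).
    rewrite genV act_gen reflection_alpha1 // => /(_ t); rewrite !ffunE eqxx.
    by rewrite oppr_ge0 ler10.
  (* The only root made negative by t is alpha t, so t2 conjugates to t. *)
  have [t2 tJ nt2] : exists2 t2, t2 \in J & ~ pos (act (v * gen t)^-1 (alpha t2)).
    apply: contrapT => H; apply: nvt => t2 tJ; apply: contrapT => np.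
    by apply: H; exists t2.
  have E : act v^-1 (alpha t2) = alpha t.
    apply: reflect_pos_root; first exact: vmin.
    by move: nt2; rewrite invMg genV.
  have vt : v * gen t = gen t2 * v.
    have := @conj_gen R W S m gen coxWS v t 1 t2.
    rewrite act1 -E actVK invg1 mulg1 mul1g => /(_ (or_introl erefl)) <-.
    by rewrite mulgVK.
  rewrite -mulgA vt mulgA twistE //; last exact: parabolic_Mgen.
  rewrite (indM coxWS df) (ind_gen coxWS df).
  case: ifP => [/asboolP/v1P v1|/asboolP nJ].
    by rewrite v1 !mulg1; move: vt; rewrite v1 mul1g mulg1 => /(gen_inj R coxWS) ->.
  have v1 : v <> 1 by move=> v1; apply: nJ; rewrite wE v1 mulg1.
  by rewrite perm1 (fix_t (twist_edge_fixed vmin v1 tJ E)) -!mulgA vt.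
- have [ts|ts] := eqVneq t s.
    have ft' : f t' = t' by apply: fix_t; rewrite -ts.
    by rewrite /twist_local; case: ifP => _; case: ifP => _; rewrite ?perm1 ?ft'.
  have tJ : t \in J by rewrite !inE.
  have -> // : twist_local f (w * gen t) = twist_local f w.
  rewrite /twist_local; have -> // : `[< parabolic gen J (w * gen t) >] = `[< parabolic gen J w >].
  apply/asboolP/asboolP => [Jw|Jw]; last exact: parabolic_Mgen.
  by rewrite -(mulg_genK t w); exact: parabolic_Mgen.
Qed.

(** Beyond the wall of s the twist is trivial: there the letters of the prefix
    avoiding s are left descents along with s. *)
Lemma twist_beyond w : pos (- act w^-1 (alpha s))%R ->
  twist f w = w /\ twist_local f w = 1.
Proof.
move=> ws; split; last first.
  rewrite /twist_local; case: ifP => // /asboolP/parabolicV Jw.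
  have /(_ s) := ws; rewrite ffunE (parabolic_coord coxWS _ Jw) ?inE ?eqxx //.
  by rewrite ffunE eqxx oppr_ge0 ler10.
have [Ju vmin wE] := twist_dec w.
rewrite {2}wE /twist; congr (_ * _); move: ws; rewrite {1}wE.
move: (twist_head w) (twist_tail w) Ju vmin => {wE w} u v Ju vmin.
have [n] := ubnP (len u); elim: n u Ju => // n IH u Ju un ws.
have [->|u1] := pselect (u = 1); first by rewrite (ind1 coxWS df).
have [t tJ ut] : exists2 t, t \in J & ~ pos (act u^-1 (alpha t)).
  apply: contrapT => H; apply: u1.
  suff /(congr1 (fun z => z^-1)) : u^-1 = 1 by rewrite invgK invg1.
  apply: (parabolic_pos_eq1 (R := R) (coxWS := coxWS) (parabolicV Ju)) => t tJ.
  by apply: contrapT => np; apply: H; exists t.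
have {}ut : pos (- act u^-1 (alpha t))%R by case: (root_pos_neg R coxWS u^-1 t).
have wt : pos (- act (u * v)^-1 (alpha t))%R.
  rewrite invMg actM -actN; apply: (minimal_act vmin) => // a aJ.
  by rewrite ffunE (supp_act coxWS (parabolicV Ju) (supp_alpha R tJ) aJ) oppr0.
have mst : m s t <> None.
  by move=> mst; apply: (@not_both_descents R W S m gen coxWS s t mst (u * v)).
have ts : s != t by move: tJ; rewrite !inE eq_sym.
have := (negVP R coxWS u t).1 ut => lu.
have := IH (gen t * u); rewrite (indM coxWS df) (ind_gen coxWS df) fix_t //.
move=> H; apply: (mulgI (gen t)); apply: H; last 1 first.
- rewrite -mulgA invMg genV actM act_gen reflection_alpha actD actN actZ.
  rewrite opprD; apply: posD => //; rewrite -scaleNr -scalerN; apply: posZ => //.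
  by have := gram_le0 R mxC ts; rewrite (gramC R mxC s); glra.
- exact: parabolicM (parabolic_gen tJ) Ju.
- lia.
Qed.

(** If s belongs to T, then f fixes T pointwise, and the prefix in W_J of an
    element of W_T remains in W_T. *)
Lemma twist_spherical T u : spherical gen T -> parabolic gen T u ->
  twist f u = induced_aut gen f u /\ {in T, twist_local f u =1 f}.
Proof.
move=> sT Tu; have [sT'|sT'] := boolP (s \in T); last first.
  have TJ : T \subset J.
    apply/fintype.subsetP => t tT; rewrite !inE; apply: contraTneq tT => ->.
    exact: sT'.
  have Ju := parabolicS coxWS TJ Tu; rewrite twist_J //; split=> // t _.
  by rewrite /twist_local asboolT.
have fT : {in T, f =1 id}.
  by move=> t tT; apply: fix_t; exact: (spherical_finite_m R coxWS sT).
split; last first.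
  by move=> t tT; rewrite /twist_local; case: ifP => _; rewrite ?perm1 ?fT.
have [a [b [Ta bmin uE]]] := coset_dec R coxWS (T :\ s) u.
have TsT : T :\ s \subset T by exact: finset.subD1set.
have Tb : parabolic gen T b.
  rewrite -(mulKg a b) -uE; apply: parabolicM Tu; apply: parabolicV.
  exact: (parabolicS coxWS TsT Ta).
have bJ : left_minimal J b.
  move=> t tJ; have [tT|tT] := boolP (t \in T).
    by apply: bmin; rewrite !inE tT andbT; move: tJ; rewrite !inE.
  apply: (root_pos_coord (t := t)).
  by rewrite (parabolic_coord coxWS _ (parabolicV Tb) tT) ffunE eqxx ltr01.
have aJ : parabolic gen J a.
  by apply: (parabolicS coxWS _ Ta); apply/fintype.subsetP => t; rewrite !inE => /andP[].
rewrite (ind_fix coxWS df Tu fT) {1}uE twistE // (ind_fix coxWS df Ta) -?uE //.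
by move=> t; rewrite inE => /andP[_]; exact: fT.
Qed.

End TwistBy.

Lemma fixes_facetV f : fixes_facet m f s -> fixes_facet m f^-1 s.
Proof.
move=> [fs ft]; split=> [|t mt]; apply: (@perm_inj _ f); rewrite permKV ?fs //.
by rewrite ft.
Qed.

Lemma twistK f : is_diagram_aut m f -> fixes_facet m f s ->
  cancel (twist f) (twist f^-1).
Proof.
move=> df [fs _] w; have [Ju vmin wE] := twist_dec w.
have fJ : f @: J = J.
  apply/setP => t; rewrite -{1}(permKV f t) mem_imset; last exact: perm_inj.
  by rewrite !inE -(inj_eq (@perm_inj _ f)) permKV fs.
have := ind_parabolic coxWS df Ju; rewrite fJ => Jfu.
rewrite [twist f w]/twist (twistE _ Jfu vmin) (ind_cancel coxWS df).1.
by rewrite -wE.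
Qed.

Section FoldAut.
Variable f : {perm S}.
Hypotheses (df : is_diagram_aut m f) (ff : fixes_facet m f s).

Let twistVK : cancel (twist f^-1) (twist f).
Proof.
have := twistK (diagram_autV df) (fixes_facetV ff).
by rewrite invgK.
Qed.

Definition fold_aut : cell_aut R gen :=
  local_aut R coxWS (twist_data df ff) (twistK df ff) twistVK.

Lemma fold_autE w x : cell_fun fold_aut (pt w x) =
  pt (twist f w) (cone_map (twist_local f w) x).
Proof. exact: (local_mapE coxWS (twist_data df ff)). Qed.

Lemma fold_aut_hat p : base_star p -> cell_fun fold_aut p = hat f p.
Proof.
move=> [w [T [sT /closed_cell_base[u0 Tu0 wu0] [u [x [Tu Tx ->]]]]]].
have Twu : parabolic gen T (w * u).
  have -> : w = u0^-1 by rewrite -[LHS](mulgK u0) wu0 mul1g.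
  by apply: parabolicM Tu; exact: parabolicV.
have [E1 E2] := twist_spherical df ff sT Twu.
rewrite fold_autE hat_local (local_mapE coxWS (hat_data coxWS df)) E1.
congr pt; apply: (eq_cone_map coxWS) => // [|U /Tx /fintype.subsetP UT t /UT].
  by case: (twist_data df ff).
exact: E2.
Qed.

Lemma fold_aut_beyond w x : pos (- act w^-1 (alpha s))%R ->
  cell_fun fold_aut (pt w x) = pt w x.
Proof.
by move=> /(twist_beyond df ff)[E1 E2]; rewrite fold_autE E1 E2 (cone_map1 coxWS).
Qed.

(** A point of the wall lying in a chamber on the near side also lies in the
    reflected chamber. *)
Lemma fold_aut_dev p : (dev coxWS (alpha s) p <= 0)%R -> cell_fun fold_aut p = p.
Proof.
have [w [x ->]] := davis_surj p => p0.
case: (root_pos_neg R coxWS w^-1 s) => [wp|]; last exact: fold_aut_beyond.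
have d0 : dev coxWS (alpha s) (pt w x) = 0%R.
  by apply/eqP; rewrite eq_le p0 dev_root_ge0.
have : wall_of R gen s (pt w x) by rewrite (wall_dev R coxWS).
rewrite /wall_of /= wactE => E; rewrite -E; apply: fold_aut_beyond.
by rewrite invMg actM genV act_gen reflection_alpha1 // actN opprK.
Qed.

(** The automorphism is the identity on the far side, hence preserves the other
    side by injectivity. *)
Lemma fold_aut_strict : fixes_strictly (cell_fun fold_aut) (wall_of R gen s).
Proof.
split=> [p|A].
  by rewrite (wall_dev R coxWS) /= => p0; apply: fold_aut_dev; rewrite p0.
have fixN : cell_fun fold_aut @` half_space coxWS (- alpha s)%R = half_space coxWS (- alpha s)%R.
  have F p : half_space coxWS (- alpha s)%R p -> cell_fun fold_aut p = p.
    by rewrite /half_space /= devN oppr_gt0 => /ltW; exact: fold_aut_dev.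
  apply/seteqP; split=> [_ [p hp <-]|p hp]; first by rewrite F.
  by exists p => //; exact: F.
case/(wall_components coxWS) => -> //.
have inj : injective (cell_fun fold_aut) := can_inj (inv_autK fold_aut).
apply/seteqP; split=> [_ [p hp <-]|p hp].
  rewrite /half_space /= ltNge; apply/negP => q0.
  have E := inj _ _ (fold_aut_dev q0).
  by move: hp; rewrite /half_space /= -E ltNge q0.
exists (cell_fun (inv_aut fold_aut) p); last exact: inv_autKV.
rewrite /half_space /= ltNge; apply/negP => q0.
have := fold_aut_dev q0; rewrite inv_autKV => E.
by move: hp; rewrite /half_space /= E ltNge q0.
Qed.

End FoldAut.

End Twist.

(** * Non-discreteness *)

Section NonDiscrete.
Variables (R : realType) (W : groupType) (S : finType).
Variables (m : S -> S -> option nat) (gen : S -> W).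
Hypothesis coxWS : is_coxeter_system m gen.
Local Notation V := {ffun S -> R}.
Local Notation alpha := (@alpha R S).
Local Notation act := (@act R W S m gen coxWS).
Local Notation davis := (davis R gen).
Local Notation dev := (@dev R W S m gen coxWS).
Local Notation xi := (@xi R S m).
Implicit Types (w v : W) (p q : davis).
Local Open Scope quotient_scope.
Local Open Scope group_scope.

Let genV s : (gen s)^-1 = gen s := genV coxWS s.
Let mxC : is_coxeter_matrix m. Proof. by case: coxWS. Qed.

Lemma archi_double (a c : R) : (0 < c)%R -> exists N : nat, (a < N.*2%:R * c)%R.
Proof.
move=> c0; have := archi_boundP (divr_ge0 (normr_ge0 a) (ltW c0)).
set N := Num.bound _; rewrite ltr_pdivrMr // => aN; exists N.
apply: (le_lt_trans (ler_norm a)); apply: (lt_le_trans aN).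
by rewrite (ler_wpM2r (ltW c0)) // ler_nat -addnn leq_addr.
Qed.

Lemma devD (u v : V) p : dev (u + v)%R p = (dev u p + dev v p)%R.
Proof.
have [w [x ->]] := davis_surj p; rewrite !devE -big_split; apply: eq_bigr => U _.
by rewrite actD xiD mulrDr.
Qed.

Lemma devZ c (v : V) p : dev (c *: v)%R p = (c * dev v p)%R.
Proof.
have [w [x ->]] := davis_surj p; rewrite !devE mulr_sumr; apply: eq_bigr => U _.
by rewrite actZ xiZ mulrCA.
Qed.

Section Infinite.
Variables s t : S.
Hypothesis mst : m s t = None.
Local Notation delta := (alpha s + alpha t)%R.

(** An isotropic vector is supported by no spherical subset, so that far away
    in both directions the roots alpha s + 2n delta are separated from the
    center of U by a definite amount. *)
Lemma xi_delta_gt0 U w : spherical gen U -> (0 < xi U (act w^-1 delta))%R.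
Proof.
move=> sU; set g := act w^-1 delta.
have gpos : pos g by exact: pos_delta.
have [c cU gc] : exists2 c, c \notin U & (0 < g c)%R.
  apply: contrapT => H.
  have gU : supp_in U g.
    move=> c cU; apply/eqP; rewrite eq_le gpos andbT leNgt; apply/negP => gc.
    by apply: H; exists c.
  have g0 : g <> 0%R.
    move=> g0; have := delta_neq0 (R := R) coxWS mst; apply.
    by apply: (@act_inj R W S m gen coxWS w^-1); rewrite act0.
  have := form_posdef coxWS sU gU g0.
  by rewrite act_form (form_delta R coxWS mst) ltxx.
have mts : m t s = None by rewrite (cox_mC coxWS).
have [N Ns] := archi_double `|act w^-1 (alpha s) c| gc.
have [E1 _] := act_st R coxWS mst N.
have [_ E2] := act_st R coxWS mts N.
have R1 : (1 / 2 <= xi U (act (w^-1 * (gen s * gen t) ^+ N) (alpha s)))%R.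
  have e : (0 < act (w^-1 * (gen s * gen t) ^+ N) (alpha s) c)%R.
    rewrite actM E1 actD actZ -/g ffunE [X in (_ + X)%R]ffunE.
    by move: Ns; rewrite ltr_norml => /andP[]; rewrite /GRing.scale /=; lra.
  apply: xi_ge => //; first exact: root_pos_coord e.
  by move=> /(_ c cU) z; move: e; rewrite z ltxx.
have R2 : (1 / 2 <= xi U (act (w^-1 * (gen t * gen s) ^+ N * gen s) (alpha s)))%R.
  have e : (0 < act (w^-1 * (gen t * gen s) ^+ N * gen s) (alpha s) c)%R.
    rewrite !actM act_gen reflection_alpha1 // !actN E2 [(alpha t + _)%R]addrC actB actZ -/g.
    rewrite !ffunE.
    by move: Ns; rewrite ltr_norml => /andP[]; rewrite /GRing.scale /=; lra.
  apply: xi_ge => //; first exact: root_pos_coord e.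
  by move=> /(_ c cU) z; move: e; rewrite z ltxx.
move: R1 R2; rewrite !actM act_gen reflection_alpha1 // !actN E1 E2.
rewrite [(alpha t + _)%R]addrC actD actB !actZ -/g xiN !xiD xiN !xiZ => R1 R2.
have : (0 < (N.*2%:R + N.*2%:R) * xi U g)%R by lra.
rewrite pmulr_rgt0 // -natrD ltr0n.
by case: N Ns {E1 E2 R1 R2} => //; rewrite mul0r normr_lt0.
Qed.

Lemma dev_delta_gt0 p : (0 < dev delta p)%R.
Proof.
have [w [x ->]] := davis_surj p; rewrite devE.
have [U xU] := bcoord_nonzero x.
rewrite (bigD1 U) //=; apply: ltr_pwDl.
  apply: mulr_gt0; first by rewrite lt_neqAle bcoord_ge0 eq_sym xU.
  by apply: xi_delta_gt0; exact: bcoord_spherical xU.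
apply: sumr_ge0 => T _; have [->|xT] := eqVneq (bcoord x T) 0%R; first by rewrite mul0r.
apply: mulr_ge0; first exact: bcoord_ge0.
by apply/ltW/xi_delta_gt0; exact: bcoord_spherical xT.
Qed.

(** The function of delta being positive, the open sets on which dev (alpha s) is
    less than 2n dev delta increase to the whole complex. *)
Lemma compact_escape (K : set davis) : compact K ->
  \forall n \near \oo, forall p, K p ->
    (dev (act ((gen t * gen s) ^+ n) (alpha s)) p <= 0)%R.
Proof.
move=> /compact_near_coveringP/near_covering_withinP cK.
have mts : m t s = None by rewrite (cox_mC coxWS).
have devn n p : dev (act ((gen t * gen s) ^+ n) (alpha s)) p =
    (dev (alpha s) p - n.*2%:R * dev delta p)%R.
  have [_ ->] := act_st R coxWS mts n.
  by rewrite [(alpha t + _)%R]addrC -scaleNr devD devZ mulNr.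
pose P (n : nat) p := (dev (alpha s) p <= n.*2%:R * dev delta p)%R.
have : \forall n \near \oo, K `<=` P n; last first.
  by apply: filterS => n KP p /KP; rewrite devn subr_le0.
apply: cK => x Kx.
have [N Nx] := archi_double (dev (alpha s) x) (dev_delta_gt0 x).
pose O := [set p | (dev (act ((gen t * gen s) ^+ N) (alpha s)) p < 0)%R].
have oO : nbhs x O.
  apply: (@dev_continuous R W S m gen coxWS _ x [set c : R | (c < 0)%R]).
  apply: open_nbhs_nbhs; split; first exact: open_lt.
  by rewrite /= devn subr_lt0.
exists (O, [set n | (N <= n)%N]); first by split=> //; exists N.
move=> [p n] [/= Op Nn] _; rewrite /P; move: Op; rewrite /O /= devn subr_lt0 => /ltW/le_trans; apply.
by rewrite (ler_wpM2r (ltW (dev_delta_gt0 _))) // ler_nat leq_double.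
Qed.

End Infinite.

Section Conjugates.
Variables (s : S) (f : {perm S}).
Hypotheses (df : is_diagram_aut m f) (ff : fixes_facet m f s).

Let phi := fold_aut R coxWS df ff.

Definition conj_fold (g : W) : cell_aut R gen :=
  comp_aut (trans_aut R coxWS g) (comp_aut phi (trans_aut R coxWS g^-1)).

Lemma conj_foldE g p :
  cell_fun (conj_fold g) p = wact g (cell_fun phi (wact g^-1 p)).
Proof. by rewrite !comp_autE /= !trans_autE. Qed.

Lemma conj_fold_id g p : (dev (act g (alpha s)) p <= 0)%R -> cell_fun (conj_fold g) p = p.
Proof.
move=> h; rewrite conj_foldE fold_aut_dev ?dev_wact ?invgK //.
have [w [x ->]] := davis_surj p.
by rewrite !wactE mulVKg.
Qed.

Lemma conj_fold1 : conj_fold 1 = phi.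
Proof.
apply: eq_cell_aut; apply/funext => p; rewrite conj_foldE invg1.
have wact1 q : wact 1 q = q by have [w [x ->]] := davis_surj q; rewrite wactE mul1g.
by rewrite !wact1.
Qed.

(** A letter t with m(s,t) finite is fixed by f. *)
Lemma moved_letter : f <> 1 -> exists t, f t != t /\ m s t = None.
Proof.
move=> f1; have [t ft] : exists t, f t != t.
  apply: contrapT => H; apply: f1; apply/permP => t; rewrite perm1.
  by apply: contrapT => ft; apply: H; exists t; apply/eqP.
exists t; split=> //; case E : (m s t) => [k|//].
case: ff => _ /(_ t); rewrite E => tt; move: ft; rewrite tt ?eqxx //.
Qed.

(** The neighbour (g t) x0 of g x0 is moved, for a letter t moved by f. *)
Lemma conj_fold_neq1 g : f <> 1 -> \pi_(AutP R gen) (conj_fold g) <> 1.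
Proof.
move=> /moved_letter[t [ft _]] /(pi_verticesP coxWS) /(_ (g * gen t)).
rewrite conj_foldE !wact_vertex mulKg fold_autE.
have [E _] := twist_spherical R coxWS df ff (spherical1 coxWS t)
  (parabolic_gen (finset.set11 t)).
rewrite E (ind_gen coxWS df) (cone_map_apex R coxWS); last first.
  by case: (twist_data R coxWS df ff).
rewrite [wact _ _]wact_vertex => /vertex_inj /mulgI /(gen_inj R coxWS) /eqP.
by rewrite (negbTE ft).
Qed.

(** The conjugates by the powers of ts coincide with the identity on a given
    compact set from some rank on, but are never trivial. *)
Lemma fold_not_discrete : f <> 1 -> ~ Aut_discrete R gen.
Proof.
move=> f1 disc; have [t [_ mst]] := moved_letter f1.
have := disc [set 1]; rewrite /open /= /quotient_open openE => /(_ (id_aut R gen) erefl).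
rewrite /interior nbhsE => -[Q [oQ Q1] sub].
case: oQ Q1 sub => O' oO' <- O'1 sub.
pose F n : {compact-open, davis -> davis} := cell_fun (conj_fold ((gen t * gen s) ^+ n)).
have : F @ \oo --> (id : {compact-open, davis -> davis}).
  apply/compact_open_cvgP => K U cK oU KU.
  have : \forall n \near \oo, forall p, K p ->
    (dev (act ((gen t * gen s) ^+ n) (alpha s)) p <= 0)%R by exact: compact_escape.
  apply: filterS => n Kn _ [p Kp <-]; rewrite /F conj_fold_id; last exact: Kn.
  by apply: KU; exists p.
move=> /(_ O'); case.
  exact: open_nbhs_nbhs.
move=> N _ /(_ N (leqnn N)) O'N.
exact: (@conj_fold_neq1 ((gen t * gen s) ^+ N) f1 (sub _ O'N)).
Qed.

End Conjugates.

End NonDiscrete.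

(** * The length metric *)

Section Metric.
Variables (R : realType) (W : groupType) (S : finType).
Variables (m : S -> S -> option nat) (gen : S -> W).
Hypothesis coxWS : is_coxeter_system m gen.
Local Notation V := {ffun S -> R}.
Local Notation B := (@form R S m).
Local Notation alpha := (@alpha R S).
Local Notation act := (@act R W S m gen coxWS).
Local Notation cone := (cone R gen).
Local Notation davis := (davis R gen).
Local Notation vertex := (@vertex R W S gen).
Local Notation dev := (@dev R W S m gen coxWS).
Local Notation xi := (@xi R S m).
Local Notation cell_vertex := (@cell_vertex R S m).
Local Notation chain := (@chain_length R W S gen m).
Implicit Types (w v : W) (s t : S) (T U : {set S}) (x y : cone) (p q : davis).
Local Open Scope quotient_scope.
Local Open Scope group_scope.

Let genV s : (gen s)^-1 = gen s := genV coxWS s.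
Let gengen s : gen s * gen s = 1 := gengen coxWS s.
Let genK s w : gen s * (gen s * w) = w := genK coxWS s w.
Let mulg_genK s w : w * gen s * gen s = w := mulg_genK coxWS s w.
Let mxC : is_coxeter_matrix m. Proof. by case: coxWS. Qed.

Lemma word_parabolic T (u : seq S) : all (mem T) u -> parabolic gen T (word_prod gen u).
Proof.
elim: u => [_|t u IH /= /andP[tT uT]]; first exact: parabolic1.
by apply: parabolicM (IH uT); exact: parabolic_gen.
Qed.

(** The position of a point of the fundamental chamber in the Coxeter polytope of
    T, the center of the face U being the difference of two cell vertices. *)
Definition cell_point T x : V := (\sum_U bcoord x U *: (cell_vertex T - cell_vertex U))%R.

Lemma developE T u x : spherical gen T -> below T x ->
  develop m T u x = act (word_prod gen u) (cell_point T x).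
Proof.
move=> sT Tx; rewrite act_word; congr word_reflection; apply/ffunP => t.
rewrite ffunE /cell_point sum_ffunE; apply: eq_bigr => U _; rewrite ffunE.
have [->|xU] := eqVneq (bcoord x U) 0%R; first by rewrite scale0r mul0r.
by rewrite (face_centerE R coxWS sT (Tx _ xU)).
Qed.

Lemma cell_point_supp T x : spherical gen T -> below T x -> supp_in T (cell_point T x).
Proof.
move=> sT Tx t tT; rewrite sum_ffunE big1 // => U _; rewrite ffunE.
have [->|xU] := eqVneq (bcoord x U) 0%R; first by rewrite scale0r.
have [Ts _] := cell_vertexP R coxWS sT.
have [Us _] := cell_vertexP R coxWS (bcoord_spherical xU).
by rewrite (suppB Ts (suppS (Tx _ xU) Us)) // scaler0.
Qed.

(** In a cell the functions dev are affine functions of the developed point. *)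
Lemma dev_develop T w u x (r : V) : spherical gen T -> below T x -> parabolic gen T u ->
  dev r (pt (w * u) x) = (xi T (act w^-1 r) + B (act u (cell_point T x)) (act w^-1 r))%R.
Proof.
move=> sT Tx Tu; rewrite devE; set r' := act w^-1 r.
have -> : xi T r' = xi T (act u^-1 r') by rewrite (xi_invariant coxWS) //; exact: parabolicV.
rewrite act_formV /cell_point form_suml.
rewrite -[xi T _]mul1r -(bcoord_sum x) mulr_suml -big_split; apply: eq_bigr => U _ /=.
by rewrite invMg actM -/r' formZl formBl /xi; lra.
Qed.

Definition is_root (r : V) : Prop := exists z s, r = act z (alpha s).

Lemma root_act r w : is_root r -> is_root (act w r).
Proof. by move=> [z [s ->]]; exists (w * z), s; rewrite actM. Qed.

Lemma root_neg r : is_root r -> is_root (- r)%R.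
Proof.
move=> [y [s ->]]; exists (y * gen s), s.
by rewrite actM act_gen reflection_alpha1 // actN.
Qed.

Lemma root_norm r : is_root r -> B r r = 1%R.
Proof. by move=> [y [s ->]]; exact: form_root. Qed.

(** A root that is not in the span of T is at distance at least 1/2 from 0 on
    the cells of T, on a constant side. *)
Lemma dev_far T w u x r c : is_root r -> c \notin T -> (0 < act w^-1 r c)%R ->
  spherical gen T -> below T x -> parabolic gen T u -> (1 / 2 <= dev r (pt (w * u) x))%R.
Proof.
move=> rr cT rc sT Tx Tu; rewrite devE -[leLHS]mul1r -[X in (X * _ <= _)%R](bcoord_sum x) mulr_suml.
apply: ler_sum => U _; have [->|xU] := eqVneq (bcoord x U) 0%R; first by rewrite !mul0r.
rewrite ler_wpM2l ?bcoord_ge0 // invMg actM.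
have [z [a E]] := root_act (u^-1) (root_act w^-1 rr).
have c0 : (0 < act z (alpha a) c)%R.
  by rewrite -E (parabolic_coord coxWS _ (parabolicV Tu) cT).
rewrite E; apply: xi_ge; [exact: bcoord_spherical xU|exact: root_pos_coord c0|].
move=> /(_ c) Uc; move: c0; rewrite Uc ?ltxx //.
by apply: contra cT; apply/fintype.subsetP; exact: Tx.
Qed.

(** The position of a point relative to the wall of a root, truncated to the
    region between the two adjacent vertices. *)
Definition depth (r : V) p : R := clamp (dev r p + 1 / 2).

Lemma depth1 r p : (1 / 2 <= dev r p)%R -> depth r p = 1%R.
Proof.
move=> h; rewrite /depth /clamp ger0_norm; last by lra.
by rewrite ger0_norm; lra.
Qed.

Lemma depth0 r p : (dev r p <= - (1 / 2))%R -> depth r p = 0%R.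
Proof.
move=> h; rewrite /depth /clamp ler0_norm; last by lra.
by rewrite ler0_norm; lra.
Qed.

Lemma clamp_lip (a b : R) : (clamp a - clamp b <= `|a - b|)%R.
Proof.
rewrite /clamp; have := ler_dist_dist a b; have := ler_dist_dist (b - 1) (a - 1).
have -> : (b - 1 - (a - 1) = - (a - b))%R by lra.
rewrite normrN => h1 h2; have := le_trans (ler_norm _) h1; have := le_trans (ler_norm _) h2.
by lra.
Qed.

(** A root in the span of T is a unit vector orthogonal to a wall of the cell, and
    the depth of any other root is constant on the cell. *)
Lemma depth_lip T w u v x y r : is_root r -> spherical gen T ->
  parabolic gen T u -> parabolic gen T v -> below T x -> below T y ->
  (depth r (pt (w * u) x) - depth r (pt (w * v) y) <=
   `[< supp_in T (act w^-1 r) >]%:R *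
     Num.sqrt (sqnorm m (act u (cell_point T x) - act v (cell_point T y))))%R.
Proof.
move=> rr sT Tu Tv Tx Ty; have rw := root_act w^-1 rr; case: asboolP => Tr.
  rewrite mul1r /depth; apply: le_trans (clamp_lip _ _) _.
  rewrite !(dev_develop (T := T)) // sqnormE.
  apply: le_trans (form_CS coxWS sT _ Tr (root_norm rw)).
    rewrite formBl le_eqVlt; apply/orP; left; apply/eqP; congr `|_|%R.
    by lra.
  by apply: suppB; apply: supp_act => //; exact: cell_point_supp.
rewrite mul0r.
have [c cT rc] : exists2 c, c \notin T & act w^-1 r c != 0%R.
  apply: contrapT => H; apply: Tr => c cT; apply/eqP/negPn/negP => rc.
  by apply: H; exists c.
case: (ltgtP 0%R (act w^-1 r c)) rc => // rc _.
  by rewrite !depth1 ?subrr //; exact: (dev_far rr cT rc).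
have rN : (0 < act w^-1 (- r)%R c)%R by rewrite actN ffunE oppr_gt0.
have F z a : parabolic gen T z -> below T a -> depth r (pt (w * z) a) = 0%R.
  by move=> Tz Ta; apply: depth0; rewrite lerNr -devN; exact: (dev_far (root_neg rr) cT rN).
by rewrite !F // subrr.
Qed.

(** Each cell crossed by a chain contributes its length at most once for each
    of the roots in its span. *)
Lemma chain_depth (I : finType) (r : I -> V) (K : nat) p q l :
  (forall i, is_root (r i)) ->
  (forall T w, spherical gen T -> (#|[pred i | `[< supp_in T (act w^-1 (r i)) >]]| <= K)%N) ->
  chain p q l -> (\sum_i (depth (r i) p - depth (r i) q) <= K%:R * l)%R.
Proof.
move=> rr rK; elim=> {p q l} [p|p q z a l [w [T [u [v [x [y [sT [Tu Tv] [Tx Ty] [-> ->] ->]]]]]]] _ IH].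
  by rewrite mulr0 big1 // => i _; rewrite subrr.
have -> : (\sum_i (depth (r i) (pt (w * word_prod gen u) x) - depth (r i) z) =
    \sum_i (depth (r i) (pt (w * word_prod gen u) x) - depth (r i) (pt (w * word_prod gen v) y)) +
    \sum_i (depth (r i) (pt (w * word_prod gen v) y) - depth (r i) z))%R.
  by rewrite -big_split; apply: eq_bigr => i _; rewrite /= addrA subrK.
rewrite mulrDr lerD // !developE //.
apply: (@le_trans _ _ (\sum_i `[< supp_in T (act w^-1 (r i)) >]%:R * 
   Num.sqrt (sqnorm m (act (word_prod gen u) (cell_point T x) - act (word_prod gen v) (cell_point T y))))%R).
  by apply: ler_sum => i _; apply: depth_lip => //; exact: word_parabolic.
rewrite -mulr_suml ler_wpM2r ?sqrtr_ge0 // -natr_sum ler_nat.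
by rewrite -big_mkcond /= sum1_card; exact: rK.
Qed.

(** ** Roots separating two vertices *)

Lemma depth_vertex1 r w : is_root r -> pos (act w^-1 r) -> depth r (vertex w) = 1%R.
Proof.
move=> rr p; apply: depth1; rewrite dev_vertex.
have [z [s E]] := root_act w^-1 rr; have : (1 <= height (act w^-1 r))%R.
  by rewrite E; apply: (root_height (coxWS := coxWS)); rewrite -E.
by lra.
Qed.

Lemma depth_vertex0 r w : is_root r -> pos (- act w^-1 r)%R -> depth r (vertex w) = 0%R.
Proof.
move=> rr p; apply: depth0; rewrite lerNr -devN dev_vertex actN.
have [z [s E]] := root_neg (root_act w^-1 rr); have : (1 <= height (- act w^-1 r))%R.
  by rewrite E; apply: (root_height (coxWS := coxWS)); rewrite -E.
by lra.
Qed.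

(** The roots in the span of a spherical T are the images under the finite group
    W_T of the simple roots of T. *)
Lemma finite_roots : exists K : nat, forall T (I : finType) (r : I -> V),
  injective r -> (forall i, is_root (r i)) -> spherical gen T ->
  (#|[pred i | `[< supp_in T (r i) >]]| <= K)%N.
Proof.
have /fin_all_exists[K KP] (T : {set S}) : exists k : nat, forall (I : finType) (r : I -> V),
  injective r -> (forall i, is_root (r i)) -> spherical gen T ->
  (#|[pred i | `[< supp_in T (r i) >]]| <= k)%N.
  have [sT|nT] := pselect (spherical gen T); last by exists 0%N => I r _ _ /nT.
  have [e [_ eP]] := spherical_enum sT.
  exists (size [seq act u (alpha t) | u <- e, t <- enum S]) => I r rinj rr _.
  rewrite cardE -(size_map r); apply: uniq_leq_size.
    by rewrite map_inj_uniq // enum_uniq.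
  move=> r' /mapP[i]; rewrite mem_enum inE => Ti -> {r'}.
  have [z [a E]] := rr i; rewrite E in Ti *.
  have [_ [u [t [Tu _ ->]]]] := root_parabolic Ti.
  by apply/allpairsP; exists (u, t); rewrite mem_enum; split=> //; exact/eP.
exists (\sum_T K T)%N => T I r rinj rr sT.
by apply: leq_trans (KP T I r rinj rr sT) _; rewrite (bigD1 T) //= leq_addr.
Qed.

Section ReducedWord.
Variables (n : nat) (l : n.-tuple S).
Hypothesis lred : len coxWS (word_prod gen l) = n.
Local Notation len := (len coxWS).

Lemma reduced_split i : (i <= n)%N ->
  len (word_prod gen (take i l)) = i /\ len (word_prod gen (drop i l)) = (n - i)%N.
Proof.
move=> le_in; have := lred; rewrite -{1}(cat_take_drop i l) word_cat.
have := lenM coxWS (word_prod gen (take i l)) (word_prod gen (drop i l)).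
have := len_word coxWS (take i l); have := len_word coxWS (drop i l).
rewrite size_drop size_takel ?size_tuple //; lia.
Qed.

(** The roots of the walls crossed by the gallery of a word. *)
Definition inversion (i : 'I_n) : V := act (word_prod gen (take i l)) (alpha (tnth l i)).

Lemma drop_inversion (i : 'I_n) : drop i l = tnth l i :: drop i.+1 l.
Proof. by rewrite (tnth_nth (tnth l i)) (drop_nth (tnth l i)) ?size_tuple. Qed.

Lemma take_inversion (i : 'I_n) : take i.+1 l = rcons (take i l) (tnth l i).
Proof. by rewrite (tnth_nth (tnth l i)) (take_nth (tnth l i)) ?size_tuple. Qed.

Lemma inversion_pos i : pos (inversion i).
Proof.
apply/posP_len.
have [-> _] := reduced_split (ltnW (ltn_ord i)).
have [+ _] := reduced_split (ltn_ord i).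
by rewrite take_inversion -cats1 word_cat /= mulg1 => ->.
Qed.

Lemma inversion_neg i : pos (- act (word_prod gen l)^-1 (inversion i))%R.
Proof.
rewrite -{1}(cat_take_drop i l) word_cat invMg actM actK; apply/negVP.
have [_ ->] := reduced_split (ltnW (ltn_ord i)).
have [_] := reduced_split (ltn_ord i).
rewrite drop_inversion /= genK => ->; have := ltn_ord i; lia.
Qed.

(** Two equal roots in the list would allow the deletion of two letters. *)
Lemma inversion_inj : injective inversion.
Proof.
move=> i j; wlog lt_ij : i j / (i < j)%N.
  move=> H E; case: (ltngtP i j) => [/H->//|/H/(_ (esym E))->//|/val_inj//].
move=> E; exfalso.
have : pos (act (word_prod gen (take i.+1 l))^-1 (inversion j)).
  have jE : take j l = take i.+1 l ++ take (j - i.+1) (drop i.+1 l).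
    by rewrite take_drop subnK // -[LHS](cat_take_drop i.+1) take_takel.
  rewrite /inversion jE word_cat actM actK; apply/posP_len.
  have [_ dl] := reduced_split (ltn_ord i).
  have jl : (j < n)%N := ltn_ord j.
  have := reduced_split jl; have := reduced_split (ltnW jl).
  rewrite take_inversion -cats1 jE !word_cat /= mulg1 => -[lj _] [lj1 _].
  have [li _] := reduced_split (ltn_ord i).
  have := lenM coxWS (word_prod gen (take i.+1 l))
     (word_prod gen (take (j - i.+1) (drop i.+1 l)) * gen (tnth l j)).
  rewrite mulgA lj1 li.
  have := len_word coxWS (take (j - i.+1) (drop i.+1 l)).
  rewrite size_takel ?size_drop ?size_tuple; lia.
rewrite -E /inversion take_inversion -cats1 word_cat /= mulg1 invMg genV actM actK.
rewrite act_gen reflection_alpha1 // => /(_ (tnth l i)).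
by rewrite !ffunE eqxx oppr_ge0 ler10.
Qed.

End ReducedWord.

(** The word metric is controlled by the length metric: every cell lies in the
    span of boundedly many roots. *)
Lemma len_chain : exists K : nat, forall v w l, chain (vertex v) (vertex w) l ->
  ((len coxWS (v^-1 * w))%:R <= K%:R * l)%R.
Proof.
have [K KP] := finite_roots; exists K => v w c vw.
have [l ln lw] := len_reduced coxWS (v^-1 * w).
have lred : len coxWS (word_prod gen (in_tuple l)) = size l by rewrite /= lw.
pose r i := act v (inversion (in_tuple l) i).
have rr i : is_root (r i) by apply: root_act; exists (word_prod gen (take i l)), (tnth (in_tuple l) i).
have rinj : injective r by move=> i j /act_inj/(inversion_inj lred).
have -> : (len coxWS (v^-1 * w))%:R =
    (\sum_i (depth (r i) (vertex v) - depth (r i) (vertex w)))%R :> R.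
  rewrite -ln -[in LHS](card_ord (size l)) -sumr_const; apply: eq_bigr => i _.
  rewrite depth_vertex1 ?depth_vertex0 ?subr0 //.
    have -> : w = v * word_prod gen l by rewrite lw mulVKg.
    by rewrite invMg actM actK; exact: (inversion_neg lred).
  by rewrite actK; exact: (inversion_pos lred).
apply: (chain_depth rr _ vw) => T u sT; apply: KP => // [i j /act_inj/rinj//|i].
exact: root_act.
Qed.

(** Each cell is in the span of at most one of the roots that separate the
    powers of st, since these differ by multiples of an isotropic vector. *)
Lemma dihedral_chain s t n l : m s t = None ->
  chain (vertex 1) (vertex ((gen s * gen t) ^+ n)) l -> (n.*2%:R <= l)%R.
Proof.
move=> mst ch; set delta := (alpha s + alpha t)%R.
have dW := act_st_delta R coxWS mst; rewrite -/delta in dW.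
have sW k : act ((gen s * gen t) ^+ k) (alpha s) = (alpha s + k.*2%:R *: delta)%R.
  by have [] := act_st R coxWS mst k.
pose r (k : 'I_n.*2) : V := (alpha s + k%:R *: delta)%R.
have rr k : is_root (r k).
  have := odd_double_half k; case: (odd k) => kE.
    exists ((gen s * gen t) ^+ k./2 * gen s), t.
    have -> : act (((gen s * gen t) ^+ k./2 * gen s)) (alpha t) = 
        act ((gen s * gen t) ^+ k./2) (alpha s + delta)%R.
      rewrite actM act_gen reflection_alpha (_ : gram R m s t = -1)%R; last by rewrite /gram mst.
      by congr act; rewrite /delta; vec.
    by rewrite actD sW dW /r -{1}kE natrD scalerDl scale1r [(delta + _)%R]addrC addrA.
  by exists ((gen s * gen t) ^+ k./2), s; rewrite sW /r -{1}kE.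
have -> : (n.*2%:R = \sum_k (depth (r k) (vertex 1) - depth (r k) (vertex ((gen s * gen t) ^+ n))))%R.
  rewrite -[in LHS](card_ord n.*2) -sumr_const; apply: eq_bigr => k _.
  have dpos := pos_delta R coxWS mst 1; rewrite invg1 act1 in dpos.
  rewrite depth_vertex1 ?depth_vertex0 ?subr0 //; last first.
    by rewrite invg1 act1; apply: posD; [exact: pos_alpha|apply: posZ].
  have -> : r k = act ((gen s * gen t) ^+ n) (- alpha t - (n.*2 - k.+1)%:R *: delta)%R.
    have [_ tW] := act_st R coxWS mst n.
    rewrite actB actN actZ dW tW natrB ?ltn_ord // -natr1 /r -/delta /delta; vec.
  rewrite actK opprB addrC opprK; apply: posD; last by apply: posZ.
  exact: pos_alpha.
rewrite -[l]mul1r; apply: (chain_depth (K := 1) rr _ ch) => T w sT.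
apply/card_le1_eqP => i j; rewrite !inE => Ti Tj; apply/eqP/negPn/negP => ij.
have g0 : act w^-1 delta <> 0%R.
  move=> g0; apply: (delta_neq0 (R := R) coxWS mst).
  by apply: (@act_inj R W S m gen coxWS w^-1); rewrite act0.
suff Td : supp_in T (act w^-1 delta).
  have := form_posdef coxWS sT Td g0.
  by rewrite act_form (form_delta R coxWS mst) ltxx.
have -> : act w^-1 delta = ((i%:R - j%:R)^-1 *: (act w^-1 (r i) - act w^-1 (r j)))%R.
  rewrite -actB -actZ; congr act; rewrite /r opprD addrACA subrr add0r -scalerBl scalerA.
  by rewrite mulVf ?scale1r // subr_eq0 eqr_nat eq_sym; exact: ij.
by apply: suppZ; apply: suppB.
Qed.

End Metric.

(** ** The length metric is a metric quasi-isometric to the word metric *)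

Section LengthMetric.
Variables (R : realType) (W : groupType) (S : finType).
Variables (m : S -> S -> option nat) (gen : S -> W).
Hypothesis coxWS : is_coxeter_system m gen.
Local Notation B := (@form R S m).
Local Notation cone := (cone R gen).
Local Notation davis := (davis R gen).
Local Notation vertex := (@vertex R W S gen).
Local Notation cell_vertex := (@cell_vertex R S m).
Local Notation cell_point := (@cell_point R W S m gen).
Local Notation chain := (@chain_length R W S gen m).
Local Notation dist := (@davis_dist R W S gen m).
Local Notation cdist := (@cell_dist R W S gen m).
Local Notation len := (len coxWS).
Implicit Types (w v : W) (s t : S) (T U : {set S}) (x y : cone) (p q z : davis).
Local Open Scope quotient_scope.
Local Open Scope group_scope.

Let mulg_genK s w : w * gen s * gen s = w := mulg_genK coxWS s w.
Let mxC : is_coxeter_matrix m. Proof. by case: coxWS. Qed.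

Lemma cell_dist_ge0 p q r : cdist p q r -> (0 <= r)%R.
Proof. by move=> [w [T [u [v [x [y [_ _ _ _ ->]]]]]]]; exact: sqrtr_ge0. Qed.

Lemma cell_dist_sym p q r : cdist p q r -> cdist q p r.
Proof.
move=> [w [T [u [v [x [y [sT [Tu Tv] [Tx Ty] [-> ->] ->]]]]]]].
exists w, T, v, u, y, x; split=> //; congr (Num.sqrt _).
by rewrite -opprB !sqnormE formNl formNr opprK.
Qed.

Lemma chain_ge0 p q l : chain p q l -> (0 <= l)%R.
Proof.
elim=> {p q l} // p q z r l /cell_dist_ge0 r0 _ l0; exact: addr_ge0.
Qed.

Lemma chain_cat p q z k l : chain p q k -> chain q z l -> chain p z (k + l)%R.
Proof.
move=> pq; elim: pq l => {p q k} [p l|p q y r k pq _ IH l yz]; first by rewrite add0r.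
by rewrite -addrA; apply: ChainCons pq (IH _ yz).
Qed.

Lemma chain1 p q r : cdist p q r -> chain p q r.
Proof. by move=> pq; rewrite -[r]addr0; exact: (ChainCons pq (@ChainNil R W S gen m q)). Qed.

Lemma chain_sym p q l : chain p q l -> chain q p l.
Proof.
elim=> {p q l} [p|p q z r l pq _ zq]; first exact: ChainNil.
by rewrite addrC; apply: chain_cat zq _; apply: chain1; exact: cell_dist_sym.
Qed.

Definition cell_bound : R :=
  (\sum_(T : {set S}) \sum_(U : {set S}) \sum_(U' : {set S})
    `|B (cell_vertex T - cell_vertex U) (cell_vertex T - cell_vertex U')|)%R.

Lemma cell_point_bound T x : (B (cell_point T x) (cell_point T x) <= cell_bound)%R.
Proof.
rewrite /cell_bound (bigD1 T) //=; apply: ler_wpDr.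
  apply: sumr_ge0 => T' _; apply: sumr_ge0 => U _; apply: sumr_ge0 => U' _.
  exact: normr_ge0.
rewrite {1}/cell_point form_suml; apply: ler_sum => U _.
rewrite formZl /cell_point form_sumr mulr_sumr; apply: ler_sum => U' _.
rewrite formZr mulrA; apply: le_trans (ler_norm _) _; rewrite normrM.
rewrite ger0_norm ?mulr_ge0 ?bcoord_ge0 // ler_piMl ?normr_ge0 //.
by rewrite mulr_ile1 ?bcoord_ge0 ?bcoord_le1.
Qed.

(** There are finitely many shapes of cells, hence a common bound on their
    diameters. *)
Definition diam : R := Num.sqrt (4 * cell_bound)%R.

Lemma diam_ge0 : (0 <= diam)%R. Proof. exact: sqrtr_ge0. Qed.

Lemma cell_dist_le p q r : cdist p q r -> (r <= diam)%R.
Proof.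
move=> [w [T [u [v [x [y [sT [Tu Tv] [Tx Ty] _ ->]]]]]]].
rewrite !(developE coxWS) // ler_wsqrtr // sqnormE.
have Xu := supp_act coxWS (word_parabolic Tu) (cell_point_supp coxWS sT Tx).
have Yv := supp_act coxWS (word_parabolic Tv) (cell_point_supp coxWS sT Ty).
have := form_ge0 coxWS sT (suppD Xu Yv).
have := act_form coxWS (word_prod gen u) (cell_point T x) (cell_point T x).
have := act_form coxWS (word_prod gen v) (cell_point T y) (cell_point T y).
have := cell_point_bound T x; have := cell_point_bound T y.
rewrite !(formDl, formDr, formNl, formNr).
by glra.
Qed.

Lemma cell_dist_vertex w x : exists2 r, cdist (vertex w) (pt w x) r & (r <= diam)%R.
Proof.
have [T xT Tx] := top_ex x; have sT := bcoord_spherical xT.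
have c : cdist (vertex w) (pt w x) (Num.sqrt (sqnorm m
   (develop m T [::] (apex R gen) - develop m T [::] x))).
  exists w, T, [::], [::], (apex R gen), x; split=> //; last by rewrite /= mulg1.
  split=> // U; rewrite bcoord_apex; case: (U =P finset.set0) => [-> _|]; last by rewrite eqxx.
  exact: finset.sub0set.
by eexists; [exact: c|exact: cell_dist_le c].
Qed.

(** The two ends of the edge of type s are half of alpha s and its opposite. *)
Lemma cell_dist_edge w s : cdist (vertex w) (vertex (w * gen s)) 1%R.
Proof.
have sS := spherical1 coxWS s.
have aS : below [set s]%SET (apex R gen).
  move=> U; rewrite bcoord_apex; case: (U =P finset.set0) => [-> _|]; last by rewrite eqxx.
  exact: finset.sub0set.
exists w, [set s]%SET, [::], [:: s], (apex R gen), (apex R gen); split=> //.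
- by rewrite /= inE eqxx.
- by rewrite /= !mulg1.
rewrite !(developE coxWS) // /= mulg1 act1 act_gen reflectionE opprB addrC subrK.
have [Sc Bc] := cell_vertexP R coxWS sS.
have [c0 _] := cell_vertexP R coxWS (spherical0 gen).
have -> : cell_point [set s]%SET (apex R gen) = cell_vertex [set s]%SET.
  rewrite /cell_point (bigD1 finset.set0) //= big1 ?addr0.
    rewrite bcoord_apex eqxx scale1r [X in (_ - X)%R](_ : _ = 0%R) ?subr0 //.
    by apply/ffunP => t; rewrite ffunE c0 ?inE.
  by move=> U /negbTE U0; rewrite bcoord_apex U0 scale0r.
by rewrite Bc ?inE // sqnormE formZl formZr form_alpha1 // !mulr1; rewrite (_ : 2 * _ = 1)%R ?mulr1 ?sqrtr1 //; lra.
Qed.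

Lemma chain_vertices w v : chain (vertex w) (vertex v) (len (w^-1 * v))%:R.
Proof.
have [l ln lv] := len_reduced coxWS (w^-1 * v); rewrite -ln.
have {lv} -> : v = w * word_prod gen l by rewrite lv mulVKg.
elim: l w {ln} => [|s l IH] w /=; first by rewrite mulg1; exact: ChainNil.
by rewrite -natr1 addrC mulgA; apply: ChainCons (cell_dist_edge w s) (IH _).
Qed.

Lemma chain_ex p q : exists l, chain p q l.
Proof.
have [w [x ->]] := davis_surj p; have [v [y ->]] := davis_surj q.
have [r pr _] := cell_dist_vertex w x; have [r' qr _] := cell_dist_vertex v y.
eexists; apply: (chain_cat (chain1 (cell_dist_sym pr))).
exact: chain_cat (chain_vertices w v) (chain1 qr).
Qed.

Lemma dist_le p q l : chain p q l -> (dist p q <= l)%R.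
Proof.
move=> pq; apply: ge_inf => //; exists 0%R => k /=; exact: chain_ge0.
Qed.

Lemma dist_ge p q (c : R) : (forall l, chain p q l -> c <= l)%R -> (c <= dist p q)%R.
Proof.
by move=> H; apply: lb_le_inf; [exact: chain_ex|exact: H].
Qed.

Lemma dist_ge0 p q : (0 <= dist p q)%R.
Proof. by apply: dist_ge => l; exact: chain_ge0. Qed.

Lemma dist_near p q (e : R) : (0 < e)%R -> exists2 l, chain p q l & (l <= dist p q + e)%R.
Proof.
move=> e0; apply: contrapT => H.
have : (dist p q + e <= dist p q)%R; last by rewrite gerDl leNgt e0.
apply: dist_ge => l pq; rewrite leNgt; apply/negP => /ltW le; apply: H.
by exists l.
Qed.

Lemma dist_sym p q : dist p q = dist q p.
Proof.
by apply/eqP; rewrite eq_le; apply/andP; split; apply: dist_ge => l /chain_sym; exact: dist_le.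
Qed.

Lemma dist_tri p q z : (dist p z <= dist p q + dist q z)%R.
Proof.
rewrite -lerBlDr; apply: dist_ge => k pq; rewrite lerBlDl -lerBlDr.
apply: dist_ge => l qz; rewrite lerBlDr addrC.
exact: dist_le (chain_cat pq qz).
Qed.

Lemma dist_vertex w x : (dist (vertex w) (pt w x) <= diam)%R.
Proof. by have [r /chain1/dist_le h /(le_trans h)] := cell_dist_vertex w x. Qed.

Lemma dist_word w v : (dist (vertex w) (vertex v) <= (len (w^-1 * v))%:R)%R.
Proof. exact: dist_le (chain_vertices w v). Qed.

Lemma word_dist_le : exists2 K : R, (0 < K)%R & forall v w,
  ((len (v^-1 * w))%:R <= K * dist (vertex v) (vertex w))%R.
Proof.
have [K KP] := len_chain R coxWS.
exists K.+1%:R%R => [|v w]; first by rewrite ltr0n.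
rewrite mulrC -ler_pdivrMr ?ltr0n //; apply: dist_ge => l vw.
rewrite ler_pdivrMr ?ltr0n // mulrC; apply: le_trans (KP _ _ _ vw) _.
by rewrite ler_wpM2r ?(chain_ge0 vw) // ler_nat.
Qed.

(** The word (st)^n gives the upper bound, the 2n roots that separate the two
    vertices the lower one. *)
Lemma dist_dihedral s t n : m s t = None ->
  dist (vertex 1) (vertex ((gen s * gen t) ^+ n)) = n.*2%:R%R.
Proof.
move=> mst; apply/eqP; rewrite eq_le; apply/andP; split.
  apply: le_trans (dist_word _ _) _; rewrite ler_nat invg1 mul1g.
  have := @len_st R W S m gen coxWS s t mst n 1.
  rewrite invg1 act1 mulg1 len1 addn0 => -> //.
  exact: pos_alpha.
by apply: dist_ge => l; exact: dihedral_chain.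
Qed.

(** ** Sampling a nearly shortest chain *)

(** Consecutive segments are grouped until their total length reaches 1, starting
    from the end; only the first group may be shorter. *)
Lemma chain_sample p q l : chain p q l -> exists n (z : nat -> davis) (c : nat -> R),
  [/\ (0 < n)%N, z 0%N = p, z n = q & c 0%N = 0%R /\ c n = l] /\
  forall i, (i < n)%N -> [/\ (dist (z i) (z i.+1) <= c i.+1 - c i)%R,
    (c i.+1 - c i <= 1 + diam)%R & (0 < i)%N -> (1 <= c i.+1 - c i)%R].
Proof.
elim=> {p q l} [p|p q y r l pq _ [n [z [c [[n0 z0 zn [c0 cn]] H]]]]].
  exists 1%N, (fun=> p), (fun=> 0%R); split=> // i; rewrite ltnS leqn0 => /eqP->.
  rewrite subrr; split=> //; first by apply: dist_le; exact: ChainNil.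
  by apply: addr_ge0 => //; exact: diam_ge0.
have [h0 b0 _] := H 0%N n0; have rd := cell_dist_le pq.
have r1 := dist_le (chain1 pq); have d0 := diam_ge0.
(* A first group of length at least 1 is closed, a shorter one is extended. *)
case: (lerP 1 (c 1%N)) => c1.
  exists n.+1, (fun i => if i is j.+1 then z j else p),
    (fun i => if i is j.+1 then r + c j else 0)%R.
  split; first by rewrite cn.
  case=> [_|i]; first by rewrite z0 c0; split=> //; lra.
  rewrite ltnS => ln; have [hi bi gi] := H i ln.
  have e : (r + c i.+1 - (r + c i) = c i.+1 - c i)%R by lra.
  rewrite e; split=> // _; case: i ln gi {hi bi e} => [|i] _; last by exact.
  by rewrite c0 subr0.
exists n, (fun i => if i is 0 then p else z i), (fun i => if i is 0 then 0 else r + c i)%R.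
split; first by case: n n0 zn cn {H} => // n _ -> ->.
case=> [_|i ln].
  rewrite c0 subr0 in h0 b0; rewrite subr0; split=> //; last by lra.
  by rewrite z0 in h0; have := dist_tri p q (z 1%N); lra.
have [hi bi gi] := H i.+1 ln; have e : (r + c i.+2 - (r + c i.+1) = c i.+2 - c i.+1)%R by lra.
by rewrite e.
Qed.

End LengthMetric.

(** * Geodesics in hyperbolic spaces stay close to quasi-geodesics *)

Section Morse.
Local Open Scope nat_scope.
Variables (X : Type) (d : X -> X -> nat) (D : nat).

(** Twice the Gromov product, which is an integer for integral distances. *)
Definition product2 o x y := d o x + d o y - d x y.

Hypothesis dC : forall x y, d x y = d y x.
Hypothesis d0 : forall x, d x x = 0.
Hypothesis dtri : forall x y z, d x z <= d x y + d y z.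
Hypothesis dgeod : forall x y k, k <= d x y -> exists2 z, d x z + d z y = d x y & d z y = k.
Hypothesis hyp : forall o x y z,
  minn (product2 o x y) (product2 o y z) <= product2 o x z + D.

(** Dichotomy: each halving of the chain costs one application of hyperbolicity. *)
Lemma product_chain o k (z : nat -> X) n : 0 < n <= 2 ^ k ->
  exists2 i, i < n & product2 o (z i) (z i.+1) <= product2 o (z 0) (z n) + k * D.
Proof.
elim: k z n => [|k IH] z n.
  by rewrite expn0 => n1; have -> : n = 1 by [lia]; exists 0; rewrite ?addn0.
rewrite expnS => nk; have [n2|n2] := leqP n (2 ^ k).
  by have [|i ? ?] := IH z n; [lia|exists i => //; lia].
have [|i ik hi] := IH z (2 ^ k); first by rewrite expn_gt0 leqnn.
have [|j jk hj] := IH (fun i => z (2 ^ k + i)) (n - 2 ^ k); first by lia.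
move: hj; rewrite addn0 subnKC ?(ltnW n2) // addnS => hj.
have := hyp o (z 0) (z (2 ^ k)) (z n).
have [h|h] := leqP (product2 o (z 0) (z (2 ^ k))) (product2 o (z (2 ^ k)) (z n)).
  move=> hh; exists i; first by lia.
  by rewrite mulSn; lia.
move=> hh; exists (2 ^ k + j); first by lia.
by rewrite mulSn; lia.
Qed.

Lemma expn_linear (a b k : nat) : 2 ^ k <= a * k + b -> k <= a + b + 4.
Proof.
move=> h; rewrite leqNgt; apply/negP => kb.
have k4 : 4 <= k by lia.
have sq : k * k <= 2 ^ k.
  elim: k k4 {h kb} => // k IH; rewrite leq_eqVlt => /orP[/eqP<-//|k4].
  have := IH k4; rewrite expnS; nia.
have : (a + b + 1) * k <= k * k by rewrite leq_mul2r; lia.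
nia.
Qed.

Definition geodesic x o y := d x o + d o y = d x y.

Section Chain.
Variables (c b : nat) (z : nat -> X) (n : nat).
Hypothesis step : forall i, i < n -> d (z i) (z i.+1) <= c.
Hypothesis speed : forall i j, i <= j -> j <= n -> j - i <= d (z i) (z j) + b.

(** The bound of [expn_linear] for the logarithm of the number of steps of the
    detour considered below. *)
Definition morse_exponent := 3 * D + (9 * D + 6 * c + b) + 4.

(** Some point of the chain between z i and z j has a Gromov product with its
    successor that exceeds that of the ends by a logarithm of the number of steps,
    which is linear in M; but it is at distance at least M. *)
Lemma chain_between o i j M : i <= j -> j <= n -> (forall k, k <= n -> M <= d o (z k)) ->
  product2 o (z i) (z j) <= 2 * D -> d (z i) (z j) <= 6 * M ->
  M <= (morse_exponent + 3) * D + c.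
Proof.
move=> ij jn Mz prod ijM.
case: (ltngtP i j) ij => // [lt_ij|eij] _; last first.
  move: prod (Mz j jn); rewrite /product2 eij d0; nia.
have jb := speed (ltnW lt_ij) jn.
pose k := trunc_log 2 (j - i).
have k1 : 2 ^ k <= j - i by apply: trunc_logP => //; lia.
have k2 : j - i < 2 ^ k.+1 by exact: trunc_log_ltn.
have [|l ll] := @product_chain o k.+1 (fun l => z (i + l)) (j - i); first by lia.
rewrite addn0 subnKC ?(ltnW lt_ij) // addnS => hl.
have M1 : 2 * M <= product2 o (z (i + l)) (z (i + l).+1) + 2 * c.
  have := step (i := i + l); have := Mz (i + l); have := Mz (i + l).+1.
  have := dtri o (z (i + l).+1) (z (i + l)); rewrite /product2 (dC (z (i + l).+1)).
  lia.
have M2 : 2 * M <= (k + 3) * D + 2 * c by nia.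
have : 2 ^ k <= 3 * D * k + (9 * D + 6 * c + b) by nia.
move/expn_linear => kb; rewrite /morse_exponent; nia.
Qed.

Definition morse_bound := (morse_exponent + 3) * D + c + D.

(** Let y be a point of the geodesics at maximal distance M from the chain. The
    detour along the chain between points at distance 2M from y on both sides
    avoids the ball of radius M about y, whereas its number of steps is linear in
    M, and the Gromov product at y only grows with the logarithm of this number. *)
Lemma morse o : geodesic (z 0) o (z n) -> exists2 k, k <= n & d o (z k) <= morse_bound.
Proof.
move=> og; apply: contrapT => far.
pose P M := `[< exists2 o, geodesic (z 0) o (z n) & forall k, k <= n -> M <= d o (z k) >].
have P0 : exists M, P M by exists 0; apply/asboolP; exists o.
have Pb M : P M -> M <= d (z 0) (z n).
  move=> /asboolP[y yg /(_ 0 isT)] yM; apply: leq_trans yM _.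
  by rewrite -yg dC leq_addr.
have [M /asboolP[y yg yM] Mmax] := ex_maxnP P0 Pb.
have : morse_bound < M.
  apply: Mmax; apply/asboolP; exists o => // k kn.
  by rewrite ltnNge; apply/negP => h; apply: far; exists k.
rewrite /morse_bound => Mbig.
have close a : geodesic (z 0) a (z n) -> exists2 k, k <= n & d a (z k) <= M.
  move=> ag; apply: contrapT => af; have : M.+1 <= M; last by rewrite ltnn.
  apply: Mmax; apply/asboolP; exists a => // k kn.
  by rewrite ltnNge; apply/negP => h; apply: af; exists k.
(* a is the point at distance 2M from y towards z 0, or z 0 itself. *)
have [a [i [ag ij ai ay ak]]] : exists a i, [/\ d (z 0) a + d a y = d (z 0) y, i <= n,
   d a (z i) <= M, d a y <= 2 * M & 2 * M <= product2 y a (z i)].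
  have [small|big] := leqP (d (z 0) y) (2 * M).
    exists (z 0), 0; rewrite d0 /product2 d0; split=> //; have := yM 0 isT; lia.
  have [a ag aM] := dgeod (ltnW big).
  have [|i ij ai] := close a.
    have := dtri (z 0) a (z n); have := dtri a y (z n); move: yg; rewrite /geodesic; lia.
  exists a, i; rewrite /product2 (dC y a); split=> //; have := yM i ij; lia.
have [e [j [eg jn ej ey ek]]] : exists e j, [/\ d (z n) e + d e y = d (z n) y, j <= n,
   d e (z j) <= M, d e y <= 2 * M & 2 * M <= product2 y e (z j)].
  have [small|big] := leqP (d (z n) y) (2 * M).
    exists (z n), n; rewrite d0 /product2 d0; split=> //; have := yM n (leqnn n).
    rewrite (dC y); lia.
  have [e eg eM] := dgeod (ltnW big).
  have [|j jn ej] := close e.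
    have := dtri (z 0) e (z n); have := dtri (z 0) y e; move: yg eg eM.
    rewrite /geodesic (dC (z n) y) (dC (z n) e) (dC e y); lia.
  exists e, j; rewrite /product2 (dC y e); split=> //; have := yM j jn; lia.
have ae0 : product2 y a e = 0.
  have := dtri (z 0) a e; have := dtri (z 0) e (z n); move: yg ag eg.
  rewrite /product2 /geodesic (dC (z n) y) (dC (z n) e) (dC e y) (dC y a); lia.
have pC x1 x2 : product2 y x1 x2 = product2 y x2 x1.
  by rewrite /product2 (dC x1) addnC.
have pij : product2 y (z i) (z j) <= 2 * D.
  have := hyp y a (z i) e; have := hyp y (z i) (z j) e.
  rewrite ae0 (pC (z j) e); lia.
have dij : d (z i) (z j) <= 6 * M.
  have := dtri (z i) a (z j); have := dtri a e (z j); have := dtri a y e.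
  rewrite (dC (z i) a) (dC y e); lia.
have [le_ij|/ltnW le_ji] := leqP i j.
  have := chain_between le_ij jn yM pij dij; lia.
rewrite pC in pij; rewrite dC in dij.
have := chain_between le_ji ij yM pij dij; lia.
Qed.

End Chain.

End Morse.

(** * Walls of hyperbolic Coxeter groups *)

Section ProperWalls.
Variables (R : realType) (W : groupType) (S : finType).
Variables (m : S -> S -> option nat) (gen : S -> W).
Hypothesis coxWS : is_coxeter_system m gen.
Local Notation alpha := (@alpha R S).
Local Notation act := (@act R W S m gen coxWS).
Local Notation davis := (davis R gen).
Local Notation vertex := (@vertex R W S gen).
Local Notation dist := (@davis_dist R W S gen m).
Local Notation len := (len coxWS).
Local Notation diam := (@diam R S m).
Implicit Types (w v : W) (s t : S) (p q : davis).
Local Open Scope group_scope.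

Let genV s : (gen s)^-1 = gen s := genV coxWS s.

Let bound (x : R) : nat := Num.bound `|x|%R.

Lemma boundP (x : R) : (x < (bound x)%:R)%R.
Proof. exact: le_lt_trans (ler_norm x) (archi_boundP (normr_ge0 x)). Qed.

Definition wdist v w : nat := len (v^-1 * w).

(** The infimum of the lengths of the words is attained. *)
Lemma word_distE v w : word_dist R gen v w = (wdist v w)%:R%R.
Proof.
rewrite /word_dist /word_length; have [l ln lw] := len_reduced coxWS (v^-1 * w).
apply/eqP; rewrite eq_le; apply/andP; split.
  apply: ge_inf; last by exists l => //; rewrite ln.
  by exists 0%R => _ [k _ <-]; exact: ler0n.
apply: lb_le_inf; first by exists (size l)%:R%R; exists l.
by move=> _ [k /= kw <-]; rewrite ler_nat /wdist -kw; exact: len_word.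
Qed.

Lemma wdistC v w : wdist v w = wdist w v.
Proof. by rewrite /wdist -(lenV coxWS) invMg invgK. Qed.

Lemma wdist0 w : wdist w w = 0%N.
Proof. by rewrite /wdist mulVg len1. Qed.

Lemma wdist_tri u v w : (wdist u w <= wdist u v + wdist v w)%N.
Proof.
have -> : wdist u w = len ((u^-1 * v) * (v^-1 * w)) by rewrite /wdist -mulgA mulVKg.
exact: lenM.
Qed.

Lemma wdist_geod v w k : (k <= wdist v w)%N ->
  exists2 u, (wdist v u + wdist u w = wdist v w)%N & wdist u w = k.
Proof.
move=> kw; have [l ln lw] := len_reduced coxWS (v^-1 * w).
rewrite -/(wdist v w) in ln; pose i := (wdist v w - k)%N.
have E1 : wdist v (v * word_prod gen (take i l)) = len (word_prod gen (take i l)).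
  by rewrite /wdist mulKg.
have E2 : wdist (v * word_prod gen (take i l)) w = len (word_prod gen (drop i l)).
  by rewrite /wdist invMg -mulgA -lw -{2}(cat_take_drop i l) word_cat mulKg.
have := len_word coxWS (take i l); have := len_word coxWS (drop i l).
have := wdist_tri v (v * word_prod gen (take i l)) w.
rewrite -E1 -E2 size_drop size_take_min ln => h1 h2 h3.
by exists (v * word_prod gen (take i l)); move: h1 h2 h3; rewrite /i; lia.
Qed.

Lemma wdist_hyperbolic : hyperbolic_group R gen -> exists D : nat, forall o x y z,
  (minn (product2 wdist o x y) (product2 wdist o y z) <= product2 wdist o x z + D)%N.
Proof.
move=> [e H]; have [D De] : exists D : nat, (2 * e <= D%:R)%R.
  by exists (bound (2 * e)%R); exact/ltW/boundP.
exists D => o x y z.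
have P u v : gromov_product (word_dist R gen) o u v = ((product2 wdist o u v)%:R / 2)%R.
  rewrite /gromov_product !word_distE /product2 natrB ?natrD //.
  by rewrite (wdistC o u); exact: wdist_tri.
have := H o x y z; rewrite !P.
set a := product2 _ _ _ _; set b := product2 _ _ _ _; set c := product2 _ _ _ _ => h.
rewrite -(ler_nat R) natrD.
have [ab|ab] := leqP a b.
  have : (a%:R / 2 <= b%:R / 2 :> R)%R by rewrite ler_wpM2r // ler_nat.
  by move=> /min_idPl E; move: h; rewrite E; lra.
have : (b%:R / 2 <= a%:R / 2 :> R)%R by rewrite ler_wpM2r // ler_nat ltnW.
by move=> /min_idPr E; move: h; rewrite E; lra.
Qed.

Lemma near_vertex p : exists w, (dist (vertex w) p <= diam)%R.
Proof. by have [w [x ->]] := davis_surj p; exists w; exact: dist_vertex. Qed.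

(** If 1 lies on a word geodesic from u to w, then the word geodesics being
    close to shortest paths of the complex, the Gromov product of u and w in
    the length metric is bounded. *)
Lemma product_bound : hyperbolic_group R gen -> exists C : R, forall u w,
  geodesic wdist u 1 w -> (gromov_product dist (vertex 1) (vertex u) (vertex w) <= C)%R.
Proof.
move=> /wdist_hyperbolic[D hD]; have [K K0 KP] := word_dist_le R coxWS.
have dm0 := diam_ge0 R m.
(* c bounds the word length of a step of the sampled chain, whose vertices are
   within the diameter of a cell of its points; b corrects its speed. *)
pose c := bound (K * (1 + 3 * diam))%R.
pose b := bound (2 + 2 * diam)%R.
have cP : (K * (1 + 3 * diam) < c%:R)%R by exact: boundP.
have bP : (2 + 2 * diam < b%:R)%R by exact: boundP.
pose M := morse_bound D c b.
exists (M%:R + diam + 1 / 2)%R => u w uw.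
have [l ul ln] := dist_near coxWS (vertex u) (vertex w) ltr01.
have [n [z [r [[n0 z0 zn [r0 rn]] H]]]] := chain_sample coxWS ul.
(* The vertices near the points of the chain, with the prescribed ends. *)
pose g0 k := projT1 (cid (near_vertex (z k))).
have g0P k : (dist (vertex (g0 k)) (z k) <= diam)%R := projT2 (cid (near_vertex (z k))).
pose g k := if k == 0%N then u else if k == n then w else g0 k.
have dist0 p : (dist p p <= 0)%R by apply: dist_le; exact: ChainNil.
have gP k : (dist (vertex (g k)) (z k) <= diam)%R.
  have dd p : (dist p p <= diam)%R by apply: le_trans (dist0 p) dm0.
  by rewrite /g; case: eqP => [->|_]; [rewrite z0|case: eqP => [->|_]; [rewrite zn|]].
have tri := @dist_tri R W S m gen coxWS; have sym := @dist_sym R W S m gen coxWS.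
have path i k : (i + k <= n)%N -> (dist (z i) (z (i + k)%N) <= r (i + k)%N - r i)%R.
  elim: k => [|k IH] ik; first by rewrite addn0 subrr; exact: dist0.
  have [] := H (i + k)%N; first by lia.
  have := IH (ltnW _); rewrite -addnS ik => /(_ isT).
  by have := tri (z i) (z (i + k)%N) (z (i + k.+1)%N); lra.
have speed i k : (0 < i)%N -> (i + k <= n)%N -> (k%:R <= r (i + k)%N - r i)%R.
  move=> i0; elim: k => [|k IH] ik; first by rewrite addn0 subrr.
  have [|_ _] := H (i + k)%N; first by lia.
  have := IH (ltnW _); rewrite -addnS ik => /(_ isT) h1 /(_ _) h2.
  by have := h2 (leq_trans i0 (leq_addr _ _)); rewrite -natr1; lra.
have short i k : (i + k <= n)%N -> (r (i + k)%N - r i <= dist (z i) (z (i + k)%N) + 1)%R.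
  move=> ik; have h1 := path 0%N i; have h2 := path (i + k)%N (n - (i + k))%N.
  have := tri (z 0%N) (z i) (z n); have := tri (z i) (z (i + k)%N) (z n).
  move: h1 h2; rewrite add0n subnKC // leqnn => /(_ (leq_trans (leq_addr _ _) ik)) h1 /(_ isT) h2.
  by rewrite -z0 -zn in ln; lra.
have step i : (i < n)%N -> (wdist (g i) (g i.+1) <= c)%N.
  move=> li; rewrite -(ler_nat R); apply: le_trans (KP _ _) (le_trans _ (ltW cP)).
  rewrite ler_pM2l //; have [h1 h2 _] := H i li.
  have := tri (vertex (g i)) (z i) (vertex (g i.+1)).
  have := tri (z i) (z i.+1) (vertex (g i.+1)).
  by have := gP i; have := gP i.+1; rewrite (sym (z i.+1)); lra.
have fast i j : (i <= j)%N -> (j <= n)%N -> (j - i <= wdist (g i) (g j) + b)%N.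
  move=> ij jn; rewrite -(ler_nat R) natrD.
  have h : ((j - i)%:R <= r j - r i + 1)%R.
    case: i ij => [|i] ij; last first.
      by have := speed i.+1 (j - i.+1)%N isT; rewrite subnKC // => /(_ jn); lra.
    case: j ij jn => [|j] ij jn; first by rewrite subrr add0r ler01.
    have [h1 _ _] := H 0%N n0; have := speed 1%N j isT jn.
    have := dist_ge0 coxWS (z 0%N) (z 1%N).
    by rewrite subn0 -natr1 add1n; lra.
  have := short i (j - i)%N; rewrite subnKC // => /(_ jn).
  have := tri (z i) (vertex (g i)) (z j); have := tri (vertex (g i)) (vertex (g j)) (z j).
  have := dist_word R coxWS (g i) (g j); have := gP i; have := gP j.
  by rewrite (sym (z i) (vertex _)) /wdist; lra.
have gn : g n = w by rewrite /g eqxx; case: eqP n0 => [->|].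
have [|k kn kM] := morse wdistC wdist0 wdist_tri wdist_geod hD step fast (o := 1).
  by rewrite gn.
rewrite -(ler_nat R) in kM; have := dist_word R coxWS 1 (g k); rewrite -/(wdist 1 (g k)) => h.
have h1 := path 0%N k kn; have h2 := path k (n - k)%N; rewrite subnKC // in h2.
have {}h2 := h2 (leqnn n).
have := tri (vertex 1) (z k) (vertex u); have := tri (vertex 1) (z k) (vertex w).
have := tri (vertex 1) (vertex (g k)) (z k); have := gP k.
rewrite (sym (z k) (vertex u)) -z0 -zn; rewrite -z0 -zn in ln.
by rewrite /gromov_product /M in kM *; lra.
Qed.

Section Ray.
Variables s t : S.
Hypothesis mst : m s t = None.
Let u n : W := (gen s * gen t) ^+ n.

(** The powers of ts move away from the wall of s. *)
Lemma len_ray n w : pos (act w^-1 (alpha s)) -> len ((u n)^-1 * w) = (n.*2 + len w)%N.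
Proof.
rewrite /u -expgVn invMg !genV => ws.
by apply: (@len_st R W S m gen coxWS t s _ n w ws); rewrite (cox_mC coxWS).
Qed.

Lemma ray_geodesic n w : pos (act w^-1 (alpha s)) -> geodesic wdist (u n) 1 w.
Proof.
move=> ws; rewrite /geodesic /wdist (len_ray n ws) (len_ray n); last first.
  by rewrite invg1 act1; exact: pos_alpha.
by rewrite len1 addn0 invg1 mul1g.
Qed.

Lemma ray_converges : converges_at_infinity dist (vertex 1) (vertex \o u).
Proof.
move=> K; exists (bound K) => i j Ki Kj.
have le k l : (k <= l)%N -> (dist (vertex (u k)) (vertex (u l)) <= (l - k).*2%:R)%R.
  move=> kl; apply: le_trans (dist_word R coxWS _ _) _; rewrite ler_nat.
  have -> : u l = u k * u (l - k)%N by rewrite /u -expgD subnKC.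
  rewrite mulKg -(lenV coxWS) -[_^-1]mulg1 len_ray ?len1 ?addn0 //.
  by rewrite invg1 act1; exact: pos_alpha.
have KN := boundP K.
rewrite /gromov_product /= !(dist_dihedral R coxWS) //.
have [ij|/ltnW ij] := leqP i j.
  have := le i j ij; rewrite -!muln2 !natrM natrB //.
  have : ((bound K)%:R <= i%:R :> R)%R by rewrite ler_nat.
  by have : (0 <= i%:R :> R)%R := ler0n _ _; lra.
have := le j i ij; rewrite (dist_sym coxWS) -!muln2 !natrM natrB //.
have : ((bound K)%:R <= j%:R :> R)%R by rewrite ler_nat.
by have : (0 <= j%:R :> R)%R := ler0n _ _; lra.
Qed.

(** The end of the ray is a boundary point of the half-space of W behind the
    wall of s only. *)
Lemma ray_avoids (A : set davis) : hyperbolic_group R gen ->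
  (forall w x, A (pt w x) -> pos (act w^-1 (alpha s))) ->
  gromov_boundary dist (base_vertex R gen) `\`
    boundary_of dist (base_vertex R gen) A !=set0.
Proof.
move=> /product_bound[C HC] Apos; exists (boundary_point dist (vertex 1) (vertex \o u)).
split; first by exists (vertex \o u) => //; exact: ray_converges.
move=> [v [cv Av] E].
have : boundary_point dist (vertex 1) (vertex \o u) v by rewrite -E; split.
move=> [_ /(_ (C + diam + 1)%R)[N]] /(_ N N (leqnn N) (leqnn N)).
have [w [x vE]] := davis_surj (v N).
have wpos := Apos w x; rewrite -vE in wpos.
have := HC _ _ (ray_geodesic N (wpos (Av N))).
have := dist_tri coxWS (vertex 1) (vertex w) (v N).
have := dist_tri coxWS (vertex (u N)) (v N) (vertex w).
have := dist_vertex coxWS w x; rewrite -vE (dist_sym coxWS (v N) (vertex w)).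
by rewrite /gromov_product /=; lra.
Qed.

End Ray.

(** The half-space containing x0 misses the end of the ray (st)^n; in the other one
    t is not a left descent, since s is one, so it misses the end of (ts)^n. *)
Lemma wall_proper s t : m s t = None -> hyperbolic_group R gen ->
  is_proper m (wall_of R gen s).
Proof.
move=> mst hyp A /(wall_components coxWS)[] ->.
  by apply: (ray_avoids mst hyp) => w x; exact: dev_root_gt0.
have mts : m t s = None by rewrite (cox_mC coxWS).
apply: (ray_avoids mts hyp) => w x; rewrite /half_space /= devN oppr_gt0 => h.
case: (root_pos_neg R coxWS w^-1 t) => // wt; exfalso.
apply: (@not_both_descents R W S m gen coxWS s t mst w); split=> //.
case: (root_pos_neg R coxWS w^-1 s) => // ws.
by move: h; rewrite ltNge (dev_root_ge0 _ ws).
Qed.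

End ProperWalls.

Theorem mainTheorem7 (R : realType) (W : groupType) (S : finType)
    (m : S -> S -> option nat) (gen : S -> W)
    (coxWS : is_coxeter_system m gen) :
  (is_rigid m -> Aut_discrete R gen /\ Aut_is_semidirect R gen m)
  /\
  (~ is_rigid m -> hyperbolic_group R gen ->
    (forall (s : S) (f : {perm S}),
        is_diagram_aut m f -> f <> 1%g -> fixes_facet m f s ->
      is_proper m (wall_of R gen s)
      /\ exists phi : cell_aut R gen,
           (forall p, base_star p -> cell_fun phi p = hat f p)
           /\ fixes_strictly (cell_fun phi) (wall_of R gen s))
    /\ Aut_plus R gen m <> [set 1%g]%classic
    /\ ~ Aut_discrete R gen).
Proof.
split=> [rigid|not_rigid hyp].
  by split; [exact: rigid_discrete coxWS rigid|exact: rigid_semidirect coxWS rigid].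
have proper s f : is_diagram_aut m f -> f <> 1%g -> fixes_facet m f s ->
    is_proper m (wall_of R gen s).
  move=> df f1 ff; have [t [_ mst]] := moved_letter ff f1.
  exact: (@wall_proper R W S m gen coxWS s t mst hyp).
have [s [f [df ff f1]]] : exists s (f : {perm S}),
    [/\ is_diagram_aut m f, fixes_facet m f s & f <> 1%g].
  apply: contrapT => H; apply: not_rigid => s f df ff; apply: contrapT => f1.
  by apply: H; exists s, f.
split; [|split].
- move=> {s f df ff f1} s f df f1 ff; split; first exact: proper f1 ff.
  exists (fold_aut R coxWS df ff); split; last exact: fold_aut_strict.
  by move=> p; exact: fold_aut_hat.
- move=> trivial.
  have : Aut_plus R gen m (\pi_(AutP R gen)%qT (fold_aut R coxWS df ff)).
    move=> N [_ sN]; apply: sN; exists (wall_of R gen s); split; last first.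
    - by exists (cell_fun (fold_aut R coxWS df ff)); [eexists|exact: fold_aut_strict].
    - exact: proper f1 ff.
    exists 1%g, s; apply/seteqP; split=> p; rewrite /wall_of /= mul1g invg1 mulg1 //.
  rewrite trivial -(conj_fold1 R coxWS df ff); exact: conj_fold_neq1.
- exact: (@fold_not_discrete R W S m gen coxWS s f df ff f1).
Qed.
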